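(* Let $d\ge 3$ be a fixed integer. Then, as $n\to\infty$ through orders for which the relevant class is nonempty, $$\min_{G\in\mathcal D_{n,d}}\mu(G)=(d-1+o(1))\frac{\pi^2}{n^2},\qquad \min_{G\in\mathcal R_{n,d}}\mu(G)=(c_d+o(1))\frac{\pi^2}{n^2},$$ where $c_d=d-1$ if $d$ is odd and $c_d=2(d-2)$ if $d$ is even.
   Context: All graphs are finite, simple and undirected. For a connected graph $G$, the algebraic connectivity $\mu(G)$ is the second smallest eigenvalue of the Laplacian $\mathsf L(G)=\mathsf D(G)-\mathsf A(G)$ (degree matrix minus adjacency matrix). For $n\ge d+1$, $\mathcal D_{n,d}$ is the class of connected graphs of order $n$ with minimum degree at least $d$, and $\mathcal R_{n,d}$ is the class of connected $d$-regular graphs of order $n$. *)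

(* Defs.v *)
From mathcomp Require Import all_boot all_order all_algebra.
From mathcomp Require Import polyrcf.
From mathcomp Require Import all_classical all_reals all_analysis.

Set Implicit Arguments.
Unset Strict Implicit.
Unset Printing Implicit Defensive.

Import Order.TTheory GRing.Theory Num.Theory.
Import numFieldNormedType.Exports.

Local Open Scope classical_set_scope.
Local Open Scope ring_scope.

Record sgraph (n : nat) := SGraph {
  adj :> rel 'I_n;
  adj_sym : symmetric adj;
  adj_irrefl : irreflexive adj }.

Definition deg (n : nat) (G : sgraph n) (x : 'I_n) : nat := #|[pred y | G x y]|.

(* The empty graph (n = 0) counts as connected here; the classes below only
   contain graphs of order n > d. *)
Definition connected_graph (n : nat) (G : sgraph n) : Prop :=
  forall x y : 'I_n, connect G x y.

Definition degree_mx (R : realType) (n : nat) (G : sgraph n) : 'M[R]_n :=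
  diag_mx (\row_i (deg G i)%:R).

Definition adjacency_mx (R : realType) (n : nat) (G : sgraph n) : 'M[R]_n :=
  \matrix_(i, j) (G i j)%:R.

Definition laplacian (R : realType) (n : nat) (G : sgraph n) : 'M[R]_n :=
  degree_mx R G - adjacency_mx R G.

(* The real eigenvalues of M in nondecreasing order, each repeated according to
   its algebraic multiplicity (rootsR lists the distinct real roots of a nonzero
   polynomial in increasing order). For symmetric M, such as a Laplacian, there
   are n of them. *)
Definition eigenvalues (R : realType) (n : nat) (M : 'M[R]_n) : seq R :=
  flatten [seq nseq (mup x (char_poly M)) x | x <- rootsR (char_poly M)].

(* Second smallest Laplacian eigenvalue (index 1, counting from 0). *)
Definition alg_connectivity (R : realType) (n : nat) (G : sgraph n) : R :=
  (eigenvalues (laplacian R G))`_1.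

Definition min_degree_class (n d : nat) : set (sgraph n) :=
  [set G | [/\ (d < n)%N, connected_graph G & forall x, (d <= deg G x)%N]].

Definition regular_class (n d : nat) : set (sgraph n) :=
  [set G | [/\ (d < n)%N, connected_graph G & forall x, deg G x = d]].

Definition is_minimum (R : realType) (A : set R) (m : R) : Prop :=
  A m /\ lbound A m.

(* min_(G in C n) mu(G) = (c + o(1)) * pi^2 / n^2, where n goes to infinity
   through the orders n such that C n is nonempty. *)
Definition min_alg_connectivity_asymp (R : realType)
    (C : forall n : nat, set (sgraph n)) (c : R) : Prop :=
  exists2 o : nat -> R,
    o n @[n --> within [set n | C n !=set0] \oo] --> (0 : R) &
    forall n : nat, C n !=set0 ->
      is_minimum [set alg_connectivity R G | G in C n]
        ((c + o n) * (pi ^+ 2 / n%:R ^+ 2)).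

(* Main.v *)
Require Import Defs.
From mathcomp Require Import all_boot all_order all_algebra.
From mathcomp Require Import all_classical all_reals all_analysis.
From mathcomp Require Import polyrcf lra zify.

Import Order.TTheory GRing.Theory Num.Theory.
Import numFieldNormedType.Exports.

Local Open Scope classical_set_scope.
Local Open Scope ring_scope.

(* Lower bound.  Order the vertices by a Fiedler vector f and let z be the sorted
   values.  The current through the cut at k, i.e. the sum of the differences
   z_j - z_i over its edges, equals mu times the tail sum of z from k on.  The
   degree condition forces the cuts to be rich on average: wherever the current
   stays below F, z increases by at most F/N per step up to a bounded number of
   steps, where N = d - 1 in general, and N = 2(d - 2) for d-regular graphs with
   d even (then all cuts are even).  Feeding this into blocks of a fixed length K
   bounds the sum of z^2 by (mu/N)(1 + o(1)) times the sum of the squared tail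
   sums, and the discrete Wirtinger inequality for the latter gives
   mu >= (N - o(1)) pi^2/n^2.
   Upper bound.  A long chain of copies of the complete graph on d + 1 vertices in
   which the edges between one vertex and c others (c = 1, or c = 2 if d is even)
   are redirected to the next copy has effective resistance (d+1)/(c(d-c)) per
   period; closing both ends by small blocks and testing with a cosine profile
   gives mu <= c(d-c)(pi/(n - O(1)))^2. *)

(** A weak cut, for instance a bridge, lets z jump by a full F in one step, so the rate F/N holds
    only on average: the dense surroundings of a weak cut must pay for it. The bookkeeping is linear
    programming duality. An edge crossing the cut k spans the gap k and, unless it joins k-1 to k,
    also a neighbouring gap; so weights on the cuts bound sums of gaps. Where no cut is weak, weight
    1 everywhere suffices. Between two weak cuts (a cluster) the extreme vertices send most of their
    edges into the cluster, and these stars span the gaps near the ends so cheaply that the weights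
    may descend to 0 there (the ramp); the saving pays for the weak gaps. For even d and d-regular
    graphs bridges are excluded by parity, but two weak cuts may be adjacent, separated by a single
    vertex; hence the separate accounting of barriers. Blocks enter because the growth bound has an
    additive error, negligible for large K, while tail sums hardly vary over K steps when n is much
    larger than K. *)

Section OrderedGraph.
Variables (R : realFieldType) (n : nat) (e : rel nat) (z : nat -> R).
Hypothesis e_sym : symmetric e.
Hypothesis e_irr : irreflexive e.
Hypothesis z_mono : forall i j, (i <= j)%N -> z i <= z j.

(** * Edge counts, cuts and currents of an ordered graph *)

Definition ecount (a b c d : nat) : nat :=
  (\sum_(a <= i < b) \sum_(c <= j < d) e i j)%N.

(** For [k <= l], the edges that cross all the cuts from [k] to [l]. *)
Definition span2 (k l : nat) : nat := ecount 0 k l n.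

Definition cut (k : nat) : nat := span2 k k.

(** The convention [0.-1 = 0] makes [gap 0] vanish. *)
Definition gap (k : nat) : R := z k - z k.-1.

Definition flux (k : nat) : R :=
  \sum_(0 <= i < k) \sum_(k <= j < n) (e i j)%:R * (z j - z i).

Lemma gap_ge0 k : 0 <= gap k.
Proof. by rewrite subr_ge0 z_mono ?leq_pred. Qed.

Lemma ecount_catl m a b c d : (a <= m)%N -> (m <= b)%N ->
  ecount a b c d = (ecount a m c d + ecount m b c d)%N.
Proof. by move=> am mb; rewrite /ecount (big_cat_nat am mb). Qed.

Lemma ecount_catr m a b c d : (c <= m)%N -> (m <= d)%N ->
  ecount a b c d = (ecount a b c m + ecount a b m d)%N.
Proof.
move=> cm md; rewrite /ecount -big_split /=.
by apply: eq_bigr => i _; rewrite (big_cat_nat cm md).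
Qed.

Lemma ecountC a b c d : ecount a b c d = ecount c d a b.
Proof.
rewrite /ecount exchange_big_nat /=; apply: eq_bigr => i _.
by apply: eq_bigr => j _; rewrite e_sym.
Qed.

Lemma ecount_leq a b c d : (ecount a b c d <= (b - a) * (d - c))%N.
Proof.
rewrite /ecount.
apply: (@leq_trans (\sum_(a <= i < b) (d - c))%N); last by rewrite sum_nat_const_nat.
apply: leq_sum => i _.
apply: (@leq_trans (\sum_(c <= i < d) 1)%N).
  by apply: leq_sum => j _; case: (e i j).
by rewrite sum_nat_const_nat muln1.
Qed.

Lemma ecount_row i c d : ecount i i.+1 c d = (\sum_(c <= j < d) e i j)%N.
Proof. by rewrite /ecount big_nat1. Qed.

Lemma ecount_diag i : ecount i i.+1 i i.+1 = 0%N.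
Proof. by rewrite ecount_row big_nat1 e_irr. Qed.

Lemma ecount_square k r : (ecount k (k + r) k (k + r) <= r * (r - 1))%N.
Proof.
rewrite /ecount.
apply: (@leq_trans (\sum_(k <= i < k + r) (r - 1))%N); last first.
  by rewrite sum_nat_const_nat; lia.
rewrite big_nat [leqRHS]big_nat; apply: leq_sum => i /andP[ki ikr].
rewrite -ecount_row (@ecount_catr i) //; last by lia.
rewrite (@ecount_catr i.+1 _ _ i) // ecount_diag add0n.
have := ecount_leq i i.+1 k i; have := ecount_leq i i.+1 i.+1 (k + r).
lia.
Qed.

Lemma cut_split k r : (k + r <= n)%N ->
  ecount k (k + r) 0 n =
  (ecount 0 k k (k + r) + ecount k (k + r) k (k + r) + ecount k (k + r) (k + r) n)%N.
Proof.
move=> krn; rewrite (@ecount_catr k) //; last by lia.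
rewrite (@ecount_catr (k + r) _ _ k) //; last by lia.
by rewrite (ecountC k (k + r) 0 k) addnA.
Qed.

Lemma ecount_mono a b c d a' b' c' d' : (a' <= a)%N -> (b <= b')%N ->
  (c' <= c)%N -> (d <= d')%N -> (ecount a b c d <= ecount a' b' c' d')%N.
Proof.
move=> aa bb cc dd.
have [ab|ba] := leqP a b; last first.
  by rewrite /ecount (big_geq (ltnW ba)).
have [cd|dc] := leqP c d; last first.
  by rewrite ecountC /ecount (big_geq (ltnW dc)).
rewrite (@ecount_catl a a' b') //; last by lia.
rewrite (@ecount_catl b a b') // (@ecount_catr c a b c' d') //; last by lia.
rewrite (@ecount_catr d a b c d') //; lia.
Qed.

(** Degree sum over the [r] vertices from [k] on: edges inside this window contribute at most
    [r * (r - 1)], and every other edge crosses one of the two bounding cuts. *)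
Lemma cut_boundary d k r : (forall i, (i < n)%N -> (d <= ecount i i.+1 0 n)%N) ->
  (k + r <= n)%N -> (r * d <= cut k + cut (k + r) + r * (r - 1))%N.
Proof.
move=> degd krn.
have : (r * d <= ecount k (k + r) 0 n)%N.
  rewrite /ecount.
  apply: (@leq_trans (\sum_(k <= i < k + r) d)%N).
    by rewrite sum_nat_const_nat; lia.
  rewrite big_nat [leqRHS]big_nat; apply: leq_sum => i /andP[ki ikr].
  by rewrite -ecount_row degd //; lia.
rewrite cut_split //.
have := ecount_square k r.
have : (ecount 0 k k (k + r) <= cut k)%N by apply: ecount_mono.
have : (ecount k (k + r) (k + r) n <= cut (k + r))%N by apply: ecount_mono.
lia.
Qed.

Lemma cut_succl k : (k < n)%N -> cut k = (span2 k k.+1 + ecount k k.+1 0 k)%N.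
Proof.
move=> kn; rewrite /cut /span2 (@ecount_catr k.+1 0 k k) //.
by rewrite (ecountC k k.+1) addnC.
Qed.

Lemma cut_succr k : (k < n)%N -> cut k.+1 = (span2 k k.+1 + ecount k k.+1 k.+1 n)%N.
Proof. by move=> kn; rewrite /cut /span2 (@ecount_catl k). Qed.

Lemma deg_split k : (k < n)%N ->
  ecount k k.+1 0 n = (ecount k k.+1 0 k + ecount k k.+1 k.+1 n)%N.
Proof.
move=> kn; rewrite (@ecount_catr k) //; last exact: ltnW.
by rewrite (@ecount_catr k.+1 _ _ k) // ecount_diag add0n.
Qed.

Lemma natr_ecount a b c d :
  (ecount a b c d)%:R = \sum_(a <= i < b) \sum_(c <= j < d) (e i j)%:R :> R.
Proof. by rewrite /ecount natr_sum; apply: eq_bigr => i _; rewrite natr_sum. Qed.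

Lemma natr_span2 k l :
  (span2 k l)%:R = \sum_(0 <= i < k) \sum_(l <= j < n) (e i j)%:R :> R.
Proof. exact: natr_ecount. Qed.

Lemma gap_leq i j k : (i < k)%N -> (k <= j)%N -> gap k <= z j - z i.
Proof.
move=> ik kj; rewrite /gap lerB // z_mono //; lia.
Qed.

Lemma flux_ge (w : nat -> nat -> R) k :
  (forall i j, (i < k)%N -> (k <= j)%N -> (j < n)%N -> e i j -> w i j <= z j - z i) ->
  \sum_(0 <= i < k) \sum_(k <= j < n) (e i j)%:R * w i j <= flux k.
Proof.
move=> hw; rewrite /flux !big_nat; apply: ler_sum => i /andP[_ ik].
rewrite !big_nat; apply: ler_sum => j /andP[kj jn].
case: (boolP (e i j)) => eij; last by rewrite !mul0r.
by rewrite !mul1r hw.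
Qed.

Lemma cut_gap_flux k : (cut k)%:R * gap k <= flux k.
Proof.
rewrite natr_ecount mulr_suml.
under eq_bigr do rewrite mulr_suml.
by apply: flux_ge => i j ik kj _ _; exact: gap_leq.
Qed.

(** An edge crossing the cut [k] spans [gap k]; it also spans [gap k.-1] if it starts below [k.-1],
    and [gap k.+1] if it ends above [k]. Longer spans are given up, so that the linear program stays
    tridiagonal. *)
Lemma flux_three k : (0 < k)%N -> (k < n)%N ->
  (cut k)%:R * gap k + (span2 k.-1 k)%:R * gap k.-1
    + (span2 k k.+1)%:R * gap k.+1 <= flux k.
Proof.
move=> k0 kn.
pose w i j := gap k + (i < k.-1)%:R * gap k.-1 + (k < j)%:R * gap k.+1 : R.
apply: (@le_trans _ _
  (\sum_(0 <= i < k) \sum_(k <= j < n) (e i j)%:R * w i j)); last first.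
  apply: flux_ge => i j ik kj _ _; rewrite /w.
  have e1 : (i < k.-1)%:R * gap k.-1 <= z k.-1 - z i.
    case: ltnP => h; last by rewrite mul0r subr_ge0 z_mono //; lia.
    by rewrite mul1r; apply: gap_leq => //; lia.
  have e2 : (k < j)%:R * gap k.+1 <= z j - z k.
    case: ltnP => h; last by rewrite mul0r subr_ge0 z_mono //; lia.
    by rewrite mul1r; apply: gap_leq => //; lia.
  by move: e1 e2; rewrite /gap; lra.
have split1 : (span2 k.-1 k)%:R =
    \sum_(0 <= i < k) \sum_(k <= j < n) (e i j)%:R * (i < k.-1)%:R :> R.
  rewrite natr_ecount [RHS](@big_cat_nat _ _ _ k.-1) //=; last by lia.
  rewrite [X in _ + X]big_nat [X in _ + X]big1 ?addr0.
    rewrite !big_nat; apply: eq_bigr => i /andP[_ ik].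
    by apply: eq_bigr => j _; rewrite ik mulr1.
  move=> i /andP[ki _]; apply: big1 => j _.
  by rewrite ltnNge ki mulr0.
have split2 : (span2 k k.+1)%:R =
    \sum_(0 <= i < k) \sum_(k <= j < n) (e i j)%:R * (k < j)%:R :> R.
  rewrite natr_ecount; apply: eq_bigr => i _.
  rewrite [RHS]big_ltn // ltnn mulr0 add0r !big_nat.
  by apply: eq_bigr => j /andP[kj _]; rewrite kj mulr1.
rewrite split1 split2 natr_ecount !mulr_suml -!big_split /=.
apply: ler_sum => i _; rewrite !mulr_suml -!big_split /=.
apply: ler_sum => j _; rewrite /w; lra.
Qed.

Definition coverage (c : nat -> R) (k : nat) : R :=
  (cut k)%:R * c k + (span2 k.-1 k)%:R * c k.-1 + (span2 k k.+1)%:R * c k.+1.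

(** The coefficients of [flux_three] form a symmetric matrix: [span2 k k.+1] couples [k] and [k.+1]
    both ways. The boundary terms vanish because no edge starts below 0 or ends at [n]. *)
Lemma coverageC (c g : nat -> R) :
  \sum_(1 <= k < n) c k * coverage g k = \sum_(1 <= k < n) g k * coverage c k.
Proof.
rewrite /coverage.
under eq_bigr do rewrite !mulrDr.
rewrite !big_split /=.
under [in RHS]eq_bigr do rewrite !mulrDr.
rewrite !big_split /=.
have key (u v : nat -> R) : \sum_(1 <= k < n) u k * ((span2 k.-1 k)%:R * v k.-1) =
    \sum_(1 <= k < n) v k * ((span2 k k.+1)%:R * u k.+1).
  case: (leqP n 1) => n1; first by rewrite !big_geq.
  have nE : n = n.-2.+2 by lia.
  rewrite big_ltn // {1}/span2 {1}/ecount big_geq // mul0r mulr0 add0r.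
  rewrite [in RHS]nE big_nat_recr //= -nE.
  have -> : span2 n.-2.+1 n = 0%N by rewrite /span2 ecountC /ecount big_geq.
  rewrite mul0r mulr0 addr0 big_add1 (_ : n.-1 = n.-2.+1); last by lia.
  by rewrite !big_nat; apply: eq_bigr => k _; lra.
rewrite (key c g) -(key g c).
have -> : \sum_(1 <= i < n) c i * ((cut i)%:R * g i) =
   \sum_(1 <= i < n) g i * ((cut i)%:R * c i) by apply: eq_bigr => i _; lra.
lra.
Qed.

(* Linear programming duality: every choice of weights [c] on the cuts bounds a
   combination of the gaps. *)
Lemma flux_dual (F : R) (c y : nat -> R) :
  (forall k, 0 <= c k) ->
  (forall k, (0 < k < n)%N -> y k <= coverage c k) ->
  (forall k, (0 < k < n)%N -> 0 < c k -> flux k <= F) ->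
  \sum_(1 <= k < n) y k * gap k <= F * \sum_(1 <= k < n) c k.
Proof.
move=> c0 yc fF.
apply: (@le_trans _ _ (\sum_(1 <= k < n) gap k * coverage c k)).
  rewrite !big_nat; apply: ler_sum => k hk.
  by rewrite mulrC ler_wpM2l ?gap_ge0 ?yc.
rewrite -coverageC mulr_sumr !big_nat; apply: ler_sum => k hk.
have := c0 k; rewrite le_eqVlt => /orP[/eqP<-|ck]; first by rewrite mulr0 mul0r.
rewrite [leRHS]mulrC ler_wpM2l // (le_trans _ (fF k hk ck)) //.
by case/andP: hk => k0 kn; exact: flux_three.
Qed.

End OrderedGraph.

(** * Currents carried by the star of one vertex *)

Section Stars.
Variables (R : realFieldType) (n : nat) (e : rel nat) (z : nat -> R).
Hypothesis e_sym : symmetric e.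
Hypothesis z_mono : forall i j, (i <= j)%N -> z i <= z j.
Local Notation ecount := (ecount e).
Local Notation span2 := (span2 n e).
Local Notation gap := (gap R z).
Local Notation flux := (flux R n e z).

Lemma sum_gap a b : (a <= b)%N -> \sum_(a.+1 <= t < b.+1) gap t = z b - z a.
Proof. by move=> ab; rewrite big_add1 /= -telescope_sumr. Qed.

Lemma sum_gap_up k j h : (k <= j)%N ->
  \sum_(0 <= l < h) (k.+1 + l <= j)%:R * gap (k.+1 + l) = z (minn j (k + h)) - z k.
Proof.
move=> kj; elim: h => [|h IH]; first by rewrite big_geq // addn0 (minn_idPr kj) subrr.
rewrite big_nat_recr //= IH.
case: (leqP (k.+1 + h) j) => H.
  rewrite mul1r /gap (_ : minn j (k + h) = k + h)%N; last by lia.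
  rewrite (_ : minn j (k + h.+1) = k.+1 + h)%N; [rewrite addSn /=; lra | lia].
rewrite mul0r addr0 (_ : minn j (k + h) = j)%N; last by lia.
by rewrite (_ : minn j (k + h.+1) = j)%N //; lia.
Qed.

Lemma sum_gap_down k i h : (i <= k)%N ->
  \sum_(0 <= l < h) (i < k - l)%:R * gap (k - l) = z k - z (maxn i (k - h)).
Proof.
move=> ik; elim: h => [|h IH]; first by rewrite big_geq // subn0 (maxn_idPr ik) subrr.
rewrite big_nat_recr //= IH.
case: (ltnP i (k - h)) => H.
  rewrite mul1r /gap (_ : maxn i (k - h.+1) = (k - h).-1)%N; [lra | lia].
by rewrite mul0r addr0 (_ : maxn i (k - h.+1) = i)%N //; lia.
Qed.

(** The upward neighbours of [k] are distinct, so at most [l] of them lie below [k.+1 + l] and at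
    least [h - l] edges of the star span that gap. The edges jumping over [k] span [gap k] in
    addition. *)
Lemma star_up k h : (k < n)%N -> (h <= ecount k k.+1 k.+1 n)%N ->
  \sum_(0 <= l < h) (h - l)%:R * gap (k.+1 + l) + (span2 k k.+1)%:R * gap k
    <= flux k.+1.
Proof.
move=> kn hdeg; rewrite /flux big_nat_recr //= addrC lerD //; last first.
  rewrite natr_span2 mulr_suml !big_nat; apply: ler_sum => i /andP[_ ik].
  rewrite mulr_suml !big_nat; apply: ler_sum => j /andP[kj jn].
  by rewrite ler_wpM2l // gap_leq //; lia.
apply: (@le_trans _ _ (\sum_(k.+1 <= j < n) (e k j)%:R *
   \sum_(0 <= l < h) (k.+1 + l <= j)%:R * gap (k.+1 + l))); last first.
  rewrite !big_nat; apply: ler_sum => j /andP[kj jn].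
  rewrite ler_wpM2l // sum_gap_up; last by lia.
  by rewrite lerB // z_mono // geq_minl.
under [leRHS]eq_bigr do rewrite mulr_sumr.
rewrite exchange_big_nat /= !big_nat; apply: ler_sum => l /andP[_ lh].
under eq_bigr do rewrite mulrA.
rewrite -mulr_suml ler_wpM2r ?gap_ge0 //.
have hn : (h <= n - k.+1)%N.
  by rewrite (leq_trans hdeg) // (leq_trans (ecount_leq _ _ _ _ _)) //; lia.
rewrite (@big_cat_nat _ _ _ (k.+1 + l)) //=; [|lia|lia].
apply: (@le_trans _ _ (\sum_(k.+1 + l <= j < n) (e k j)%:R * (k.+1 + l <= j)%:R)); last first.
  by rewrite lerDr sumr_ge0 // => j _; rewrite mulr_ge0.
rewrite (_ : \sum_(_ <= j < n) _ = (ecount k k.+1 (k.+1 + l) n)%:R); last first.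
  rewrite ecount_row natr_sum !big_nat; apply: eq_bigr => j /andP[-> _].
  by rewrite mulr1.
rewrite ler_nat.
have := hdeg; rewrite (@ecount_catr _ (k.+1 + l)); [|lia|lia].
have := ecount_leq e k k.+1 k.+1 (k.+1 + l); lia.
Qed.

Lemma star_down k h : (k < n)%N -> (h <= ecount k k.+1 0 k)%N ->
  \sum_(0 <= l < h) (h - l)%:R * gap (k - l) + (span2 k k.+1)%:R * gap k.+1
    <= flux k.
Proof.
move=> kn hdeg.
have -> : flux k = \sum_(0 <= i < k) (e i k)%:R * (z k - z i) +
   \sum_(0 <= i < k) \sum_(k.+1 <= j < n) (e i j)%:R * (z j - z i).
  by rewrite -big_split; apply: eq_bigr => i _; rewrite big_ltn.
rewrite lerD //; last first.
  rewrite natr_span2 mulr_suml !big_nat; apply: ler_sum => i /andP[_ ik].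
  rewrite mulr_suml !big_nat; apply: ler_sum => j /andP[kj jn].
  by rewrite ler_wpM2l // gap_leq //; lia.
apply: (@le_trans _ _ (\sum_(0 <= i < k) (e i k)%:R *
   \sum_(0 <= l < h) (i < k - l)%:R * gap (k - l))); last first.
  rewrite !big_nat; apply: ler_sum => i /andP[_ ik].
  rewrite ler_wpM2l // sum_gap_down; last by lia.
  by rewrite lerB // z_mono // leq_maxl.
under [leRHS]eq_bigr do rewrite mulr_sumr.
rewrite exchange_big_nat /= !big_nat; apply: ler_sum => l /andP[_ lh].
under eq_bigr do rewrite mulrA.
rewrite -mulr_suml ler_wpM2r ?gap_ge0 //.
have hn : (h <= k)%N.
  by rewrite (leq_trans hdeg) // (leq_trans (ecount_leq _ _ _ _ _)) //; lia.
rewrite (@big_cat_nat _ _ _ (k - l)) //=; last by lia.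
apply: (@le_trans _ _ (\sum_(0 <= i < k - l) (e i k)%:R * (i < k - l)%:R)); last first.
  by rewrite lerDl sumr_ge0 // => j _; rewrite mulr_ge0.
rewrite (_ : \sum_(_ <= j < _) _ = (ecount k k.+1 0 (k - l))%:R); last first.
  rewrite ecount_row natr_sum !big_nat; apply: eq_bigr => j /andP[_ ->].
  by rewrite mulr1 e_sym.
rewrite ler_nat.
have := hdeg; rewrite (@ecount_catr _ (k - l)) //; last by lia.
have := ecount_leq e k k.+1 (k - l) k; lia.
Qed.

End Stars.

(** * Ramp weights for the gaps of a cluster *)

Section Ramp.
Variable R : realFieldType.

(* The part of the gap [l] of a cluster with gaps [0 .. M] that is not covered by
   the star of the lowest vertex (with [h] edges) and the star of the highest
   vertex (with [h'] edges). *)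
Definition ramp (h h' M l : nat) : R :=
  1 - (h - l)%:R / h%:R - (h' - (M - l))%:R / h'%:R.

Lemma sub_divl (h l : nat) : (0 < h)%N -> (l <= h)%N ->
  (h - l)%:R / h%:R = 1 - l%:R / h%:R :> R.
Proof.
by move=> h0 lh; rewrite natrB // mulrBl divff // pnatr_eq0 -lt0n.
Qed.

Lemma sub_div0 (h l : nat) : (h <= l)%N -> (h - l)%:R / h%:R = 0 :> R.
Proof. by move=> lh; rewrite (eqP lh) mul0r. Qed.

Lemma sub_div_le1 (h l : nat) : (0 < h)%N -> (h - l)%:R / h%:R <= 1 :> R.
Proof.
by move=> h0; rewrite ler_pdivrMr ?ltr0n // mul1r ler_nat leq_subr.
Qed.

Lemma sub_div_ge0 (h l : nat) : 0 <= (h - l)%:R / h%:R :> R.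
Proof. by rewrite divr_ge0. Qed.

(** Where both stars reach, the ramp is [l / h + (M - l) / h' - 1], which is smallest, namely 0, for
    [h = h' = M]. *)
Lemma ramp_ge0 h h' M l : (0 < h)%N -> (0 < h')%N -> (h <= M)%N -> (h' <= M)%N ->
  (l <= M)%N -> 0 <= ramp h h' M l.
Proof.
move=> h0 h0' hM hM' lM; rewrite /ramp.
have [hl|lh] := leqP h l.
  by rewrite (sub_div0 _ _ hl) subr0 subr_ge0 sub_div_le1.
have [hl'|lh'] := leqP h' (M - l).
  by rewrite (sub_div0 _ _ hl') subr0 subr_ge0 sub_div_le1.
rewrite (sub_divl _ _ h0 (ltnW lh)) (sub_divl _ _ h0' (ltnW lh')).
have M0 : (0 < M)%N by apply: leq_trans hM.
have e1 : l%:R / M%:R <= l%:R / h%:R :> R.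
  by rewrite ler_wpM2l // lef_pV2 ?posrE ?ltr0n ?ler_nat.
have e2 : (M - l)%:R / M%:R <= (M - l)%:R / h'%:R :> R.
  by rewrite ler_wpM2l // lef_pV2 ?posrE ?ltr0n ?ler_nat.
have e3 := sub_divl M l M0 lM.
lra.
Qed.

Lemma ramp0 h h' M : (0 < h)%N -> (h' <= M)%N -> ramp h h' M 0 = 0.
Proof.
move=> h0 hM; rewrite /ramp !subn0 (sub_div0 _ _ hM) subr0 divff ?subrr //.
by rewrite pnatr_eq0 -lt0n.
Qed.

Lemma rampM h h' M : (0 < h')%N -> (h <= M)%N -> ramp h h' M M = 0.
Proof.
move=> h0 hM; rewrite /ramp subnn subn0 (sub_div0 _ _ hM) subr0 divff ?subrr //.
by rewrite pnatr_eq0 -lt0n.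
Qed.

Lemma ramp1 h h' M l : (h <= l)%N -> (h' <= M - l)%N -> ramp h h' M l = 1.
Proof. by move=> h1 h2; rewrite /ramp !sub_div0 // !subr0. Qed.

Lemma ramp_rev h h' M l : (l <= M)%N -> ramp h h' M (M - l) = ramp h' h M l.
Proof. by move=> lM; rewrite /ramp subKn //; lra. Qed.

Lemma sum_sub_div (h M : nat) : (0 < h)%N -> (h <= M)%N ->
  \sum_(0 <= l < M.+1) (h - l)%:R / h%:R = (h%:R + 1) / 2 :> R.
Proof.
move=> h0 hM; rewrite -mulr_suml (@big_cat_nat _ _ _ h) //=; last by lia.
rewrite [X in _ + X]big_nat [X in _ + X]big1 ?addr0; last first.
  by move=> l /andP[hl _]; rewrite (eqP hl).
have -> : \sum_(0 <= i < h) (h - i)%:R = h%:R * (h%:R + 1) / 2 :> R.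
  elim: (h) => [|p IH]; first by rewrite big_geq // mul0r mul0r.
  rewrite big_nat_recl // subn0 (eq_bigr (fun i => (p - i)%:R)); last by move=> i _; rewrite subSS.
  rewrite IH -natr1; lra.
by rewrite mulrC !mulrA mulVf ?mul1r // pnatr_eq0 -lt0n.
Qed.

Lemma sum_ramp h h' M : (0 < h)%N -> (0 < h')%N -> (h <= M)%N -> (h' <= M)%N ->
  \sum_(0 <= l < M.+1) ramp h h' M l = M%:R - (h%:R + h'%:R) / 2.
Proof.
move=> h0 h0' hM hM'; rewrite /ramp !sumrB.
rewrite sumr_const_nat subn0 sum_sub_div //.
have -> : \sum_(0 <= i < M.+1) (h' - (M - i))%:R / h'%:R = (h'%:R + 1) / 2 :> R.
  rewrite big_nat_rev /= -(sum_sub_div _ _ h0' hM') !big_nat.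
  by apply: eq_bigr => i /andP[_ iM]; rewrite add0n subSS subKn.
by rewrite -(natr1 M); move: (M%:R : R) (h%:R : R) (h'%:R : R) => u v w; lra.
Qed.

(* A cluster is covered by its two extreme stars, up to the ramp. *)
Lemma ramp_bound (g : nat -> R) (N F H H' : R) h h' M :
  (forall l, 0 <= g l) -> 0 <= N ->
  (0 < h)%N -> (0 < h')%N -> (h <= M)%N -> (h' <= M)%N ->
  \sum_(0 <= l < h) (h - l)%:R * g l <= H ->
  \sum_(0 <= l < h') (h' - l)%:R * g (M - l)%N <= H' ->
  \sum_(0 <= l < M.+1) N * ramp h h' M l * g l
     <= F * \sum_(0 <= l < M.+1) ramp h h' M l ->
  N * \sum_(0 <= l < M.+1) g l
    <= N * (H / h%:R + H' / h'%:R) + F * (M%:R - (h%:R + h'%:R) / 2).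
Proof.
move=> g0 N0 h0 h0' hM hM' hH hH'; rewrite sum_ramp // => hR.
have e1 : \sum_(0 <= l < M.+1) (h - l)%:R / h%:R * g l <= H / h%:R.
  rewrite (@big_cat_nat _ _ _ h) //=; last by lia.
  rewrite [X in _ + X]big_nat [X in _ + X]big1 ?addr0; last first.
    by move=> l /andP[hl _]; rewrite (eqP hl) !mul0r.
  under eq_bigr do rewrite mulrAC.
  by rewrite -mulr_suml ler_wpM2r // invr_ge0.
have e2 : \sum_(0 <= l < M.+1) (h' - (M - l))%:R / h'%:R * g l <= H' / h'%:R.
  rewrite big_nat_rev /= big_nat.
  under eq_bigr => i /andP[_ iM] do rewrite add0n subSS subKn //.
  rewrite -big_nat (@big_cat_nat _ _ _ h') //=; last by lia.
  rewrite [X in _ + X]big_nat [X in _ + X]big1 ?addr0; last first.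
    by move=> l /andP[hl _]; rewrite (eqP hl) !mul0r.
  under eq_bigr do rewrite mulrAC.
  by rewrite -mulr_suml ler_wpM2r // invr_ge0.
have -> : \sum_(0 <= l < M.+1) g l = \sum_(0 <= l < M.+1) (h - l)%:R / h%:R * g l
   + \sum_(0 <= l < M.+1) (h' - (M - l))%:R / h'%:R * g l
   + \sum_(0 <= l < M.+1) ramp h h' M l * g l.
  by rewrite -!big_split; apply: eq_bigr => l _ /=; rewrite /ramp; lra.
have e3 : N * \sum_(0 <= l < M.+1) ramp h h' M l * g l
    <= F * (M%:R - (h%:R + h'%:R) / 2).
  rewrite mulr_sumr; apply: le_trans hR.
  by rewrite le_eqVlt; apply/orP; left; apply/eqP/eq_bigr => l _; rewrite mulrA.
by rewrite mulrDr lerD // ler_wpM2l // lerD.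
Qed.

End Ramp.

(** * Growth across a cluster and across a stretch without weak cuts *)

Section Clusters.
Variables (R : realFieldType) (n : nat) (e : rel nat) (z : nat -> R).
Hypothesis e_sym : symmetric e.
Hypothesis z_mono : forall i j, (i <= j)%N -> z i <= z j.
Local Notation span2 := (span2 n e).
Local Notation cut := (cut n e).
Local Notation gap := (gap R z).
Local Notation flux := (flux R n e z).

Lemma sum_window (f : nat -> R) a L : (0 < a)%N -> (a + L <= n)%N ->
  \sum_(1 <= i < n) (if (a <= i < a + L)%N then f (i - a)%N else 0)
    = \sum_(0 <= l < L) f l.
Proof.
move=> a0 aL; rewrite (@big_cat_nat _ _ _ a) //=; last by lia.
rewrite [X in X + _]big_nat [X in X + _]big1 ?add0r; last first.
  by move=> i /andP[_ ia]; rewrite leqNgt ia.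
rewrite (@big_cat_nat _ _ _ (a + L)) //=; last by lia.
rewrite [X in _ + X]big_nat [X in _ + X]big1 ?addr0; last first.
  by move=> i /andP[ia _]; rewrite [(i < _)%N]ltnNge ia andbF.
rewrite -{1}[a]add0n big_addn addKn !big_nat.
by apply: eq_bigr => l /andP[_ lL]; rewrite addnK (addnC l) leq_addr ltn_add2l lL.
Qed.

Lemma sum_gap_window a L : (0 < a)%N ->
  \sum_(0 <= l < L) gap (a + l) = z (a + L).-1 - z a.-1.
Proof.
move=> a0; have := sum_gap R z a.-1 (a + L).-1.
rewrite (_ : a.-1.+1 = a); last by lia.
rewrite (_ : (a + L).-1.+1 = a + L)%N; last by lia.
move=> <-; last by lia.
rewrite -{2}[a]add0n big_addn addKn.
by apply: eq_bigr => l _; rewrite addnC.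
Qed.

(** The dual weights are the ramp on the cuts of the cluster and 0 elsewhere. Coverage has to be
    checked only for [0 < l < M], since the ramp vanishes at both ends; the two stars pay for the
    rest through [ramp_bound]. *)
Lemma cluster_bound (k M h h' : nat) (N F H H' : R) : 0 <= N ->
  (k + M.+1 < n)%N -> (0 < h)%N -> (0 < h')%N -> (h <= M)%N -> (h' <= M)%N ->
  (forall l, (l <= M)%N -> flux (k.+1 + l) <= F) ->
  (forall l, (0 < l)%N -> (l < M)%N -> N * ramp R h h' M l <=
      (cut (k.+1 + l))%:R * ramp R h h' M l
      + (span2 (k + l) (k.+1 + l))%:R * ramp R h h' M l.-1
      + (span2 (k.+1 + l) (k.+1 + l).+1)%:R * ramp R h h' M l.+1) ->
  \sum_(0 <= l < h) (h - l)%:R * gap (k.+1 + l) <= H ->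
  \sum_(0 <= l < h') (h' - l)%:R * gap (k.+1 + (M - l)) <= H' ->
  N * (z (k + M.+1)%N - z k)
    <= N * (H / h%:R + H' / h'%:R) + F * (M%:R - (h%:R + h'%:R) / 2).
Proof.
move=> N0 kMn h0 h0' hM hM' hflux hcov hH hH'.
have -> : z (k + M.+1)%N - z k = \sum_(0 <= l < M.+1) gap (k.+1 + l).
  by rewrite sum_gap_window // addSn.
apply: ramp_bound => //; first by move=> l; exact: gap_ge0.
pose c i := if (k.+1 <= i < k.+1 + M.+1)%N then ramp R h h' M (i - k.+1) else 0.
have c0 i : 0 <= c i.
  by rewrite /c; case: ifP => // /andP[h1 h2]; apply: ramp_ge0 => //; lia.
have := @flux_dual R n e z e_sym z_mono F c (fun i => N * c i) c0.
have -> : \sum_(1 <= i < n) c i = \sum_(0 <= l < M.+1) ramp R h h' M l.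
  by rewrite (sum_window (fun l => ramp R h h' M l)) //; lia.
have -> : \sum_(1 <= i < n) N * c i * gap i =
   \sum_(0 <= l < M.+1) N * ramp R h h' M l * gap (k.+1 + l).
  rewrite -(@sum_window (fun l => N * ramp R h h' M l * gap (k.+1 + l)) k.+1) //.
  apply: eq_bigr => i _; rewrite /c; case: ifP => [/andP[h1 h2]|_].
    by rewrite subnKC.
  by rewrite mulr0 mul0r.
apply.
- move=> i /andP[i0 iN]; rewrite /coverage {1}/c; case: ifP => [/andP[h1 h2]|_]; last first.
    by rewrite mulr0 !addr_ge0 // mulr_ge0.
  have iE : i = (k.+1 + (i - k.+1))%N by rewrite subnKC.
  have hc : c i = ramp R h h' M (i - k.+1) by rewrite /c h1 h2.
  have [l0|l0] := posnP (i - k.+1).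
    by rewrite l0 ramp0 // mulr0 !addr_ge0 // mulr_ge0.
  have [lM|lM] := leqP M (i - k.+1).
    rewrite (_ : i - k.+1 = M)%N; last by lia.
    by rewrite rampM // mulr0 !addr_ge0 // mulr_ge0.
  have := hcov _ l0 lM; rewrite -iE.
  rewrite (_ : k + (i - k.+1) = i.-1)%N; last by lia.
  rewrite hc (_ : c i.-1 = ramp R h h' M (i - k.+1).-1); last first.
    by rewrite /c ifT; [congr ramp; lia | lia].
  rewrite (_ : c i.+1 = ramp R h h' M (i - k.+1).+1) //.
  by rewrite /c ifT; [congr ramp; lia | lia].
- move=> i _; rewrite /c; case: ifP => [/andP[h1 h2] _|_]; last by rewrite ltxx.
  by rewrite -(subnKC h1); apply: hflux; lia.
Qed.

(** Dual weight 1 on every cut of the window. The first and the last gap have a neighbour without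
    weight; nothing is demanded there, and each is at most [F] because its cut is nonempty. This
    gives the loss [2 * N]. *)
Lemma flat_bound (a L : nat) (N F : R) : 0 <= N -> 0 <= F ->
  (0 < a)%N -> (a + L <= n)%N ->
  (forall i, (a <= i < a + L)%N -> (0 < cut i)%N /\ flux i <= F) ->
  (forall i, (a < i)%N -> (i.+1 < a + L)%N ->
     N <= (cut i)%:R + (span2 i.-1 i)%:R + (span2 i i.+1)%:R) ->
  N * (z (a + L).-1 - z a.-1) <= F * (L%:R + 2 * N).
Proof.
move=> N0 F0 a0 aL hcut hcov.
rewrite -sum_gap_window //.
pose c i : R := if (a <= i < a + L)%N then 1 else 0.
pose y i : R := if (a <= i < a + L)%N then
  (if (0 < i - a)%N && ((i - a).+1 < L)%N then N else 0) else 0.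
have c0 i : 0 <= c i by rewrite /c; case: ifP.
have := @flux_dual R n e z e_sym z_mono F c y c0.
rewrite (sum_window (fun=> 1)) // sumr_const_nat subn0.
have -> : \sum_(1 <= i < n) y i * gap i = \sum_(0 <= l < L)
    (if (0 < l)%N && (l.+1 < L)%N then N else 0) * gap (a + l).
  rewrite -(@sum_window (fun l => (if (0 < l)%N && (l.+1 < L)%N then N else 0) * gap (a + l)) a) //.
  apply: eq_bigr => i _; rewrite /y; case: ifP => [/andP[h1 h2]|_].
    by rewrite subnKC.
  by rewrite mul0r.
move=> key.
have {}key : \sum_(0 <= l < L) (if (0 < l)%N && (l.+1 < L)%N then N else 0) * gap (a + l)
   <= F * L%:R.
  apply: key.
  - move=> i /andP[i0 iN]; rewrite /coverage /y; case: ifP => [/andP[h1 h2]|_]; last first.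
      by rewrite !addr_ge0 // mulr_ge0.
    case: ifP => [/andP[h3 h4]|_]; last by rewrite !addr_ge0 // mulr_ge0.
    rewrite /c !ifT ?mulr1; [|lia..].
    by apply: hcov; lia.
  - move=> i _; rewrite /c; case: ifP => [h _|_]; last by rewrite ltxx.
    by have [] := hcut _ h.
have gapF l : (l < L)%N -> gap (a + l) <= F.
  move=> lL; have [h1 h2] := hcut (a + l)%N ltac:(lia).
  have := cut_gap_flux R n e z z_mono (a + l); have := gap_ge0 R z z_mono (a + l).
  have : 1 <= (cut (a + l))%:R :> R by rewrite ler1n.
  move=> ? ? ?; nra.
rewrite mulr_sumr.
apply: (@le_trans _ _ (\sum_(0 <= l < L) ((if (0 < l)%N && (l.+1 < L)%N then N else 0) * gap (a + l)
   + (l == 0)%N%:R * (N * F) + (l == L.-1)%N%:R * (N * F)))).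
  rewrite !big_nat; apply: ler_sum => l /andP[_ lL].
  have := gapF l lL; have := gap_ge0 R z z_mono (a + l) => g0 gF.
  have NF : N * gap (a + l) <= N * F by rewrite ler_wpM2l.
  have NF0 : 0 <= N * F by rewrite mulr_ge0.
  move: g0 gF NF; case: (posnP l) => [->|l0] g0 gF NF.
    by case: eqP => _ /=; lra.
  case: (ltnP l.+1 L) => hl /=; first by case: eqP => _ /=; lra.
  rewrite (_ : (l == L.-1)%N = true); last by apply/eqP; lia.
  by rewrite mul1r; lra.
rewrite !big_split /= -!mulr_suml.
have sing (p : nat) : \sum_(0 <= l < L) (l == p)%:R <= 1 :> R.
  case: (ltnP p L) => pL.
    rewrite big_mkord (bigD1 (Ordinal pL)) //= eqxx big1 ?addr0 //.
    move=> i hi; case: eqP => // ip; case/eqP: hi; exact: val_inj.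
  by rewrite big_nat big1 // => l /andP[_ lL]; case: eqP => // lp; lia.
have s1 := sing 0%N; have s2 := sing L.-1.
have NF0 : 0 <= N * F by rewrite mulr_ge0.
nra.
Qed.

End Clusters.

Lemma last_between (P : pred nat) (a k : nat) :
  (forall j, (a < j < k)%N -> ~~ P j) \/
  exists2 j, (a < j < k)%N && P j & forall i, (j < i < k)%N -> ~~ P i.
Proof.
elim: k => [|k IH]; first by left => j; rewrite ltn0 andbF.
have [ak|ka] := ltnP a k; last by left => j hj; lia.
have [Pk|nPk] := boolP (P k).
  by right; exists k; [rewrite ak ltnSn | move=> i hi; lia].
case: IH => [none|[j hj jmax]].
  left => j hj; have [->//|jk] := eqVneq j k.
  by apply: none; lia.
right; exists j; first by lia.
move=> i hi; have [->//|ik] := eqVneq i k.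
by apply: jmax; lia.
Qed.

(** * Minimum degree at least d: growth with N = d - 1 *)

Section DensityOne.
Variables (R : realFieldType) (n : nat) (e : rel nat) (z : nat -> R).
Hypothesis e_sym : symmetric e.
Hypothesis e_irr : irreflexive e.
Hypothesis z_mono : forall i j, (i <= j)%N -> z i <= z j.
Local Notation ecount := (ecount e).
Local Notation span2 := (span2 n e).
Local Notation cut := (cut n e).
Local Notation gap := (gap R z).
Local Notation flux := (flux R n e z).
Hypothesis cut_gt0 : forall k, (0 < k < n)%N -> (0 < cut k)%N.

(** Only an edge joining [k.-1] to [k] crosses the cut [k] without reaching further on either side.
    Hence unit weights cover a gap at least [2 * cut k - 1] times, which is at least [d - 1] as soon
    as [2 * cut k >= d]: this is the origin of N and of the threshold for weak cuts. *)
Lemma cut_le_spans k : (0 < k)%N -> (k < n)%N ->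
  (cut k <= span2 k.-1 k + span2 k k.+1 + 1)%N.
Proof.
move=> k0 kn.
have -> : cut k = (span2 k.-1 k + ecount k.-1 k k n)%N.
  by rewrite -[cut k]/(ecount 0 k k n) (@ecount_catl _ k.-1) // leq_pred.
rewrite (@ecount_catr _ k.+1 k.-1 k) //.
have := ecount_leq e k.-1 k k k.+1.
have : (ecount k.-1 k k.+1 n <= span2 k k.+1)%N by apply: ecount_mono.
lia.
Qed.

Lemma gap_le_flux (F : R) k : (0 < k < n)%N -> flux k <= F ->
  gap k <= F / (cut k)%:R.
Proof.
move=> hk fF; rewrite ler_pdivlMr ?ltr0n ?cut_gt0 // mulrC.
exact: le_trans (cut_gap_flux _ _ _ _ z_mono _) fF.
Qed.

Lemma gap_le_flux1 (F : R) k : (0 < k < n)%N -> flux k <= F -> gap k <= F.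
Proof.
move=> hk fF; apply: le_trans (gap_le_flux F k hk fF) _.
have c1 : 1 <= (cut k)%:R :> R by rewrite ler1n cut_gt0.
have F0 : 0 <= F.
  apply: le_trans fF; apply: le_trans (cut_gap_flux _ _ _ _ z_mono _).
  by rewrite mulr_ge0 // gap_ge0.
by rewrite ler_pdivrMr; nra.
Qed.

(** In the application [s] is the size of a weak cut and [h = d - s], so the numerators are N: the
    cost of one star plus half the weak gap against the length saved by the ramp. Cleared of
    denominators, the difference is [(s - 1) * (h * (h - 1) - 2 * s)], which vanishes for a
    bridge. *)
Lemma side_cost (s h : nat) : (0 < s)%N -> (s < h)%N ->
  (h + s - 1)%:R / h%:R + (h + s - 1)%:R / (2 * s%:R) <= h%:R / 2 + 1 :> R.
Proof.
move=> s0 sh.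
have hp : 0 < h%:R :> R by rewrite ltr0n; lia.
have sp : 0 < s%:R :> R by rewrite ltr0n.
rewrite (_ : (h + s - 1)%:R = h%:R + s%:R - 1 :> R); last first.
  by rewrite natrB ?natrD //; lia.
rewrite -(ler_pM2r (_ : 0 < 2 * s%:R * h%:R)); last by nra.
rewrite mulrDl.
rewrite (_ : _ / (2 * s%:R) * _ = (h%:R + s%:R - 1) * h%:R); last first.
  by rewrite mulrA divfK // gt_eqF //; lra.
rewrite (_ : _ / h%:R * _ = (h%:R + s%:R - 1) * (2 * s%:R)); last first.
  by rewrite (mulrC (2 * s%:R) h%:R) (mulrA (_ / h%:R)) divfK // gt_eqF.
have s1 : 1 <= s%:R :> R by rewrite ler1n.
have hs1 : s%:R + 1 <= h%:R :> R by rewrite natr1 ler_nat.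
suff : 0 <= (s%:R - 1) * (h%:R * (h%:R - 1) - 2 * s%:R) :> R by lra.
rewrite mulr_ge0 ?subr_ge0 //; nra.
Qed.


Variable d : nat.
Hypothesis d3 : (3 <= d)%N.
Hypothesis degd : forall i, (i < n)%N -> (d <= ecount i i.+1 0 n)%N.

Let N : R := (d - 1)%:R.

Lemma updeg k : (k < n)%N -> (d - cut k <= ecount k k.+1 k.+1 n)%N.
Proof.
move=> kn; have := degd k kn; rewrite (deg_split _ _ e_irr) //.
by rewrite (cut_succl _ _ e_sym) //; lia.
Qed.

Lemma downdeg k : (k < n)%N -> (d - cut k.+1 <= ecount k k.+1 0 k)%N.
Proof.
move=> kn; have := degd k kn; rewrite (deg_split _ _ e_irr) //.
by rewrite (cut_succr _ _) //; lia.
Qed.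

(** For [1 <= r <= d] one has [r * (d - r + 1) >= d], while two weak cuts have fewer than [d] edges
    together; this contradicts [cut_boundary]. *)
Lemma weak_cuts_far k r : (0 < k)%N -> (0 < r)%N -> (k + r < n)%N ->
  (2 * cut k < d)%N -> (2 * cut (k + r) < d)%N -> (d < r)%N.
Proof.
move=> k0 r0 krn w1 w2; rewrite ltnNge; apply/negP => rd.
have := cut_boundary n e e_sym e_irr d k r degd (ltnW krn).
by nia.
Qed.

(* A cut of size at least [(d - 1) / 2] between two consecutive weak cuts is
   either large itself, or so far from both that the ramp is constant there. *)
Lemma coverage_one k M l (r : nat -> R) :
  r = ramp R (d - cut k) (d - cut (k + M.+2)) M -> (0 < k)%N -> (k + M.+2 < n)%N -> (d <= M.+1)%N ->
  (2 * cut k < d)%N -> (2 * cut (k + M.+2) < d)%N ->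
  (0 < l)%N -> (l < M)%N -> (d <= 2 * cut (k.+1 + l))%N ->
  N * r l <= (cut (k.+1 + l))%:R * r l
    + (span2 (k + l) (k.+1 + l))%:R * r l.-1
    + (span2 (k.+1 + l) (k.+1 + l).+1)%:R * r l.+1.
Proof.
move=> rE k0 kMn dM w1 w2 l0 lM nw.
have c1 : (0 < cut k)%N by apply: cut_gt0; lia.
have c2 : (0 < cut (k + M.+2))%N by apply: cut_gt0; lia.
have r0 i : (i <= M)%N -> 0 <= r i by move=> iM; rewrite rE; apply: ramp_ge0; lia.
have [big|small] := leqP (d - 1) (cut (k.+1 + l)).
  have a1 : N * r l <= (cut (k.+1 + l))%:R * r l.
    by rewrite ler_wpM2r ?ler_nat // r0 // ltnW.
  by rewrite -[leLHS]addr0 -addrA lerD // addr_ge0 // mulr_ge0 // r0 //; lia.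
have b1 := cut_boundary n e e_sym e_irr d k l.+1 degd ltac:(lia).
have b2 := cut_boundary n e e_sym e_irr d (k.+1 + l) (M.+1 - l) degd ltac:(lia).
move: b1 b2; rewrite (_ : k + l.+1 = k.+1 + l)%N; last by lia.
rewrite (_ : k.+1 + l + (M.+1 - l) = k + M.+2)%N; last by lia.
move=> b1 b2.
(* Otherwise the [l.+1 <= d] vertices between the weak cut and this cut of fewer than [d - 1] edges
   would violate [cut_boundary]. The bound [l.-1] makes the ramp equal to 1 at the lower neighbour
   too. *)
have h1 : (d - cut k <= l.-1)%N.
  rewrite leqNgt; apply/negP => H.
  have ld : (l.+1 <= d)%N by lia.
  nia.
have h2 : (d - cut (k + M.+2) <= M - l.+1)%N.
  rewrite leqNgt; apply/negP => H.
  have ld : (M.+1 - l <= d)%N by lia.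
  move: b2; set q := (M.+1 - l)%N in ld *; have q2 : (2 <= q)%N by lia.
  have qd : (d - cut (k + M.+2) > q - 2)%N by lia.
  nia.
rewrite rE !ramp1 ?mulr1; [|lia..].
have := cut_le_spans (k.+1 + l) ltac:(lia) ltac:(lia).
rewrite (_ : (k.+1 + l).-1 = k + l)%N; last by lia.
move=> W; rewrite -!natrD ler_nat; lia.
Qed.

(** A weak gap is shared equally by the clusters on its two sides. The budget is the distance [M.+2]
    of the weak cuts; [side_cost] is applied once at each end. *)
Lemma cluster_one k M F : (0 < k)%N -> (k + M.+2 < n)%N ->
  (2 * cut k < d)%N -> (2 * cut (k + M.+2) < d)%N ->
  (forall i, (k < i < k + M.+2)%N -> (d <= 2 * cut i)%N) ->
  (forall i, (k <= i <= k + M.+2)%N -> flux i <= F) ->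
  N * (z (k + M.+1)%N - z k) + N * gap k / 2 + N * gap (k + M.+2) / 2
    <= F * M.+2%:R.
Proof.
move=> k0 kMn w1 w2 nw fF.
have dM : (d <= M.+1)%N by rewrite -ltnS; apply: weak_cuts_far k0 _ kMn w1 w2.
have k1 : (0 < k < n)%N by lia.
have k2 : (0 < k + M.+2 < n)%N by lia.
have c1 : (0 < cut k)%N by exact: cut_gt0.
have c2 : (0 < cut (k + M.+2))%N by exact: cut_gt0.
have kM1 : (k + M.+1 < n)%N by lia.
have kn : (k < n)%N by lia.
have h1 : (cut k < d - cut k)%N by lia.
have h2 : (cut (k + M.+2) < d - cut (k + M.+2))%N by lia.
have hM1 : (d - cut k <= M)%N by lia.
have hM2 : (d - cut (k + M.+2) <= M)%N by lia.
have d1 : (d - cut k + cut k - 1 = d - 1)%N by lia.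
have d2 : (d - cut (k + M.+2) + cut (k + M.+2) - 1 = d - 1)%N by lia.
have in1 : (k <= k <= k + M.+2)%N by lia.
have in2 : (k <= k + M.+2 <= k + M.+2)%N by lia.
have in3 : (k <= k.+1 <= k + M.+2)%N by lia.
have in4 : (k <= k + M.+1 <= k + M.+2)%N by lia.
have in5 l : (l <= M)%N -> (k <= k.+1 + l <= k + M.+2)%N by lia.
have in6 l : (l < M)%N -> (k < k.+1 + l < k + M.+2)%N by lia.
have h10 := leq_ltn_trans (leq0n _) h1.
have h20 := leq_ltn_trans (leq0n _) h2.
have F0 : 0 <= F.
  apply: le_trans (fF k in1).
  apply: le_trans (cut_gap_flux _ _ _ _ z_mono _).
  by rewrite mulr_ge0 // gap_ge0.
have star1 := star_up R n e z z_mono k (d - cut k) kn (updeg k kn).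
have star2 := star_down R n e z e_sym z_mono _ _ kM1 (downdeg _ kM1).
rewrite -addnS in star2.
have g1 := gap_ge0 R z z_mono k.
have g2 := gap_ge0 R z z_mono (k + M.+2).
have key : N * (z (k + M.+1)%N - z k) <= N * (F / (d - cut k)%:R + F / (d - cut (k + M.+2))%:R)
    + F * (M%:R - ((d - cut k)%:R + (d - cut (k + M.+2))%:R) / 2).
  apply: (@cluster_bound R n e z e_sym z_mono k M) => //.
  - by move=> l lM; apply/fF/in5.
  - by move=> l l0 lM; apply: coverage_one => //; apply/nw/in6.
  - by apply: le_trans (fF _ in3); apply: le_trans star1; rewrite lerDl mulr_ge0.
  - apply: le_trans (fF _ in4); apply: le_trans star2; rewrite -[leLHS]addr0 lerD //; last first.
      by rewrite mulr_ge0 // gap_ge0.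
    rewrite le_eqVlt; apply/orP; left; apply/eqP; rewrite !big_nat; apply: eq_bigr => l /andP[_ hl].
    congr (_ * gap _); clear -hl hM2; lia.
have G1 := gap_le_flux F k k1 (fF k in1).
have G2 := gap_le_flux F (k + M.+2) k2 (fF (k + M.+2)%N in2).
have S1 := side_cost (cut k) (d - cut k) c1 h1.
have S2 := side_cost (cut (k + M.+2)) (d - cut (k + M.+2)) c2 h2.
move: S1 S2; rewrite d1 d2.
rewrite -/N !invfM => S1 S2.
have N0 : 0 <= N by exact: ler0n.
have {}G1 : N * gap k <= N * (F / (cut k)%:R) by rewrite ler_wpM2l.
have {}G2 : N * gap (k + M.+2) <= N * (F / (cut (k + M.+2))%:R) by rewrite ler_wpM2l.
have {}S1 := ler_wpM2l F0 S1.
have {}S2 := ler_wpM2l F0 S2.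
rewrite (_ : M.+2%:R = M%:R + 2 :> R); last by rewrite -addn2 natrD.
move: key G1 G2 S1 S2.
move: ((d - cut k)%:R : R) ((d - cut (k + M.+2))%:R : R) => h h'.
move: (h^-1) (h'^-1) ((cut k)%:R^-1 : R) ((cut (k + M.+2))%:R^-1 : R) => u u' v v'.
lra.
Qed.

(** The clusters between consecutive weak cuts are paid for exactly. The additive term comes from
    the ends: [flat_bound] before the first and after the last weak cut costs [2 * N] each time, and
    the unshared halves of the two extreme weak gaps at most [N / 2] each. *)
Lemma density_one a b F : (a <= b)%N -> (b < n)%N -> 0 <= F ->
  (forall k, (a < k <= b)%N -> flux k <= F) ->
  N * (z b - z a) <= F * ((b - a)%:R + 6 * N).
Proof.
move=> ab bn F0 fF.
have N0 : 0 <= N by exact: ler0n.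
have NF0 : 0 <= N * F by rewrite mulr_ge0.
pose weak k := (2 * cut k < d)%N.
have flat p L : (a <= p)%N -> (p + L <= b)%N ->
    (forall j, (p < j < (p + L).+1)%N -> ~~ weak j) ->
    N * (z (p + L)%N - z p) <= F * (L%:R + 2 * N).
  move=> ap pLb nw.
  have -> : (p + L)%N = (p.+1 + L).-1 by rewrite addSn.
  apply: (@flat_bound R n e z e_sym z_mono p.+1 L N F); rewrite ?ltnS //; first by lia.
    by move=> i hi; split; [apply: cut_gt0; lia | apply: fF; lia].
  move=> i pi iL; have := cut_le_spans i ltac:(lia) ltac:(lia).
  have := nw i ltac:(lia); rewrite /weak -leqNgt => ci W.
  by rewrite -!natrD ler_nat; lia.
have gapF k : (a < k <= b)%N -> N * gap k <= N * F.
  move=> hk; rewrite ler_wpM2l // gap_le_flux1 //; last by apply: fF.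
  by lia.
(* Induction over the weak cuts; half of [gap k] is left for the cluster above [k]. *)
have P k : (a < k <= b)%N -> weak k ->
    N * (z k.-1 - z a) + N * gap k / 2 <= F * ((k - a)%:R + 3 * N).
  elim/ltn_ind: k => k IH hk wk.
  have [none|[j /andP[hj wj] jmax]] := last_between weak a k.
    have := flat a (k.-1 - a)%N ltac:(lia) ltac:(lia).
    rewrite (_ : a + (k.-1 - a) = k.-1)%N; last by lia.
    rewrite prednK; last by lia.
    move=> /(_ none) f1; have := gapF k hk.
    have e1 : (k.-1 - a)%:R <= (k - a)%:R :> R by rewrite ler_nat; lia.
    have := ler_wpM2l F0 e1; nra.
  have I1 := IH j ltac:(lia) ltac:(lia) wj.
  have jk : (d < k - j)%N.
    apply: (weak_cuts_far j) => //; try lia.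
    by rewrite subnKC //; lia.
  have := @cluster_one j (k - j).-2 F ltac:(lia).
  rewrite (_ : (k - j).-2.+2 = k - j)%N; last by lia.
  rewrite subnKC; last by lia.
  rewrite (_ : (j + (k - j).-2.+1 = k.-1)%N); last by lia.
  move=> /(_ ltac:(lia) wj wk) cl.
  have {}cl : N * (z k.-1 - z j) + N * gap j / 2 + N * gap k / 2 <= F * (k - j)%:R.
    apply: cl => i hi; last by apply: fF; lia.
    by have := jmax i hi; rewrite -leqNgt.
  have e1 : (k - a)%:R = (k - j)%:R + (j - a)%:R :> R by rewrite -natrD; congr _%:R; lia.
  move: cl I1; rewrite e1 /gap; lra.
have [none|[j /andP[hj wj] jmax]] := last_between weak a b.+1.
  have := flat a (b - a)%N ltac:(lia) ltac:(lia).
  rewrite subnKC // => /(_ none) f1; nra.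
have I1 := P j ltac:(lia) wj.
have := flat j (b - j)%N ltac:(lia) ltac:(lia).
rewrite subnKC; last by lia.
move=> /(_ jmax) f1.
have := gapF j ltac:(lia).
have e1 : (b - a)%:R = (b - j)%:R + (j - a)%:R :> R by rewrite -natrD; congr _%:R; lia.
move: f1 I1; rewrite e1 /gap; nra.
Qed.

End DensityOne.

(** * Even d: cost of a barrier at one end of a cluster *)

Section SideCosts.
Variables (R : realFieldType) (d : nat).
Hypothesis d4 : (4 <= d)%N.
Let D : R := (d - 2)%:R.

(* [s] is the size of a weak cut below a cluster, [g <= F / s] the corresponding
   gap, [J] bounds the number of edges of the cut at the lowest vertex of the
   cluster, and [w] is the part of the length of the barrier below the cluster
   that is charged to the cluster. The barrier is either a single cut or a cut
   vertex between two weak cuts of sizes [t] and [s]. *)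
Definition barrier_side (F : R) (s J : nat) (g w : R) : Prop :=
  [/\ (0 < J)%N, (2 * J <= s)%N, (s <= d - 2)%N, 0 <= g <= F / s%:R &
    (s = (2 * J)%N /\ w = g / 2) \/
    exists t, [/\ (2 * J <= t)%N, (t <= d - 2)%N, (s + t = d - 2 + 2 * J)%N &
      w = g - F / s%:R + (F / s%:R + F / t%:R - F / (2 * D)) / 2]].

Lemma D_ge2 : 2 <= D. Proof. by rewrite ler_nat; lia. Qed.

(** With the sum of [s] and [t] fixed, the reciprocals are largest at the extreme sizes [2 * J] and
    [d - 2]; the inequality amounts to [(s - 2 * J) * (t - 2 * J) >= 0]. *)
Lemma harmonic_pair (J s t : nat) : (0 < J)%N -> (2 * J <= s)%N -> (2 * J <= t)%N ->
  (s + t = d - 2 + 2 * J)%N ->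
  D * (s%:R^-1 + t%:R^-1) <= 1 + D * J%:R^-1 / 2.
Proof.
move=> J0 Js Jt st.
have Jp : 1 <= J%:R :> R by rewrite ler1n.
have sJ : 2 * J%:R <= s%:R :> R by rewrite -natrM ler_nat.
have tJ : 2 * J%:R <= t%:R :> R by rewrite -natrM ler_nat.
have stR : s%:R + t%:R = D + 2 * J%:R by rewrite -natrD st natrD natrM.
have sp : 0 < s%:R :> R by lra.
have tp : 0 < t%:R :> R by lra.
rewrite -(ler_pM2r (_ : 0 < 2 * J%:R * (s%:R * t%:R))); last first.
  by rewrite mulr_gt0 ?mulr_gt0 //; lra.
have es : s%:R * s%:R^-1 = 1 :> R by rewrite mulfV ?gt_eqF.
have et : t%:R * t%:R^-1 = 1 :> R by rewrite mulfV ?gt_eqF.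
have eJ : J%:R * J%:R^-1 = 1 :> R by rewrite mulfV // gt_eqF //; lra.
have -> : D * (s%:R^-1 + t%:R^-1) * (2 * J%:R * (s%:R * t%:R)) =
   2 * J%:R * D * (t%:R * (s%:R * s%:R^-1) + s%:R * (t%:R * t%:R^-1)) by lra.
have -> : (1 + D * J%:R^-1 / 2) * (2 * J%:R * (s%:R * t%:R)) =
   s%:R * t%:R * (2 * J%:R + D * (J%:R * J%:R^-1)) by lra.
rewrite es et eJ.
have : 0 <= (s%:R - 2 * J%:R) * (t%:R - 2 * J%:R) :> R by rewrite mulr_ge0 ?subr_ge0.
have eD : D = s%:R + t%:R - 2 * J%:R by lra.
rewrite eD; nra.
Qed.

Lemma side_quad (J : nat) : (0 < J)%N -> (2 * J <= d - 2)%N ->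
  D * (d - J)%:R^-1 + D * J%:R^-1 / 2 <= ((d - J)%:R + 1) / 2.
Proof.
move=> J0 Jd.
have Jp : 1 <= J%:R :> R by rewrite ler1n.
have hJ : J%:R + 2 <= (d - J)%:R :> R.
  by rewrite -natrD ler_nat; lia.
have eD : D = (d - J)%:R + J%:R - 2.
  rewrite -natrD -natrB; last by lia.
  by congr _%:R; lia.
move: hJ eD; set h : R := (d - J)%:R => hJ eD.
have eJ : J%:R * J%:R^-1 = 1 :> R by rewrite mulfV // gt_eqF //; lra.
have eh : h * h^-1 = 1 :> R by rewrite mulfV // gt_eqF //; lra.
rewrite -(ler_pM2r (_ : 0 < 2 * (h * J%:R))); last by nra.
have -> : (D * h^-1 + D * J%:R^-1 / 2) * (2 * (h * J%:R)) =
   D * (2 * J%:R * (h * h^-1) + h * (J%:R * J%:R^-1)) by lra.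
rewrite eJ eh eD.
have [->|] := eqVneq J 1%N; first by nra.
move=> J1; have J2 : 2 <= J%:R :> R by rewrite ler_nat; lia.
suff : 0 <= (J%:R - 1) * (h * (h - 2)) - 2 * (J%:R * (J%:R - 2)) :> R by lra.
have : J%:R * (J%:R + 2) <= h * (h - 2) :> R by nra.
nra.
Qed.

Lemma side_deg (J : nat) : (0 < J)%N -> (2 * J <= d - 2)%N ->
  2 * D * (d - J)%:R^-1 <= (d - J)%:R / 2 + 1.
Proof.
move=> J0 Jd.
have hJ : D + 4 <= 2 * (d - J)%:R :> R.
  by rewrite -natrD -natrM ler_nat; lia.
have D2 := D_ge2.
move: hJ; set h : R := (d - J)%:R => hJ.
have hp : 0 < h by lra.
have eh : h * h^-1 = 1 :> R by rewrite mulfV // gt_eqF.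
rewrite -(ler_pM2r (_ : 0 < h)); last by lra.
rewrite (_ : 2 * D * h^-1 * h = 2 * D * (h * h^-1)); last by lra.
rewrite eh.
have : 0 <= (2 * h - (D + 4)) * (2 * h + (D + 4)) by rewrite mulr_ge0; lra.
have : 0 <= (D - 2) ^+ 2 by rewrite sqr_ge0.
lra.
Qed.

(** The left side is affine in [g], so only the ends of its range count: [g = F / s] is settled by
    [side_quad], with [harmonic_pair] for a cut vertex, and [g = 0] by [side_deg]. *)
Lemma barrier_side_cost (F : R) (s J : nat) (g w : R) : 0 <= F ->
  barrier_side F s J g w ->
  2 * D * ((F - (s - J)%:R * g) / (d - J)%:R) + 2 * D * w
    <= F * ((d - J)%:R / 2 + 1).
Proof.
move=> F0 [J0 Js sd /andP[g0 gF] side].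
have D2 := D_ge2.
have Jd : (2 * J <= d - 2)%N by lia.
have Q := ler_wpM2l F0 (side_quad J J0 Jd).
have P := ler_wpM2l F0 (side_deg J J0 Jd).
have Jp : 1 <= J%:R :> R by rewrite ler1n.
have hp : 0 < (d - J)%:R :> R by rewrite ltr0n; lia.
have eh : (d - J)%:R * (d - J)%:R^-1 = 1 :> R by rewrite mulfV // gt_eqF.
have sJ : 2 * J%:R <= s%:R :> R by rewrite -natrM ler_nat.
have es : s%:R * s%:R^-1 = 1 :> R by rewrite mulfV // gt_eqF //; lra.
have eb : (s - J)%:R = s%:R - J%:R :> R by rewrite natrB //; clear -Js; lia.
have bh : (s - J)%:R <= (d - J)%:R :> R by rewrite ler_nat; clear -sd; lia.
have hi : 0 < (d - J)%:R^-1 :> R by rewrite invr_gt0.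
have sp : 0 < s%:R :> R by lra.
have gs : g * s%:R <= F by rewrite -ler_pdivlMr.
case: side => [[sE ->]|[t [Jt td st ->]]].
  have sER : s%:R = 2 * J%:R :> R by rewrite sE natrM.
  move: Q P hi; set u := (d - J)%:R^-1; set h := (d - J)%:R => Q P hi.
  have eJ : J%:R * J%:R^-1 = 1 :> R by rewrite mulfV // gt_eqF //; lra.
  have gJ : g <= F * J%:R^-1 / 2.
    rewrite -(ler_pM2r (_ : 0 < 2 * J%:R)); last by lra.
    rewrite (_ : F * J%:R^-1 / 2 * (2 * J%:R) = F * (J%:R * J%:R^-1)); last by lra.
    by rewrite eJ mulr1 -sER.
  rewrite eb sER (_ : 2 * J%:R - J%:R = J%:R); last by lra.
  have [co|co] := lerP (1 / 2) (J%:R * u).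
    apply: le_trans P.
    have : 0 <= D * (g * (2 * (J%:R * u) - 1)) by rewrite mulr_ge0 ?mulr_ge0 //; lra.
    by lra.
  have : 0 <= D * ((F * J%:R^-1 / 2 - g) * (1 - 2 * (J%:R * u))).
    by rewrite mulr_ge0 ?mulr_ge0 //; lra.
  rewrite (_ : (F * J%:R^-1 / 2 - g) * (1 - 2 * (J%:R * u)) =
     F * J%:R^-1 / 2 - g - F * (J%:R * J%:R^-1) * u + 2 * (J%:R * u) * g); last by lra.
  by rewrite eJ; nra.
have H := ler_wpM2l F0 (harmonic_pair J s t J0 Js Jt st).
have eD : D * D^-1 = 1 by rewrite mulfV // gt_eqF //; lra.
rewrite invfM.
rewrite -/D in H Q P.
move: Q P H hi eh bh; set u := (d - J)%:R^-1; set h := (d - J)%:R => Q P H hi eh bh.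
have gv : g <= F * s%:R^-1 by exact: gF.
have sv : s%:R^-1 <= J%:R^-1 / 2 :> R.
  rewrite -invfM mulrC lef_pV2 ?posrE //; lra.
have c1 : (s - J)%:R * u <= 1.
  by apply: (@le_trans _ _ (h * u)); [rewrite ler_wpM2r // ltW | rewrite eh].
have e1 : 0 <= D * ((F * s%:R^-1 - g) * (1 - (s - J)%:R * u)).
  by rewrite mulr_ge0 ?mulr_ge0 //; lra.
have Jv : J%:R * s%:R^-1 <= 1 / 2 :> R by nra.
have e2 : D * (F * u * (J%:R * s%:R^-1)) <= D * (F * u * (1 / 2)).
  by rewrite ler_wpM2l ?ler_wpM2l ?mulr_ge0 //; lra.
have e3 : F * s%:R^-1 * (s%:R * u) = F * u.
  by rewrite (_ : _ * _ * _ = F * u * (s%:R * s%:R^-1)); [rewrite es mulr1 | lra].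
have e4 : 2 * D * (F * (2^-1 * D^-1)) = F.
  by rewrite (_ : _ * _ = F * (D * D^-1)); [rewrite eD mulr1 | lra].
move: e1 e2; rewrite eb => e1 e2.
have e5 : D * (F * s%:R^-1 * (s%:R * u)) = D * (F * u) by rewrite e3.
have e6 : 2 * D * ((F / s%:R + F / t%:R - F * (2^-1 / D)) / 2) = D * (F / s%:R + F / t%:R) - F / 2.
  by move: e4; clear; lra.
rewrite [2 * D * (_ - _ + _)]mulrDr e6.
lra.
Qed.

End SideCosts.

(** * Even d: two weak cuts at distance exactly d *)

Section SmallCluster.
Variables (R : realFieldType).

Lemma small_budget_real (D a b K av bv X : R) : 2 <= a -> 2 <= b -> 4 <= K ->
  2 * a <= D -> 2 * b <= D -> a + b + K = D + 4 ->
  a * av = 1 -> b * bv = 1 -> K * X = D ->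
  D * (av + bv) / 2 + 2 * X <= D + 1 /\ D * (av + bv) / 2 + 4 * X <= D + 4.
Proof.
move=> a2 b2 K4 aD bD E ea eb eX.
have av0 : 0 < av by nra.
have bv0 : 0 < bv by nra.
have av1 : av <= 1 / 2 by nra.
have bv1 : bv <= 1 / 2 by nra.
have X0 : 0 <= X by nra.
split.
  have : X <= D / 4 by nra.
  by nra.
have q0 : 0 <= K - 4 by lra.
have hX : 4 * X <= a + b by nra.
have e1 : D * av <= 2 + 2 * ((K - 4) * av).
  have : (D - 2 * a - 2 * (K - 4)) * av <= 0 by rewrite mulr_le0_ge0 //; lra.
  rewrite (_ : (D - 2 * a - 2 * (K - 4)) * av = D * av - 2 * (a * av) - 2 * ((K - 4) * av)); last by lra.
  by rewrite ea; lra.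
have e2 : D * bv <= 2 + 2 * ((K - 4) * bv).
  have : (D - 2 * b - 2 * (K - 4)) * bv <= 0 by rewrite mulr_le0_ge0 //; lra.
  rewrite (_ : (D - 2 * b - 2 * (K - 4)) * bv = D * bv - 2 * (b * bv) - 2 * ((K - 4) * bv)); last by lra.
  by rewrite eb; lra.
have e3 : (K - 4) * av <= (K - 4) / 2 by nra.
have e4 : (K - 4) * bv <= (K - 4) / 2 by nra.
lra.
Qed.

Lemma small_budget_one (D b K bv X : R) : 3 <= b -> 2 * b <= D ->
  K + b = D + 3 -> b * bv = 1 -> K * X = D ->
  D * (1 + bv) / 2 + 2 * X <= D + 1 /\ D * (1 + bv) / 2 + 4 * X <= D + 4.
Proof.
move=> b3 bD E eb eX.
have bv0 : 0 < bv by nra.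
have bv1 : bv <= 1 / 3 by nra.
have X0 : 0 < X by nra.
have hX : X * (D + 6) <= 2 * D by nra.
have hDb : D * bv <= D / 3 by nra.
have h1 : 2 * X <= D / 3 + 1.
  rewrite -(ler_pM2r (_ : 0 < D + 6)); last by lra.
  have := sqr_ge0 (D - 3 / 2); rewrite expr2; lra.
have h2 : 4 * X <= D / 3 + 4.
  rewrite -(ler_pM2r (_ : 0 < D + 6)); last by lra.
  have := sqr_ge0 (D - 3); rewrite expr2; lra.
lra.
Qed.

Variable d : nat.
Hypothesis d4 : (4 <= d)%N.
Let D : R := (d - 2)%:R.

(** The two bounds settle the cases where both ends of the cluster fall under the same alternative
    of [small_side]; their average settles the mixed case. For [J = J' = 1] the first would require
    [X <= 1 / 2], so that case needs the finer [small_side1]. *)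
Lemma small_budget (J J' : nat) (X : R) : (0 < J)%N -> (0 < J')%N ->
  (2 * J <= d - 2)%N -> (2 * J' <= d - 2)%N -> (3 <= J + J')%N ->
  (d + 2 - J - J')%:R * X = D ->
  D * (J%:R^-1 + J'%:R^-1) / 2 + 2 * X <= D + 1 /\
  D * (J%:R^-1 + J'%:R^-1) / 2 + 4 * X <= D + 4.
Proof.
wlog JJ : J J' / (J <= J')%N.
  move=> hw J0 J0' h1 h2 h3; have [JJ|/ltnW JJ] := leqP J J'; first exact: hw.
  rewrite [_^-1 + _]addrC subnAC; apply: hw => //; by rewrite addnC.
move=> J0 J0' h1 h2 h3.
have EK : (d + 2 - J - J')%:R = D + 4 - J%:R - J'%:R :> R.
  rewrite -natrD -natrB; last by lia.
  by rewrite -natrB; [congr _%:R; lia | lia].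
rewrite EK => eX.
have J'p : (J'%:R * J'%:R^-1 = 1 :> R) by rewrite mulfV // pnatr_eq0 -lt0n.
have D2J : 2 * J'%:R <= D by rewrite -natrM ler_nat.
have [J2|J1] := leqP 2 J.
  have Jp : (J%:R * J%:R^-1 = 1 :> R) by rewrite mulfV // pnatr_eq0 -lt0n.
  have a1 : 2 <= J%:R :> R by rewrite ler_nat.
  have a2 : 2 <= J'%:R :> R by rewrite ler_nat; lia.
  have a3 : 2 * J%:R <= D by rewrite -natrM ler_nat.
  apply: (@small_budget_real D J%:R J'%:R (D + 4 - J%:R - J'%:R)) => //; lra.
have -> : J = 1%N by lia.
rewrite (_ : J = 1%N) in eX; last by lia.
rewrite invr1.
have [J3|J2] := leqP 3 J'.
  have a2 : 3 <= J'%:R :> R by rewrite ler_nat.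
  by apply: (@small_budget_one D J'%:R (D + 4 - 1 - J'%:R)) => //; lra.
have E2 : J' = 2%N by lia.
rewrite E2 in eX J'p D2J *.
have X0 : 0 <= X by nra.
have : X <= 1 by nra.
by lra.
Qed.

(** Again affine in [g]: the first alternative is the bound obtained when [g = F / s] is the worst
    case, the second when [g = 0] is. *)
Lemma small_side (F : R) (s J : nat) (g w X : R) : 0 <= F -> 0 <= X ->
  barrier_side R d F s J g w ->
  2 * X * (F - (s - J)%:R * g) + 2 * D * w <=
     F * (D * J%:R^-1 / 2 + 1 / 2 + X) \/
  2 * X * (F - (s - J)%:R * g) + 2 * D * w <=
     F * (D * J%:R^-1 / 2 + 1 / 2 + (2 * X - 3 / 2)).
Proof.
move=> F0 X0 [J0 Js sd /andP[g0 gF] side].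
have D2 : 2 <= D := D_ge2 R d d4.
have Jp : 1 <= J%:R :> R by rewrite ler1n.
have sJ : 2 * J%:R <= s%:R :> R by rewrite -natrM ler_nat.
have es : s%:R * s%:R^-1 = 1 :> R by rewrite mulfV // gt_eqF //; lra.
have eJ : J%:R * J%:R^-1 = 1 :> R by rewrite mulfV // gt_eqF //; lra.
have eb : (s - J)%:R = s%:R - J%:R :> R by rewrite natrB //; clear -Js; lia.
have sp : 0 < s%:R :> R by lra.
have sDr : s%:R <= D by rewrite ler_nat.
have gs : g * s%:R <= F by rewrite -ler_pdivlMr.
have jv0 : 0 < J%:R^-1 :> R by rewrite invr_gt0; lra.
have sv0 : 0 < s%:R^-1 :> R by rewrite invr_gt0; lra.
have DJ : 1 <= D * J%:R^-1 / 2 by nra.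
have DFJ := ler_wpM2l F0 DJ.
have Ds : 1 <= D * s%:R^-1 by nra.
have DFs := ler_wpM2l F0 Ds.
case: side => [[sE ->]|[t [Jt td st ->]]].
  have sER : s%:R = 2 * J%:R :> R by rewrite sE natrM.
  rewrite eb sER (_ : 2 * J%:R - J%:R = J%:R); last by lra.
  rewrite sER in gs.
  have [co|co] := lerP D (2 * X * J%:R).
    right.
    have : 0 <= g * (2 * X * J%:R - D) by rewrite mulr_ge0 ?subr_ge0.
    by move: DFJ; clear; lra.
  left.
  have : 0 <= J%:R^-1 * (F - g * (2 * J%:R)) * (D - 2 * X * J%:R).
    by rewrite !mulr_ge0 ?subr_ge0 // ltW.
  have -> : J%:R^-1 * (F - g * (2 * J%:R)) * (D - 2 * X * J%:R)
     = D * F * J%:R^-1 - 2 * X * F * (J%:R * J%:R^-1)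
     - 2 * D * g * (J%:R * J%:R^-1) + 4 * X * g * J%:R * (J%:R * J%:R^-1) :> R.
    by move: (J%:R^-1 : R) => v; clear; lra.
  rewrite eJ; move: F0; clear; lra.
have H := ler_wpM2l F0 (harmonic_pair R d J s t J0 Js Jt st).
rewrite -/D in H.
have eD : D * D^-1 = 1 by rewrite mulfV // gt_eqF //; lra.
have e4 : 2 * D * (F * (2^-1 * D^-1)) = F.
  have : F * (D * D^-1) = F by rewrite eD mulr1.
  by move: (D^-1) => v; clear; lra.
have e6 : 2 * D * (g - F / s%:R + (F / s%:R + F / t%:R - F / (2 * D)) / 2) =
    2 * D * g - D * (F / s%:R) + D * (F / t%:R) - F / 2.
  by rewrite invfM; move: e4; clear; lra.
rewrite e6.
have sv : s%:R^-1 <= J%:R^-1 / 2 :> R.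
  by rewrite -invfM mulrC lef_pV2 ?posrE //; lra.
have [co|co] := lerP (X * (s - J)%:R) D; [left|right].
  have : 0 <= s%:R^-1 * (F - g * s%:R) * (D - X * (s - J)%:R).
    by rewrite !mulr_ge0 ?subr_ge0 // ltW.
  have -> : s%:R^-1 * (F - g * s%:R) * (D - X * (s - J)%:R)
     = D * (F / s%:R) - X * F * (s%:R * s%:R^-1) + X * F * (J%:R * s%:R^-1)
     - D * g * (s%:R * s%:R^-1) + X * g * (s%:R - J%:R) * (s%:R * s%:R^-1) :> R.
    by rewrite eb; move: (s%:R^-1 : R) => v; clear; lra.
  rewrite eb.
  rewrite es => K1.
  have Js2 : J%:R * s%:R^-1 <= 1 / 2 :> R by nra.
  have K2 : X * F * (J%:R * s%:R^-1) <= X * F * (1 / 2).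
    by rewrite ler_wpM2l // mulr_ge0.
  move: K1 K2 H; clear; lra.
have : 0 <= g * (X * (s - J)%:R - D) by rewrite mulr_ge0 // subr_ge0 ltW.
have tv : t%:R^-1 <= J%:R^-1 / 2 :> R.
  have tJ : 2 * J%:R <= t%:R :> R by rewrite -natrM ler_nat.
  by rewrite -invfM mulrC lef_pV2 ?posrE //; lra.
have : D * (F * t%:R^-1) <= D * (F * (J%:R^-1 / 2)).
  by rewrite ler_wpM2l ?ler_wpM2l //; lra.
move: DFs F0; clear; lra.
Qed.

(** Keeps [2 * X / s] where [small_side] has [X]. When [d <= s + s'], the two such terms of a
    cluster add up to at most 1, again by [harmonic_pair]. *)
Lemma small_side1 (F : R) (s : nat) (g w X : R) : 0 <= F -> 0 <= X -> X <= 1 ->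
  X * d%:R = D -> barrier_side R d F s 1 g w ->
  2 * X * (F - (s - 1)%:R * g) + 2 * D * w <= F * (2 * X / s%:R + 1 / 2 + D / 2).
Proof.
move=> F0 X0 X1 eX [_ Js sd /andP[g0 gF] side].
have D2 : 2 <= D := D_ge2 R d d4.
have s2 : 2 <= s%:R :> R by rewrite ler_nat.
have es : s%:R * s%:R^-1 = 1 :> R by rewrite mulfV // gt_eqF //; lra.
have eb : (s - 1)%:R = s%:R - 1 :> R by rewrite natrB //; clear -Js; lia.
have sp : 0 < s%:R :> R by lra.
have gs : g * s%:R <= F by rewrite -ler_pdivlMr.
have sv0 : 0 < s%:R^-1 :> R by rewrite invr_gt0; lra.
case: side => [[sE ->]|[t [Jt td st ->]]].
  have sER : s%:R = 2 :> R by rewrite sE.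
  rewrite eb sER; rewrite sER in gs.
  have : 0 <= (F - 2 * g) * (D - 2 * X) by rewrite mulr_ge0 //; lra.
  have := mulr_ge0 F0 X0.
  have : F * X <= F * 1 by rewrite ler_wpM2l.
  move: F0; clear; lra.
have := ler_wpM2l F0 (harmonic_pair R d 1 s t (ltn0Sn _) Js Jt st).
rewrite -/D invr1 => H.
have eD : D * D^-1 = 1 by rewrite mulfV // gt_eqF //; lra.
have e4 : 2 * D * (F * (2^-1 * D^-1)) = F.
  have : F * (D * D^-1) = F by rewrite eD mulr1.
  by move: (D^-1) => v; clear; lra.
have e6 : 2 * D * (g - F / s%:R + (F / s%:R + F / t%:R - F / (2 * D)) / 2) =
    2 * D * g - D * (F / s%:R) + D * (F / t%:R) - F / 2.
  by rewrite invfM; move: e4; clear; lra.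
have co : X * (s - 1)%:R <= D.
  rewrite -eX ler_wpM2l // ler_nat; clear -sd; lia.
have : 0 <= s%:R^-1 * (F - g * s%:R) * (D - X * (s - 1)%:R).
  by rewrite !mulr_ge0 ?subr_ge0 // ltW.
have -> : s%:R^-1 * (F - g * s%:R) * (D - X * (s - 1)%:R)
   = D * (F / s%:R) - X * F * (s%:R * s%:R^-1) + X * F * s%:R^-1
   - D * g * (s%:R * s%:R^-1) + X * g * (s%:R - 1) * (s%:R * s%:R^-1) :> R.
  by rewrite eb; move: (s%:R^-1 : R) => v; clear; lra.
rewrite e6 eb es; move: H; clear; lra.
Qed.

Lemma small_cluster_cost (F : R) s J g w s' J' g' w' : 0 <= F ->
  barrier_side R d F s J g w -> barrier_side R d F s' J' g' w' -> (d <= s + s')%N ->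
  2 * D * ((F - (s - J)%:R * g + (F - (s' - J')%:R * g')) / (d + 2 - J - J')%:R)
    + 2 * D * w + 2 * D * w' <= F * d%:R.
Proof.
move=> F0 side side' dss.
have D2 : 2 <= D := D_ge2 R d d4.
have [J0 Js sd _ _] := side; have [J0' Js' sd' _ _] := side'.
have Jd : (2 * J <= d - 2)%N by apply: leq_trans sd.
have Jd' : (2 * J' <= d - 2)%N by apply: leq_trans sd'.
have K0 : (0 < d + 2 - J - J')%N by clear -Jd Jd' d4; lia.
have KR : 0 < (d + 2 - J - J')%:R :> R by rewrite ltr0n.
pose X : R := D / (d + 2 - J - J')%:R.
have eX : (d + 2 - J - J')%:R * X = D by rewrite mulrC divfK // gt_eqF.
have X0 : 0 <= X by rewrite divr_ge0 //; lra.
have -> : 2 * D * ((F - (s - J)%:R * g + (F - (s' - J')%:R * g')) / (d + 2 - J - J')%:R)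
   = 2 * X * (F - (s - J)%:R * g) + 2 * X * (F - (s' - J')%:R * g') :> R.
  by rewrite /X; move: ((d + 2 - J - J')%:R^-1 : R) => v; clear; lra.
have dE : d%:R = D + 2 :> R by rewrite -natrD; congr _%:R; clear -d4; lia.
have [J3|J2] := leqP 3 (J + J').
  have [Ba Bb] := small_budget J J' X J0 J0' Jd Jd' J3 eX.
  have := ler_wpM2l F0 Ba; have := ler_wpM2l F0 Bb; rewrite dE.
  have [S1|S1] := small_side F s J g w X F0 X0 side;
  have [S2|S2] := small_side F s' J' g' w' X F0 X0 side';
  move: S1 S2; clear; lra.
have E1 : J = 1%N by clear -J2 J0 J0'; lia.
have E2 : J' = 1%N by clear -J2 J0 J0'; lia.
subst J J'.
have eX' : X * d%:R = D by rewrite mulrC -eX; congr (_%:R * _); clear -d4; lia.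
have X1 : X <= 1 by nra.
have S1 := small_side1 F s g w X F0 X0 X1 eX' side.
have S2 := small_side1 F s' g' w' X F0 X0 X1 eX' side'.
(* The smallest size of the other cut allowed by [d <= s + s']; it complements [s] as
   [harmonic_pair] requires for [J = 1]. *)
pose t := (d - s)%N.
have ts : (t <= s')%N by rewrite /t; clear -dss; lia.
have t2 : (2 * 1 <= t)%N by rewrite /t; clear -sd d4; lia.
have st : (s + t = d - 2 + 2 * 1)%N by rewrite /t; clear -sd d4; lia.
have := harmonic_pair R d 1 s t (ltn0Sn _) Js t2 st.
rewrite -/D invr1 => H.
have sv : s'%:R^-1 <= t%:R^-1 :> R.
  rewrite lef_pV2 ?posrE ?ltr0n ?ler_nat //; first by clear -ts t2; lia.
  by clear -t2; lia.
have e1 : X * (s%:R^-1 + s'%:R^-1) <= 1 / 2.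
  rewrite -(ler_pM2r (_ : 0 < d%:R)); last by rewrite dE; lra.
  rewrite mulrAC eX' dE.
  have : D * s'%:R^-1 <= D * t%:R^-1 by rewrite ler_wpM2l //; lra.
  by move: H; clear; lra.
have := ler_wpM2l F0 e1.
move: S1 S2; rewrite dE; clear; lra.
Qed.

End SmallCluster.

(** * Slope of the ramp near its ends and in between *)

Section RampSlope.
Variable R : realFieldType.

(** Next to the end of a cluster the ramp is small, but it doubles from position 1 to position 2 as
    long as the opposite star does not interfere. That star can reach these positions only for
    [h' = M] or [h' = M - 1], which are treated apart. *)
Lemma ramp_second (h h' M : nat) (C : R) : (1 < h)%N -> (1 < h')%N -> (h <= M)%N ->
  (h' <= M)%N -> 2 <= C -> C <= 2 * h'%:R ->
  (C - 2) * ramp R h h' M 1 <= C * ramp R h h' M 2.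
Proof.
move=> h1 h1' hM hM' C2 Ch.
have hp : 0 < h%:R :> R by rewrite ltr0n ltnW.
have hp' : 0 < h'%:R :> R by rewrite ltr0n ltnW.
have eh : h%:R * h%:R^-1 = 1 :> R by rewrite mulfV // gt_eqF.
have eh' : h'%:R * h'%:R^-1 = 1 :> R by rewrite mulfV // gt_eqF.
have u0 : 0 < h%:R^-1 :> R by rewrite invr_gt0.
have u0' : 0 < h'%:R^-1 :> R by rewrite invr_gt0.
have E1 : (h - 1)%:R / h%:R = 1 - h%:R^-1 :> R.
  by rewrite sub_divl ?(ltnW h1) // mul1r.
have E2 : (h - 2)%:R / h%:R = 1 - 2 * h%:R^-1 :> R by rewrite sub_divl // ltnW.
have [big|small] := leqP h'.+2 M.
  rewrite /ramp E1 E2 !sub_div0; [|clear -big; lia..].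
  nra.
have [Mh|Mh] := eqVneq M h'.
  have E3 : (h' - (M - 1))%:R / h'%:R = h'%:R^-1 :> R.
    by rewrite (_ : h' - (M - 1) = 1)%N ?mul1r //; clear -Mh h1'; lia.
  have E4 : (h' - (M - 2))%:R / h'%:R = 2 * h'%:R^-1 :> R.
    by rewrite (_ : h' - (M - 2) = 2)%N //; clear -Mh h1'; lia.
  rewrite /ramp E1 E2 E3 E4.
  have : h'%:R^-1 <= h%:R^-1 :> R by rewrite lef_pV2 ?posrE // ler_nat; clear -Mh hM; lia.
  nra.
have ME : M = h'.+1 by clear -Mh small hM'; lia.
have E4 : (h' - (M - 2))%:R / h'%:R = h'%:R^-1 :> R.
  by rewrite (_ : h' - (M - 2) = 1)%N ?mul1r //; clear -ME h1'; lia.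
rewrite /ramp E1 E2 E4 sub_div0; last by clear -ME; lia.
have hh : h%:R <= h'%:R + 1 :> R by rewrite natr1 ler_nat -ME.
have : 0 <= h%:R^-1 * h'%:R^-1 * ((C + 2) * h'%:R - C * h%:R).
  rewrite !mulr_ge0 ?(ltW u0) ?(ltW u0') //; nra.
have -> : h%:R^-1 * h'%:R^-1 * ((C + 2) * h'%:R - C * h%:R) =
   (C + 2) * h%:R^-1 * (h'%:R * h'%:R^-1) - C * h'%:R^-1 * (h%:R * h%:R^-1) :> R.
  by move: (h%:R^-1 : R) (h'%:R^-1 : R) => u v; clear; lra.
rewrite eh eh'; clear; lra.
Qed.

Lemma ramp_step (h h' M l : nat) : (0 < h)%N -> (0 < l)%N -> (l <= M)%N ->
  ramp R h h' M l - h%:R^-1 <= ramp R h h' M l.-1.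
Proof.
move=> h0 l0 lM; rewrite /ramp.
have u0 : 0 <= h%:R^-1 :> R by rewrite invr_ge0.
have u0' : 0 <= h'%:R^-1 :> R by rewrite invr_ge0.
have : (h - l.-1)%:R / h%:R <= (h - l)%:R / h%:R + h%:R^-1 :> R.
  rewrite -[X in _ + X]mul1r -mulrDl ler_wpM2r // natr1 ler_nat; clear -l0; lia.
have : (h' - (M - l.-1))%:R / h'%:R <= (h' - (M - l))%:R / h'%:R :> R.
  by rewrite ler_wpM2r // ler_nat; clear -l0; lia.
clear; lra.
Qed.

End RampSlope.

(** * Regular graphs of even degree: structure of the weak cuts *)

Section DensityTwo.
Variables (R : realFieldType) (n : nat) (e : rel nat) (z : nat -> R).
Hypothesis e_sym : symmetric e.
Hypothesis e_irr : irreflexive e.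
Hypothesis z_mono : forall i j, (i <= j)%N -> z i <= z j.
Local Notation ecount := (ecount e).
Local Notation span2 := (span2 n e).
Local Notation cut := (cut n e).
Local Notation gap := (gap R z).
Local Notation flux := (flux R n e z).
Hypothesis cut_gt0 : forall k, (0 < k < n)%N -> (0 < cut k)%N.
Variable d : nat.
Hypothesis d4 : (4 <= d)%N.
Hypothesis d_even : ~~ odd d.
Hypothesis cut_even : forall k, (k <= n)%N -> ~~ odd (cut k).
Hypothesis deg_eq : forall i, (i < n)%N -> ecount i i.+1 0 n = d.
Let D : R := (d - 2)%:R.

(** Each of the [d] edges at vertex [k] lies in one of the two cuts, and each edge jumping over [k]
    lies in both. *)
Lemma cut_step k : (k < n)%N -> (cut k + cut k.+1 = d + 2 * span2 k k.+1)%N.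
Proof.
move=> kn; have := deg_eq k kn; rewrite (deg_split _ _ e_irr) //.
by rewrite (cut_succl _ _ e_sym) // cut_succr //; lia.
Qed.

Lemma strong_cut k : (k <= n)%N -> ~~ (cut k <= d - 2)%N -> (d <= cut k)%N.
Proof. by move=> kn; have := cut_even k kn; move: d_even d4; lia. Qed.

Lemma boundary_two k r : (k + r <= n)%N ->
  (r * d <= cut k + cut (k + r) + r * (r - 1))%N.
Proof. by apply: cut_boundary => // i hi; rewrite deg_eq. Qed.

(** For [2 <= r <= d - 1] one has [r * (d - r + 1) >= 2 * (d - 1)], more than two weak cuts can have
    together. Distance 1 survives: then a single vertex separates them. *)
Lemma weak_cuts_far2 k r : (0 < r)%N -> (k + r <= n)%N ->
  (cut k <= d - 2)%N -> (cut (k + r) <= d - 2)%N -> r = 1%N \/ (d <= r)%N.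
Proof.
move=> r0 krn w1 w2; have b := boundary_two k r krn.
have [->|r1] := eqVneq r 1%N; first by left.
right; rewrite leqNgt; apply/negP => rd.
by nia.
Qed.

Definition low_mult k : nat :=
  if (cut k.-1 <= d - 2)%N then (1 + span2 k.-1 k)%N else (cut k)./2.

(** For two adjacent weak cuts [k.-1] and [k], [low_share F k] and [high_share F k.-1] add up to
    [gap k + gap k.-1 - F / (2 * D)]: the vertex in between pays with its own unit of length. A
    single weak cut is halved. *)
Definition low_share (F : R) k : R :=
  if (cut k.-1 <= d - 2)%N
  then gap k - F / (cut k)%:R + (F / (cut k)%:R + F / (cut k.-1)%:R - F / (2 * D)) / 2
  else gap k / 2.

Definition high_mult k : nat :=
  if (cut k.+1 <= d - 2)%N then (1 + span2 k k.+1)%N else (cut k)./2.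

Definition high_share (F : R) k : R :=
  if (cut k.+1 <= d - 2)%N
  then gap k - F / (cut k)%:R + (F / (cut k)%:R + F / (cut k.+1)%:R - F / (2 * D)) / 2
  else gap k / 2.

Lemma gap_range (F : R) k : (0 < k < n)%N -> flux k <= F ->
  0 <= gap k <= F / (cut k)%:R.
Proof.
move=> hk fF; rewrite gap_ge0 //=.
exact: gap_le_flux.
Qed.

(** If the weak cut is single, [cut k.+1 >= d] allows at most half of its edges to end at [k]. If
    [k.-1] is weak too, at most one edge joins [k] to [k.-1] and the other downward edges of [k] are
    counted by [span2 k.-1 k]; [cut_step] relates the sizes of the two cuts. *)
Lemma low_side (F : R) k : (0 < k)%N -> (k < n)%N ->
  (cut k <= d - 2)%N -> ~~ (cut k.+1 <= d - 2)%N -> flux k <= F ->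
  barrier_side R d F (cut k) (low_mult k) (gap k) (low_share F k) /\
  (ecount k k.+1 0 k <= low_mult k)%N.
Proof.
move=> k0 kn wk nwk fF.
have hk : (0 < k < n)%N by rewrite k0.
have c0 := cut_gt0 k hk.
have ev := cut_even k (ltnW kn).
have st1 := strong_cut k.+1 kn nwk.
have gr := gap_range F k hk fF.
rewrite /low_mult /low_share; case: ifP => [wk1|nwk1].
  have k1n : (k.-1 < n)%N by clear -kn; lia.
  have E := cut_step k.-1 k1n; rewrite prednK // in E.
  split; last first.
    rewrite (@ecount_catr _ k.-1) ?leq_pred //.
    have := ecount_leq e k k.+1 k.-1 k.
    have : (ecount k k.+1 0 k.-1 <= span2 k.-1 k)%N.
      by rewrite ecountC //; apply: ecount_mono.
    clear -k0; lia.
  split=> //; [clear -wk1 E wk d4; lia|].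
  right; exists (cut k.-1); split=> //; clear -wk1 E wk d4; lia.
split; last first.
  move: (cut_succl _ _ e_sym k kn) (cut_succr n e k kn) (deg_split n e e_irr k kn).
  by rewrite deg_eq // => h1 h2 h3; clear -h1 h2 h3 ev st1; lia.
split=> //; [clear -c0 ev; lia | clear -c0 ev; lia|].
by left; split=> //; clear -c0 ev; lia.
Qed.

Lemma high_side (F : R) k : (0 < k)%N -> (k < n)%N ->
  (cut k <= d - 2)%N -> ~~ (cut k.-1 <= d - 2)%N -> flux k <= F ->
  barrier_side R d F (cut k) (high_mult k) (gap k) (high_share F k) /\
  (ecount k.-1 k k n <= high_mult k)%N.
Proof.
move=> k0 kn wk nwk fF.
have hk : (0 < k < n)%N by rewrite k0.
have c0 := cut_gt0 k hk.
have ev := cut_even k (ltnW kn).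
have k1n : (k.-1 < n)%N by clear -kn; lia.
have st1 := strong_cut k.-1 (ltnW k1n) nwk.
have gr := gap_range F k hk fF.
have E := cut_step k kn.
rewrite /high_mult /high_share; case: ifP => [wk1|nwk1].
  split; last first.
    rewrite (@ecount_catr _ k.+1) //.
    have := ecount_leq e k.-1 k k k.+1.
    have : (ecount k.-1 k k.+1 n <= span2 k k.+1)%N by apply: ecount_mono.
    clear -k0; lia.
  split=> //; [clear -wk1 E wk d4; lia|].
  right; exists (cut k.+1); split=> //; clear -wk1 E wk d4; lia.
split; last first.
  move: (cut_succl _ _ e_sym k.-1 k1n) (cut_succr n e k.-1 k1n) (deg_split n e e_irr k.-1 k1n).
  rewrite deg_eq // prednK // => h1 h2 h3; clear -h1 h2 h3 ev st1; lia.
split=> //; [clear -c0 ev; lia | clear -c0 ev; lia|].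
by left; split=> //; clear -c0 ev; lia.
Qed.

(** A cut of [2 * (d - 2)] edges suffices alone. By [cut_boundary] a smaller strong cut lies either
    next to an end of the ramp or nearly [d] away from both ends. In the first case the adjacent cut
    is so large that at least [d - 2] edges span both, and [ramp_second] applies; in the second at
    least [d / 2] edges span each neighbouring gap, and the ramp is high and flat enough. *)
Lemma coverage_two k M l (h h' : nat) (r : nat -> R) :
  r = ramp R h h' M -> (k + M.+2 <= n)%N ->
  (d <= M.+1)%N -> (d + 2 <= 2 * h)%N -> (d + 2 <= 2 * h')%N ->
  (h < d)%N -> (h' < d)%N ->
  (cut k <= d - 2)%N -> (cut (k + M.+2) <= d - 2)%N ->
  (forall i, (k < i < k + M.+2)%N -> (d <= cut i)%N) ->
  (0 < l)%N -> (l < M)%N ->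
  2 * D * r l <= (cut (k.+1 + l))%:R * r l
    + (span2 (k + l) (k.+1 + l))%:R * r l.-1
    + (span2 (k.+1 + l) (k.+1 + l).+1)%:R * r l.+1.
Proof.
move=> rE kMn dM hd hd' h_d h_d' w1 w2 nw l0 lM.
have hM : (h <= M)%N by clear -h_d dM; lia.
have hM' : (h' <= M)%N by clear -h_d' dM; lia.
have h0 : (1 < h)%N by clear -hd d4; lia.
have h0' : (1 < h')%N by clear -hd' d4; lia.
have r0 i : (i <= M)%N -> 0 <= r i.
  by move=> iM; rewrite rE; apply: ramp_ge0 => //; exact: ltnW.
have rl := r0 l (ltnW lM).
have rl1 : 0 <= r l.-1 by apply: r0; clear -lM; lia.
have rl2 : 0 <= r l.+1 by apply: r0; exact: lM.
have c1 : (0 : R) <= (span2 (k + l) (k.+1 + l))%:R by exact: ler0n.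
have c2 : (0 : R) <= (span2 (k.+1 + l) (k.+1 + l).+1)%:R by exact: ler0n.
have [big|small] := leqP (2 * (d - 2)) (cut (k.+1 + l)).
  have a1 : 2 * D * r l <= (cut (k.+1 + l))%:R * r l.
    by rewrite ler_wpM2r // -natrM ler_nat.
  by rewrite -[leLHS]addr0 -addrA lerD // addr_ge0 // mulr_ge0.
have ci : (d <= cut (k.+1 + l))%N by apply: nw; clear -lM; lia.
have d6 : (6 <= d)%N by clear -ci small d_even; lia.
have ci1 : l.+1 != M -> (d <= cut (k.+1 + l).+1)%N.
  by move=> ?; apply: nw; clear -lM; lia.
have e1 : (k + l).+1 = (k.+1 + l)%N by [].
have bn1 : (k + l < n)%N by clear -kMn lM; lia.
have bn2 : (k.+1 + l < n)%N by clear -kMn lM; lia.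
have st1 := cut_step _ bn1; have st2 := cut_step _ bn2; rewrite e1 in st1.
have bn3 : (k + l.+1 <= n)%N by clear -kMn lM; lia.
have bn4 : (k.+1 + l + (M.+1 - l) <= n)%N by clear -kMn lM; lia.
have b1 := boundary_two k l.+1 bn3.
have b2 := boundary_two (k.+1 + l) (M.+1 - l) bn4.
rewrite (_ : k + l.+1 = k.+1 + l)%N in b1; last by rewrite addnS.
rewrite (_ : k.+1 + l + (M.+1 - l) = k + M.+2)%N in b2; last by clear -lM; lia.
have ca : l = 1%N \/ (d <= l.+2)%N.
  have [->|l1] := eqVneq l 1%N; first by left.
  right; rewrite leqNgt; apply/negP => ld.
  by clear -b1 w1 small ld l0 l1 d6; nia.
have cb : l.+1 = M \/ (d <= (M - l).+2)%N.
  have [->|l1] := eqVneq l.+1 M; first by left.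
  right; rewrite leqNgt; apply/negP => ld.
  have [q [qE q3]] : exists q, (M.+1 - l = q /\ 3 <= q)%N.
    by exists (M.+1 - l)%N; split=> //; clear -l1 lM; lia.
  have {}ld : (q.+1 < d)%N by clear -qE ld lM; lia.
  by move: b2; rewrite qE => b2; clear -b2 w2 small ld q3 d6; nia.
have D4 : 4 <= D by rewrite ler_nat; clear -d6; lia.
have dE : d%:R = D + 2 :> R by rewrite -natrD; congr _%:R; clear -d4; lia.
have hR : D <= 2 * h%:R :> R by rewrite -natrM ler_nat; clear -hd; lia.
have hR' : D <= 2 * h'%:R :> R by rewrite -natrM ler_nat; clear -hd'; lia.
have ciR : D + 2 <= (cut (k.+1 + l))%:R by rewrite -dE ler_nat.
have cr : (D + 2) * r l <= (cut (k.+1 + l))%:R * r l by rewrite ler_wpM2r.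
case: ca => [l1|ld].
  (* The three vertices above the weak cut force [cut (k + 3) >= 2 * (d - 2)]. *)
  have bn5 : (k + 3 <= n)%N by clear -kMn lM l0; lia.
  have b3 := boundary_two k 3 bn5.
  have sp : (d - 2 <= span2 (k.+1 + l) (k.+1 + l).+1)%N.
    rewrite (_ : k + 3 = (k.+1 + l).+1)%N in b3; last by rewrite l1; clear; lia.
    by clear -b3 st2 ci w1 d4; lia.
  have spR : D <= (span2 (k.+1 + l) (k.+1 + l).+1)%:R by rewrite ler_nat.
  have := @ramp_second R h h' M D h0 h0' hM hM'; rewrite -rE.
  have -> : r 1%N = r l by rewrite l1.
  have -> : r 2%N = r l.+1 by rewrite l1.
  move=> K.
  have {}K : (D - 2) * r l <= D * r l.+1 by apply: K => //; lra.
  have : D * r l.+1 <= (span2 (k.+1 + l) (k.+1 + l).+1)%:R * r l.+1 by rewrite ler_wpM2r.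
  have : 0 <= (span2 (k + l) (k.+1 + l))%:R * r l.-1 by rewrite mulr_ge0.
  by move: K cr; lra.
case: cb => [lM1|lMd].
  have bn5 : (k + l + 3 <= n)%N by clear -kMn lM1; lia.
  have b3 := boundary_two (k + l)%N 3 bn5.
  have sp : (d - 2 <= span2 (k + l) (k.+1 + l))%N.
    rewrite (_ : k + l + 3 = k + M.+2)%N in b3; last by rewrite -lM1; clear; lia.
    by clear -b3 st1 ci w2 d4; lia.
  have spR : D <= (span2 (k + l) (k.+1 + l))%:R by rewrite ler_nat.
  have := @ramp_second R h' h M D h0' h0 hM' hM.
  rewrite -(ramp_rev R h h' M 1); last by clear -dM d6; lia.
  rewrite -(ramp_rev R h h' M 2); last by clear -dM d6; lia.
  rewrite -rE (_ : M - 1 = l)%N; last by rewrite -lM1 subn1.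
  rewrite (_ : M - 2 = l.-1)%N; last by rewrite -lM1; clear; lia.
  move=> K.
  have {}K : (D - 2) * r l <= D * r l.-1 by apply: K => //; lra.
  have : D * r l.-1 <= (span2 (k + l) (k.+1 + l))%:R * r l.-1 by rewrite ler_wpM2r.
  have : 0 <= (span2 (k.+1 + l) (k.+1 + l).+1)%:R * r l.+1 by rewrite mulr_ge0.
  by move: K cr; lra.
have hp : 0 < h%:R :> R by rewrite ltr0n ltnW.
have hp' : 0 < h'%:R :> R by rewrite ltr0n ltnW.
have u1 : (D + 2) * h%:R^-1 <= 2.
  by rewrite ler_pdivrMr // -dE -natrM ler_nat; clear -hd; lia.
have u1' : (D + 2) * h'%:R^-1 <= 2.
  by rewrite ler_pdivrMr // -dE -natrM ler_nat; clear -hd'; lia.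
have r1 : r l - h%:R^-1 <= r l.-1.
  by rewrite rE; apply: ramp_step => //; [exact: ltnW | exact: ltnW].
have r2 : r l - h'%:R^-1 <= r l.+1.
  have := @ramp_step R h' h M (M - l) (ltnW h0').
  rewrite ramp_rev; last by clear -lM; lia.
  rewrite (_ : (M - l).-1 = M - l.+1)%N; last by clear; lia.
  rewrite ramp_rev // -rE; apply; first by clear -lM; lia.
  exact: leq_subr.
have sp1 : D + 2 <= 2 * (span2 (k + l) (k.+1 + l))%:R.
  rewrite -dE -natrM ler_nat.
  have : (d <= cut (k + l))%N by apply: nw; clear -l0 lM; lia.
  by clear -st1 ci; lia.
have sp2 : D + 2 <= 2 * (span2 (k.+1 + l) (k.+1 + l).+1)%:R.
  rewrite -dE -natrM ler_nat.
  have : (d <= cut (k.+1 + l).+1)%N by apply: nw; clear -l0 lM; lia.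
  by clear -st2 ci; lia.
(* At this distance at most one edge of each star is still active, and each star has at least 4
   edges. *)
have half : 1 / 2 <= r l.
  have a1 : (h - l)%:R / h%:R <= 1 / 4 :> R.
    rewrite ler_pdivrMr // mulrAC ler_pdivlMr // mul1r -natrM ler_nat.
    by clear -ld h_d hd d6; lia.
  have a2 : (h' - (M - l))%:R / h'%:R <= 1 / 4 :> R.
    rewrite ler_pdivrMr // mulrAC ler_pdivlMr // mul1r -natrM ler_nat.
    by clear -lMd h_d' hd' d6; lia.
  by rewrite rE /ramp; lra.
have m1 : (D + 2) * r l.-1 <= 2 * (span2 (k + l) (k.+1 + l))%:R * r l.-1.
  by rewrite ler_wpM2r.
have m2 : (D + 2) * r l.+1 <= 2 * (span2 (k.+1 + l) (k.+1 + l).+1)%:R * r l.+1.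
  by rewrite ler_wpM2r.
have m3 : (D + 2) * (r l - h%:R^-1) <= (D + 2) * r l.-1 by rewrite ler_wpM2l //; lra.
have m4 : (D + 2) * (r l - h'%:R^-1) <= (D + 2) * r l.+1 by rewrite ler_wpM2l //; lra.
move: cr m1 m2 m3 m4 u1 u1' half.
lra.
Qed.

End DensityTwo.

(** * Regular graphs of even degree: growth with N = 2(d - 2) *)

Section DensityTwoBound.
Variables (R : realFieldType) (n : nat) (e : rel nat) (z : nat -> R).
Hypothesis e_sym : symmetric e.
Hypothesis e_irr : irreflexive e.
Hypothesis z_mono : forall i j, (i <= j)%N -> z i <= z j.
Local Notation ecount := (ecount e).
Local Notation span2 := (span2 n e).
Local Notation cut := (cut n e).
Local Notation gap := (gap R z).
Local Notation flux := (flux R n e z).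
Hypothesis cut_gt0 : forall k, (0 < k < n)%N -> (0 < cut k)%N.
Variable d : nat.
Hypothesis d4 : (4 <= d)%N.
Hypothesis d_even : ~~ odd d.
Hypothesis cut_even : forall k, (k <= n)%N -> ~~ odd (cut k).
Hypothesis deg_eq : forall i, (i < n)%N -> ecount i i.+1 0 n = d.
Let D : R := (d - 2)%:R.
Local Notation low_mult := (low_mult n e d).
Local Notation high_mult := (high_mult n e d).
Local Notation low_share := (low_share R n e z d).
Local Notation high_share := (high_share R n e z d).
Local Notation weak k := (cut k <= d - 2)%N.

(** At least [cut k - J] edges of the weak cut jump over vertex [k]; they add [gap k] to the current
    of the next cut, and this share is no longer available to the star. *)
Lemma low_star (F : R) k J : (k < n)%N -> (ecount k k.+1 0 k <= J)%N ->
  flux k.+1 <= F ->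
  \sum_(0 <= l < d - J) (d - J - l)%:R * gap (k.+1 + l)
    <= F - (cut k - J)%:R * gap k.
Proof.
move=> kn dJ fF.
have E := deg_split n e e_irr k kn; rewrite deg_eq // in E.
have C := cut_succl n e e_sym k kn.
have hu : (d - J <= ecount k k.+1 k.+1 n)%N by clear -E dJ; lia.
have := star_up R n e z z_mono k (d - J) kn hu.
have : (cut k - J)%:R * gap k <= (span2 k k.+1)%:R * gap k.
  by rewrite ler_wpM2r ?gap_ge0 // ler_nat; clear -C dJ; lia.
by move: fF; lra.
Qed.

Lemma high_star (F : R) k J : (k < n)%N -> (ecount k k.+1 k.+1 n <= J)%N ->
  flux k <= F ->
  \sum_(0 <= l < d - J) (d - J - l)%:R * gap (k - l)
    <= F - (cut k.+1 - J)%:R * gap k.+1.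
Proof.
move=> kn dJ fF.
have E := deg_split n e e_irr k kn; rewrite deg_eq // in E.
have C := cut_succr n e k kn.
have hu : (d - J <= ecount k k.+1 0 k)%N by clear -E dJ; lia.
have := star_down R n e z e_sym z_mono k (d - J) kn hu.
have : (cut k.+1 - J)%:R * gap k.+1 <= (span2 k k.+1)%:R * gap k.+1.
  by rewrite ler_wpM2r ?gap_ge0 // ler_nat; clear -C dJ; lia.
by move: fF; lra.
Qed.

Lemma cluster_two (F : R) k M : 0 <= F -> (0 < k)%N -> (k + M.+2 < n)%N ->
  weak k -> weak (k + M.+2)%N ->
  (forall i, (k < i < k + M.+2)%N -> ~~ weak i) ->
  (forall i, (k <= i <= k + M.+2)%N -> flux i <= F) ->
  2 * D * (z (k + M.+1)%N - z k) + 2 * D * low_share F k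
     + 2 * D * high_share F (k + M.+2) <= F * M.+2%:R.
Proof.
move=> F0 k0 kMn w1 w2 nw fF.
have kn : (k < n)%N by clear -kMn; lia.
have kn1 : (k + M.+1 < n)%N by clear -kMn; lia.
have k20 : (0 < k + M.+2)%N by clear; lia.
have f1 : flux k <= F by apply: fF; clear; lia.
have f2 : flux (k + M.+2)%N <= F by apply: fF; clear; lia.
have f3 : flux k.+1 <= F by apply: fF; clear; lia.
have f4 : flux (k + M.+1)%N <= F by apply: fF; clear; lia.
have n1 : ~~ weak k.+1 by apply: nw; clear; lia.
have n2 : ~~ weak (k + M.+2).-1 by apply: nw; clear; lia.
have [S1 L1] := low_side R n e z e_sym e_irr z_mono cut_gt0 d d4 d_even cut_even deg_eq F k k0 kn w1 n1 f1.
have [S2 L2] := high_side R n e z e_sym e_irr z_mono cut_gt0 d d4 d_even cut_even deg_eq F _ k20 kMn w2 n2 f2.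
have e2 : (k + M.+2)%N = (k + M.+1).+1 by rewrite addnS.
rewrite e2 /= in L2.
have H1 := low_star F k _ kn L1 f3.
have H2 := high_star F (k + M.+1) _ kn1 L2 f4.
rewrite -e2 in H2.
set J := low_mult k in S1 H1; set J' := high_mult (k + M.+2) in S2 H2.
have [J0 Js sd _ _] := S1; have [J0' Js' sd' _ _] := S2.
have D0 : 0 <= D by exact: ler0n.
have [] := weak_cuts_far2 n e e_sym e_irr d d4 d_even deg_eq k M.+2 isT (ltnW kMn) w1 w2.
  by move=> E; clear -E; lia.
(* At distance exactly [d] a star may have [d - 1 > M] edges, too many for a ramp. There the two
   stars alone are added: their multiplicities [d - J - l] and [d - J' - (M - l)] have the sum
   [d + 2 - J - J'] at every gap. *)
rewrite leq_eqVlt => /orP[/eqP dM|dM].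
  have bd := boundary_two n e e_sym e_irr d deg_eq k M.+2 (ltnW kMn).
  have dss : (d <= cut k + cut (k + M.+2))%N.
    by move: bd; rewrite -dM; clear -d4; nia.
  have C := small_cluster_cost R d d4 F _ _ _ _ _ _ _ _ F0 S1 S2 dss.
  rewrite -/D in C; rewrite (_ : M.+2%:R = d%:R); last by rewrite dM.
  apply: le_trans C.
  rewrite !lerD2r ler_wpM2l ?mulr_ge0 //.
  have K0 : (0 < d + 2 - J - J')%N by clear -Js Js' sd sd' d4; lia.
  rewrite ler_pdivlMr ?ltr0n //.
  apply: le_trans (lerD H1 H2).
  have -> : z (k + M.+1)%N - z k = \sum_(0 <= l < M.+1) gap (k.+1 + l).
    by rewrite sum_gap_window // addSn.
  have ext (q : nat -> R) h : (h <= M.+1)%N -> (forall l, 0 <= q l) ->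
      \sum_(0 <= l < h) (h - l)%:R * q l = \sum_(0 <= l < M.+1) (h - l)%:R * q l.
    move=> hM q0; rewrite [RHS](@big_cat_nat _ _ _ h) //=.
    rewrite [X in _ = _ + X]big_nat [X in _ = _ + X]big1 ?addr0 //.
    by move=> l /andP[hl _]; rewrite (eqP hl) mul0r.
  rewrite (ext (fun l => gap (k.+1 + l))); [|clear -dM J0; lia|by move=> l; exact: gap_ge0].
  rewrite (ext (fun l => gap (k + M.+1 - l))); [|clear -dM J0'; lia|by move=> l; exact: gap_ge0].
  rewrite [X in _ <= _ + X]big_nat_rev /= -big_split /= mulr_suml !big_nat.
  apply: ler_sum => l /andP[_ lM].
  rewrite add0n subSS (_ : k + M.+1 - (M - l) = k.+1 + l)%N; last by clear -lM; lia.
  rewrite -mulrDl [leLHS]mulrC ler_wpM2r ?gap_ge0 // -natrD ler_nat.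
  by clear -dM lM; lia.
have C1 := barrier_side_cost R d d4 F _ _ _ _ F0 S1.
have C2 := barrier_side_cost R d d4 F _ _ _ _ F0 S2.
have hM1 : (d - J <= M)%N by clear -dM J0; lia.
have hM2 : (d - J' <= M)%N by clear -dM J0'; lia.
have h10 : (0 < d - J)%N by clear -Js sd d4; lia.
have h20 : (0 < d - J')%N by clear -Js' sd' d4; lia.
have N0 : 0 <= 2 * D by rewrite mulr_ge0.
have := @cluster_bound R n e z e_sym z_mono k M (d - J) (d - J') (2 * D) F _ _ N0 kn1 h10 h20 hM1 hM2 _ _ H1.
move=> /(_ (F - (cut (k + M.+2) - J')%:R * gap (k + M.+2))) key.
have {}key : 2 * D * (z (k + M.+1)%N - z k) <=
    2 * D * ((F - (cut k - J)%:R * gap k) / (d - J)%:R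
       + (F - (cut (k + M.+2) - J')%:R * gap (k + M.+2)) / (d - J')%:R)
    + F * (M%:R - ((d - J)%:R + (d - J')%:R) / 2).
  apply: key.
  - by move=> l lM; apply: fF; clear -lM; lia.
  - move=> l l0 lM; apply: (@coverage_two R n e e_sym e_irr d d4 d_even deg_eq k M l (d - J) (d - J')) => //.
    + exact: ltnW.
    + by clear -Js sd d4; lia.
    + by clear -Js' sd' d4; lia.
    + by clear -J0 d4; lia.
    + by clear -J0' d4; lia.
    + move=> i hi; apply: (strong_cut n e d d4 d_even cut_even); last exact: nw.
      by clear -hi kMn; lia.
  - apply: le_trans H2; rewrite le_eqVlt; apply/orP; left; apply/eqP.
    rewrite !big_nat; apply: eq_bigr => l /andP[_ hl].
    by congr (_ * gap _); clear -hl hM2; lia.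
have -> : M.+2%:R = M%:R + 2 :> R by rewrite -natrD addn2.
move: C1 C2 key; rewrite -/D; lra.
Qed.

Lemma frac_range (F : R) (t : nat) : 0 <= F -> 0 <= F / t%:R <= F.
Proof.
move=> F0; rewrite divr_ge0 //=.
case: t => [|t]; first by rewrite invr0 mulr0.
by rewrite ler_pdivrMr ?ltr0n // ler_peMr // ler1n.
Qed.

Lemma barrier_share_range (F g : R) (s t : nat) : 0 <= F -> 0 <= g <= F / s%:R ->
  - (2 * F) <= g - F / s%:R + (F / s%:R + F / t%:R - F / (2 * D)) / 2 <= F.
Proof.
move=> F0 /andP[g0 gF].
have /andP[a1 a2] := frac_range F s F0; have /andP[b1 b2] := frac_range F t F0.
have : 0 <= F / (2 * D) <= F by rewrite /D -natrM; exact: frac_range.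
move=> /andP[c1 c2]; apply/andP; split; lra.
Qed.

(** The scheme of [density_one], with barriers of one or two weak cuts. Only the outermost barriers
    and flat stretches contribute to the additive term. *)
Lemma density_two a b F : (a <= b)%N -> (b < n)%N -> 0 <= F ->
  (forall k, (a < k <= b)%N -> flux k <= F) ->
  2 * D * (z b - z a) <= F * ((b - a)%:R + 10 * (2 * D)).
Proof.
move=> ab bn F0 fF.
have N0 : 0 <= 2 * D by rewrite mulr_ge0.
have D0 : 2 <= D by exact: D_ge2.
have NF0 : 0 <= 2 * D * F by rewrite mulr_ge0.
have far := weak_cuts_far2 n e e_sym e_irr d d4 d_even deg_eq.
have gapF k : (a < k <= b)%N -> gap k <= F / (cut k)%:R.
  move=> hk; apply: gap_le_flux => //; last exact: fF.
  by clear -hk bn; lia.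
have gap1 k : (a < k <= b)%N -> gap k <= F.
  by move=> hk; apply: le_trans (gapF k hk) _; have /andP[] := frac_range F (cut k) F0.
have flat p L : (a <= p)%N -> (p + L <= b)%N ->
    (forall j, (p < j < (p + L).+1)%N -> ~~ weak j) ->
    2 * D * (z (p + L)%N - z p) <= F * (L%:R + 2 * (2 * D)).
  move=> ap pLb nw.
  have -> : (p + L)%N = (p.+1 + L).-1 by rewrite addSn.
  apply: (@flat_bound R n e z e_sym z_mono p.+1 L (2 * D) F) => //; first by clear -pLb bn; lia.
    move=> i hi; split; [apply: cut_gt0; clear -hi pLb bn; lia|].
    by apply: fF; clear -hi ap pLb; lia.
  move=> i pi iL.
  have dd i' : (p < i' < (p + L).+1)%N -> (d <= cut i')%N.
    move=> hi; apply: (strong_cut n e d d4 d_even cut_even); last exact: nw.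
    by clear -hi pLb bn; lia.
  have c1 : (d <= cut i)%N by apply: dd; clear -pi iL; lia.
  have c2 : (d <= cut i.+1)%N by apply: dd; clear -pi iL; lia.
  have c3 : (d <= cut i.-1)%N by apply: dd; clear -pi iL; lia.
  have i0 : (i.-1 < n)%N by clear -iL pLb bn; lia.
  have i1 : (i < n)%N by clear -iL pLb bn; lia.
  have := cut_step n e e_sym e_irr d d4 d_even deg_eq i i1.
  have := cut_step n e e_sym e_irr d d4 d_even deg_eq i.-1 i0.
  rewrite prednK => [s1 s2|]; last by clear -pi; lia.
  rewrite /D -natrM -!natrD ler_nat; clear -s1 s2 c1 c2 c3; lia.
have share_hi k : (a < k <= b)%N -> - (2 * F) <= high_share F k <= F.
  move=> hk; rewrite /high_share; case: ifP => _.
    by apply: barrier_share_range => //; rewrite gap_ge0 //= gapF.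
  by have := gap_ge0 R z z_mono k; have := gap1 k hk => *; apply/andP; split; lra.
have share_lo k : (a < k <= b)%N -> - (2 * F) <= low_share F k.
  move=> hk; rewrite /low_share; case: ifP => _.
    have : 0 <= gap k <= F / (cut k)%:R by rewrite gap_ge0 //= gapF.
    by move=> /(barrier_share_range F _ _ (cut k.-1) F0) /andP[].
  by have := gap_ge0 R z z_mono k; lra.
(* The growth up to a barrier entered at [k], including the share charged to the cluster below; [Q]
   carries it across the barrier. *)
pose P k := 2 * D * (z k.-1 - z a) + 2 * D * high_share F k <= F * ((k - a)%:R + 4 * (2 * D)).
(* Three consecutive weak cuts would contain two at distance 2, and cut 1 has [d] edges; so a
   barrier has at most two cuts. *)
have not1 k : (0 < k)%N -> (k < n)%N -> weak k -> weak k.-1 -> ~~ weak k.-2 /\ (1 < k)%N.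
  move=> k0 kn w1 w2.
  have k2 : (1 < k)%N.
    rewrite ltn_neqAle k0 andbT; apply/eqP => k1; move: w1 w2; rewrite -k1 /= => w1 w2.
    have := cut_step n e e_sym e_irr d d4 d_even deg_eq 0 (leq_ltn_trans (leq0n _) kn).
    have -> : span2 0 1 = 0%N by rewrite /span2 /ecount big_geq.
    have -> : cut 0 = 0%N by rewrite /cut /span2 /ecount big_geq.
    by clear -w1 d4; lia.
  split=> //; apply/negP => w3.
  have := far k.-2 2%N isT; rewrite (_ : k.-2 + 2 = k)%N; last by clear -k2; lia.
  by move=> /(_ (ltnW kn) w3 w1); clear -d4; lia.
have Q j : (a < j <= b)%N -> weak j -> ~~ weak j.+1 ->
    (forall i, (i <= j)%N -> (a < i <= b)%N -> weak i -> ~~ weak i.-1 -> P i) ->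
    2 * D * (z j - z a) - 2 * D * low_share F j <= F * ((j - a)%:R + 4 * (2 * D)).
  move=> hj wj nwj IH.
  have j0 : (0 < j)%N by clear -hj; lia.
  have jn : (j < n)%N by clear -hj bn; lia.
  have [wj1|nwj1] := boolP (weak j.-1); last first.
    have := IH j (leqnn j) hj wj nwj1.
    by rewrite /P /low_share /high_share (negbTE nwj) (negbTE nwj1) /gap; lra.
  have [nwj2 j1] := not1 j j0 jn wj wj1.
  have [aj|ja] := ltnP a j.-1; last first.
    have -> : a = j.-1 by clear -ja hj; lia.
    have := share_lo j hj => slo; have := gap1 j hj; rewrite /gap => gj.
    have : 2 * D * (z j - z j.-1) <= 2 * D * F by rewrite ler_wpM2l.
    have : 2 * D * (- (2 * F)) <= 2 * D * low_share F j by rewrite ler_wpM2l.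
    have : 0 <= F * (j - j.-1)%:R by rewrite mulr_ge0.
    by move: NF0; lra.
  have hj1 : (a < j.-1 <= b)%N by clear -aj hj; lia.
  have := IH j.-1 (leq_pred _) hj1 wj1 nwj2.
  rewrite /P /low_share /high_share prednK // wj wj1.
  have e4 : 2 * D * (F / (2 * D)) = F by rewrite mulrC divfK // gt_eqF //; lra.
  have e5 : (j - a)%:R = (j.-1 - a)%:R + 1 :> R.
    by rewrite natr1; congr _%:R; clear -aj; lia.
  rewrite e5 /gap; move: e4; lra.
have HP k : (a < k <= b)%N -> weak k -> ~~ weak k.-1 -> P k.
  elim/ltn_ind: k => k IH hk wk nwk.
  have k0 : (0 < k)%N by clear -hk; lia.
  have /andP[_ shk] := share_hi k hk.
  have [none|[j /andP[hj wj] jmax]] := last_between (fun i => weak i) a k.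
    have ak : (a <= a)%N by [].
    have akb : (a + (k.-1 - a) <= b)%N by clear -hk; lia.
    have := flat a (k.-1 - a)%N ak akb.
    rewrite (_ : a + (k.-1 - a) = k.-1)%N; last by clear -hk; lia.
    rewrite prednK // => /(_ none) f1.
    have e1 : F * (k.-1 - a)%:R <= F * (k - a)%:R.
      by rewrite ler_wpM2l // ler_nat; clear; lia.
    have : 2 * D * high_share F k <= 2 * D * F by rewrite ler_wpM2l.
    by rewrite /P; move: f1 e1 NF0; lra.
  have jk : (j.+1 < k)%N.
    rewrite ltn_neqAle; apply/andP; split; last by clear -hj; lia.
    by apply/eqP => E; move: nwk; rewrite -E /= wj.
  have nwj : ~~ weak j.+1 by apply: jmax; clear -jk; lia.
  have hjb : (a < j <= b)%N by clear -hj hk; lia.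
  have q := Q j hjb wj nwj.
  have {}q : 2 * D * (z j - z a) - 2 * D * low_share F j <= F * ((j - a)%:R + 4 * (2 * D)).
    by apply: q => i ij hi wi nwi; apply: IH => //; clear -ij hj; lia.
  have j0 : (0 < j)%N by clear -hj; lia.
  have := @cluster_two F j (k - j).-2 F0 j0.
  rewrite (_ : (k - j).-2.+2 = k - j)%N; last by clear -jk; lia.
  rewrite subnKC; last by clear -jk; lia.
  rewrite (_ : (j + (k - j).-2.+1 = k.-1)%N); last by clear -jk; lia.
  have kn : (k < n)%N by clear -hk bn; lia.
  move=> /(_ kn wj wk jmax) cl.
  have {}cl : 2 * D * (z k.-1 - z j) + 2 * D * low_share F j + 2 * D * high_share F k
      <= F * (k - j)%:R.
    by apply: cl => i hi; apply: fF; clear -hi hk hj; lia.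
  have e1 : (k - a)%:R = (k - j)%:R + (j - a)%:R :> R.
    by rewrite -natrD; congr _%:R; clear -hj; lia.
  by move: cl q; rewrite /P e1; lra.
have abn : (a + (b - a) <= b)%N by clear -ab; lia.
have [none|[j /andP[hj wj] jmax]] := last_between (fun i => weak i) a b.+1.
  have := flat a (b - a)%N (leqnn a) abn; rewrite subnKC // => /(_ none).
  by move: NF0; lra.
have hjb : (a < j <= b)%N by clear -hj; lia.
have aj : (a <= j)%N by clear -hj; lia.
have jb : (j <= b)%N by clear -hj; lia.
have jbb : (j + (b - j) <= b)%N by clear -jb; lia.
have := flat j (b - j)%N aj jbb; rewrite subnKC // => /(_ jmax) f1.
have gj : 2 * D * gap j <= 2 * D * F by rewrite ler_wpM2l // gap1.
have e1 : (b - a)%:R = (b - j)%:R + (j - a)%:R :> R.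
  by rewrite -natrD; congr _%:R; clear -hj; lia.
have j0 : (0 < j)%N by clear -hj; lia.
have jn : (j < n)%N by clear -jb bn; lia.
rewrite e1; move: gj; rewrite /gap => gj.
have [wj1|nwj1] := boolP (weak j.-1); last first.
  have := HP j hjb wj nwj1; rewrite /P.
  have /andP[sh _] := share_hi j hjb.
  have : 2 * D * (- (2 * F)) <= 2 * D * high_share F j by rewrite ler_wpM2l.
  by move: f1 gj NF0; lra.
have [nwj2 j1] := not1 j j0 jn wj wj1.
have [aj1|ja] := ltnP a j.-1; last first.
  have E : a = j.-1 by clear -ja hj; lia.
  have : 0 <= F * (j - a)%:R by rewrite mulr_ge0.
  by move: f1 gj NF0; rewrite E; lra.
have hj1 : (a < j.-1 <= b)%N by clear -aj1 hj; lia.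
have := HP j.-1 hj1 wj1 nwj2; rewrite /P.
have /andP[sh _] := share_hi j.-1 hj1.
have gj1 : 2 * D * gap j.-1 <= 2 * D * F by rewrite ler_wpM2l // gap1.
have : 2 * D * (- (2 * F)) <= 2 * D * high_share F j.-1 by rewrite ler_wpM2l.
have : F * (j.-1 - a)%:R <= F * (j - a)%:R.
  by rewrite ler_wpM2l // ler_nat; clear; lia.
by move: gj1 f1 gj NF0; rewrite /gap; lra.
Qed.

End DensityTwoBound.

(** * Discrete Wirtinger inequality *)

Section Wirtinger.
Variables (R : realFieldType) (n : nat) (lam : R) (phi S : nat -> R).
Hypothesis phi_gt0 : forall k, (0 < k < n)%N -> 0 < phi k.
Hypothesis phi0 : phi 0 = 0.
Hypothesis phin : phi n = 0.
Hypothesis phi_rec : forall k, (0 < k < n)%N -> phi k.-1 + phi k.+1 = (2 - lam) * phi k.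
Hypothesis S0 : S 0 = 0.
Hypothesis Sn : S n = 0.

(* Picone's inequality: [S k = phi k * (S k / phi k)] for the ground state [phi]. *)
Lemma wirtinger :
  lam * \sum_(0 <= k < n) S k ^+ 2 <= \sum_(0 <= k < n) (S k - S k.+1) ^+ 2.
Proof.
have [->|n0] := posnP n; first by rewrite !big_geq // mulr0.
pose A k := S k ^+ 2 * (1 - phi k.+1 / phi k).
pose B k := S k ^+ 2 * (1 - phi k.-1 / phi k).
apply: (@le_trans _ _ (\sum_(0 <= k < n) (A k + B k.+1))); last first.
  rewrite !big_nat; apply: ler_sum => k /andP[_ kn]; rewrite /A /B /=.
  have [->|k0] := posnP k.
    by rewrite S0 expr0n /= mul0r add0r phi0 mul0r subr0 mulr1 sub0r sqrrN.
  have [kn1|kn1] := eqVneq k.+1 n.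
    by rewrite kn1 Sn phin expr0n /= mul0r mul0r addr0 !subr0 mulr1.
  have pk : 0 < phi k by apply: phi_gt0; rewrite k0.
  have pk1 : 0 < phi k.+1 by apply: phi_gt0; rewrite /= ltn_neqAle kn1.
  set q := phi k.+1 / phi k.
  have -> : phi k / phi k.+1 = q^-1 by rewrite invf_div.
  have q0 : 0 < q by rewrite divr_gt0.
  have eq1 : q * q^-1 = 1 by rewrite mulfV // gt_eqF.
  have qv : 0 < q^-1 by rewrite invr_gt0.
  have : 0 <= q^-1 * (q * S k - S k.+1) ^+ 2 by rewrite mulr_ge0 ?sqr_ge0 // ltW.
  have -> : q^-1 * (q * S k - S k.+1) ^+ 2 =
     (q * q^-1) * q * S k ^+ 2 - 2 * (q * q^-1) * S k * S k.+1 + q^-1 * S k.+1 ^+ 2.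
    by move: (q^-1) => v; lra.
  by rewrite eq1; lra.
rewrite big_split /=.
have -> : \sum_(0 <= k < n) B k.+1 = \sum_(0 <= k < n) B k.
  rewrite -(big_add1 _ _ 0 n.+1 predT B) /= [in RHS](big_ltn n0).
  rewrite big_nat_recr //= /B Sn S0 expr0n /= !mul0r addr0 add0r.
  by rewrite big_add1.
rewrite -big_split mulr_sumr /= !big_nat; apply: ler_sum => k /andP[_ kn].
have [->|k0] := posnP k; first by rewrite /A /B S0 expr0n /= !mul0r mulr0 addr0.
have hk : (0 < k < n)%N by rewrite k0.
have pk := phi_gt0 k hk.
have E : phi k.-1 / phi k + phi k.+1 / phi k = 2 - lam.
  by rewrite -mulrDl phi_rec // mulfK // gt_eqF.
rewrite /A /B -mulrDr.
rewrite (_ : 1 - _ + (1 - _) = 2 - (phi k.-1 / phi k + phi k.+1 / phi k)); last by lra.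
by rewrite E; lra.
Qed.

End Wirtinger.

Lemma argmax_between (R : realFieldType) (f : nat -> R) (a K : nat) : (0 < K)%N ->
  exists2 m, (a < m <= a + K)%N & forall k, (a < k <= a + K)%N -> f k <= f m.
Proof.
elim: K => // -[_ _|K IH _].
  exists a.+1; first by lia.
  by move=> k hk; rewrite (_ : k = a.+1) //; lia.
have [//|m hm mmax] := IH.
have [le|/ltW le] := lerP (f (a + K.+2)%N) (f m).
  exists m; first by lia.
  move=> k hk; have [->//|kK] := eqVneq k (a + K.+2)%N.
  by apply: mmax; lia.
exists (a + K.+2)%N; first by lia.
move=> k hk; have [->//|kK] := eqVneq k (a + K.+2)%N.
by apply: le_trans le; apply: mmax; lia.
Qed.

Lemma sum_sqr_le (R : realFieldType) (a K : nat) (f : nat -> R) :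
  (\sum_(a <= i < a + K) f i) ^+ 2 <= K%:R * \sum_(a <= i < a + K) f i ^+ 2.
Proof.
elim: K => [|K IH]; first by rewrite addn0 !big_geq // expr0n mul0r.
rewrite addnS !big_nat_recr ?leq_addr //=.
set s := \sum_(_ <= i < _) f i in IH *; set q := \sum_(_ <= i < _) f i ^+ 2 in IH *.
set x := f _.
have [Kz|K0] := eqVneq K 0%N.
  have -> : s = 0 by rewrite /s Kz addn0 big_geq.
  have -> : q = 0 by rewrite /q Kz addn0 big_geq.
  by rewrite Kz; lra.
have Kp : 1 <= K%:R :> R by rewrite ler1n lt0n.
rewrite -natr1.
have kv : 0 < K%:R^-1 :> R by rewrite invr_gt0; lra.
have ek : K%:R * K%:R^-1 = 1 :> R by rewrite mulfV // gt_eqF //; lra.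
have h1 : K%:R^-1 * s ^+ 2 <= q.
  by have := ler_wpM2l (ltW kv) IH; rewrite mulKf // gt_eqF //; lra.
have : 0 <= K%:R * (x - K%:R^-1 * s) ^+ 2 by rewrite mulr_ge0 ?sqr_ge0.
have -> : K%:R * (x - K%:R^-1 * s) ^+ 2 = K%:R * x ^+ 2 - 2 * (K%:R * K%:R^-1) * x * s
   + K%:R * K%:R^-1 * (K%:R^-1 * s ^+ 2) by move: (K%:R^-1 : R) => v; lra.
rewrite ek; move: IH h1; lra.
Qed.

(** * From the growth bound to a lower bound on the eigenvalue, by blocks *)

Section SpectralBound.
Variables (R : realFieldType) (n : nat) (z : nat -> R).
Hypothesis z_mono : forall i j, (i <= j)%N -> z i <= z j.
Hypothesis z_sum : \sum_(0 <= i < n) z i = 0.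
Local Notation gap := (gap R z).

Definition tail (k : nat) : R := \sum_(k <= i < n) z i.

Lemma tail_ge n' : (n <= n')%N -> tail n' = 0.
Proof. by move=> h; rewrite /tail big_geq. Qed.

Lemma tail0 : tail 0 = 0. Proof. exact: z_sum. Qed.

Lemma tail_step k : (k < n)%N -> tail k - tail k.+1 = z k.
Proof. by move=> kn; rewrite /tail big_ltn // addrK. Qed.

Lemma tail_ge0 k : 0 <= tail k.
Proof.
have [kn|nk] := leqP k n; last by rewrite tail_ge // ltnW.
have [zk|zk] := lerP 0 (z k).
  rewrite /tail big_nat sumr_ge0 // => i /andP[ki _].
  exact: le_trans (z_mono _ _ ki).
have : \sum_(0 <= i < k) z i + tail k = 0 by rewrite -big_cat_nat.
have : \sum_(0 <= i < k) z i <= 0.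
  rewrite big_nat sumr_le0 // => i /andP[_ ik].
  exact: le_trans (z_mono _ _ (ltnW ik)) (ltW zk).
lra.
Qed.

(** Summation by parts; the boundary term is a multiple of the total sum, which is 0. *)
Lemma sum_sqr_gap_tail :
  \sum_(0 <= i < n) z i ^+ 2 = \sum_(1 <= k < n) gap k * tail k.
Proof.
have -> : \sum_(1 <= k < n) gap k * tail k = \sum_(0 <= i < n) z i * (z i - z 0).
  rewrite /tail; elim: (n) => [|m IH]; first by rewrite !big_geq.
  rewrite [RHS]big_nat_recr //= -IH.
  case: m {IH} => [|m].
    by rewrite !big_geq // subrr mulr0 addr0.
  rewrite [LHS]big_nat_recr //= big_nat1.
  rewrite -(sum_gap R z 0 m.+1) // [in X in _ = _ + X]big_nat_recr //=.
  rewrite big_nat (eq_bigr (fun k => gap k * (\sum_(k <= i < m.+1) z i) + gap k * z m.+1)).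
    by rewrite -big_nat big_split /= -mulr_suml; lra.
  by move=> k /andP[k0 km]; rewrite big_nat_recr ?mulrDr //; exact: ltnW.
under [RHS]eq_bigr do rewrite mulrBr.
rewrite sumrB -mulr_suml z_sum mul0r subr0.
by apply: eq_bigr => i _; rewrite expr2.
Qed.

Variables (mu N C lam eps : R) (K : nat).
Hypothesis mu_ge0 : 0 <= mu.
Hypothesis N_gt0 : 0 < N.
Hypothesis C_ge0 : 0 <= C.
Hypothesis eps_gt0 : 0 < eps.
Hypothesis K_gt0 : (0 < K)%N.
Hypothesis density : forall a b F, (a <= b)%N -> (b < n)%N -> 0 <= F ->
  (forall k, (a < k <= b)%N -> mu * tail k <= F) ->
  N * (z b - z a) <= F * ((b - a)%:R + C).

Let step k : R := tail k - tail k.+1.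

(** Young's inequality for [tail m = tail k + (tail m - tail k)]; the difference is a sum of at most
    [K] steps and is bounded by Cauchy-Schwarz. *)
Lemma tail_block a m k : (a < m <= a + K)%N -> (a < k <= a + K)%N ->
  tail m ^+ 2 <= (1 + eps) * tail k ^+ 2
     + (1 + eps^-1) * (K%:R * \sum_(a.+1 <= i < a.+1 + K) step i ^+ 2).
Proof.
move=> hm hk.
set V := \sum_(_ <= i < _) step i ^+ 2.
have tel p q : (p <= q)%N -> tail p - tail q = \sum_(p <= i < q) step i.
  move=> pq; rewrite /step -opprB -telescope_sumr // -sumrN.
  by apply: eq_bigr => i _; rewrite opprB.
have bound p q : (a < p)%N -> (p <= q)%N -> (q <= a + K)%N ->
    (tail p - tail q) ^+ 2 <= K%:R * V.
  move=> ap pq qa; rewrite tel //.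
  have qE : q = (p + (q - p))%N by rewrite subnKC.
  rewrite {1}qE; apply: le_trans (sum_sqr_le R p (q - p) step) _.
  rewrite -qE; apply: ler_pM; rewrite ?ler_nat //; last 2 first.
  - lia.
  - have pK : (p <= a.+1 + K)%N by lia.
    have qK : (q <= a.+1 + K)%N by lia.
    rewrite /V (@big_cat_nat _ _ _ p a.+1) //=.
    rewrite [X in _ <= _ + X](@big_cat_nat _ _ _ q p) //=.
    rewrite addrCA lerDl addr_ge0 // sumr_ge0 // => i _; exact: sqr_ge0.
  by rewrite sumr_ge0 // => i _; exact: sqr_ge0.
have D2 : (tail m - tail k) ^+ 2 <= K%:R * V.
  have [mk|/ltnW km] := leqP m k; first by apply: bound => //; lia.
  by rewrite -sqrrN opprB; apply: bound => //; lia.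
have ev : 0 < eps^-1 by rewrite invr_gt0.
have ee : eps * eps^-1 = 1 by rewrite mulfV // gt_eqF.
have : 0 <= eps^-1 * ((tail m - tail k) - eps * tail k) ^+ 2.
  by rewrite mulr_ge0 ?sqr_ge0 // ltW.
have -> : eps^-1 * ((tail m - tail k) - eps * tail k) ^+ 2 =
  eps^-1 * (tail m - tail k) ^+ 2 - 2 * (eps * eps^-1) * (tail m - tail k) * tail k
   + (eps * eps^-1) * eps * tail k ^+ 2.
  by move: (eps^-1) => v; lra.
rewrite ee.
have := ler_wpM2l (_ : 0 <= 1 + eps^-1) D2.
move=> /(_ ltac:(lra)).
lra.
Qed.

(** On a block all currents are at most [mu] times the largest tail, so [density] bounds the
    increase of [z] there. Then [tail_block] replaces the maximum by the block average, at the price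
    of squared steps; as steps are values of [z], these are of lower order. *)
Lemma block_sum a :
  N * K%:R * \sum_(a <= i < a + K) gap i.+1 * tail i.+1 <=
  mu * (K%:R + C) * ((1 + eps) * \sum_(a <= i < a + K) tail i.+1 ^+ 2
     + (1 + eps^-1) * (K%:R ^+ 2 * \sum_(a <= i < a + K) step i.+1 ^+ 2)).
Proof.
have [m hm mmax] := argmax_between R tail a K K_gt0.
have tm := tail_ge0 m.
have ev : 0 < eps^-1 by rewrite invr_gt0.
set V := \sum_(_ <= i < _) step i.+1 ^+ 2.
have VE : V = \sum_(a.+1 <= i < a.+1 + K) step i ^+ 2 by rewrite big_add1 addSn.
have V0 : 0 <= V by rewrite sumr_ge0 // => i _; exact: sqr_ge0.
have Kr : 0 < K%:R :> R by rewrite ltr0n.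
apply: (@le_trans _ _ (mu * (K%:R + C) * (K%:R * tail m ^+ 2))); last first.
  rewrite ler_wpM2l ?mulr_ge0 ?addr_ge0 //.
  have : \sum_(a <= i < a + K) tail m ^+ 2 <= \sum_(a <= i < a + K)
     ((1 + eps) * tail i.+1 ^+ 2 + (1 + eps^-1) * (K%:R * V)).
    rewrite !big_nat; apply: ler_sum => i hi.
    by rewrite VE; apply: tail_block => //; lia.
  rewrite big_split /= -[X in _ <= X + _]mulr_sumr !sumr_const_nat addKn.
  rewrite -(mulr_natl (tail m ^+ 2)) -(mulr_natl ((1 + eps^-1) * _)) (expr2 K%:R); lra.
have [an|na] := ltnP a n; last first.
  rewrite big_nat big1 ?mulr0 ?mulr_ge0 ?addr_ge0 ?sqr_ge0 //.
  by move=> i /andP[ai _]; rewrite tail_ge ?mulr0 //; clear -ai na; lia.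
(* The last blocks may leave the range where [density] applies; the tails beyond it are 0. *)
pose b := minn (a + K) n.-1.
have ab : (a <= b)%N by rewrite /b; clear -an; lia.
have bn : (b < n)%N by rewrite /b; clear -an; lia.
have mm : 0 <= mu * tail m by rewrite mulr_ge0.
have dens : N * (z b - z a) <= mu * tail m * ((b - a)%:R + C).
  apply: density => // k hk; rewrite ler_wpM2l // mmax //.
  by move: hk; rewrite /b; clear; lia.
have : \sum_(a <= i < a + K) gap i.+1 * tail i.+1 <= tail m * (z b - z a).
  rewrite (@big_cat_nat _ _ _ b) //=; last by rewrite /b geq_minl.
  rewrite [X in _ + X]big_nat [X in _ + X]big1 ?addr0; last first.
    by move=> i /andP[bi iK]; rewrite tail_ge ?mulr0 //; move: bi iK; rewrite /b; clear; lia.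
  rewrite -(sum_gap R z a b) // big_add1 /= mulr_sumr !big_nat.
  apply: ler_sum => i hi; rewrite mulrC ler_wpM2r ?gap_ge0 // mmax //.
  by move: hi; rewrite /b; clear; lia.
move=> h1.
have bK : (b - a)%:R <= K%:R :> R by rewrite ler_nat /b; clear; lia.
have h2 := ler_wpM2l (_ : 0 <= N * K%:R) h1.
apply: le_trans (h2 _) _; first by rewrite mulr_ge0 // ltW.
have h3 := ler_wpM2l tm dens.
have h4 : mu * tail m * ((b - a)%:R + C) <= mu * tail m * (K%:R + C).
  by rewrite ler_wpM2l // lerD2r.
have h5 := ler_wpM2l tm h4.
have := ler_wpM2l (ltW Kr) (le_trans h3 h5).
lra.
Qed.

Lemma spectral_block_bound (lam_ge0 : 0 <= lam) :
  lam * \sum_(0 <= k < n) tail k ^+ 2 <= \sum_(0 <= k < n) step k ^+ 2 ->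
  0 < \sum_(0 <= i < n) z i ^+ 2 ->
  N * K%:R * lam <= mu * (K%:R + C) * (1 + eps + (1 + eps^-1) * (K%:R ^+ 2 * lam)).
Proof.
move=> wirt z2.
have ev : 0 < eps^-1 by rewrite invr_gt0.
have Kr : 0 < K%:R :> R by rewrite ltr0n.
have szE : \sum_(0 <= k < n) step k ^+ 2 = \sum_(0 <= i < n) z i ^+ 2.
  by rewrite !big_nat; apply: eq_bigr => k /andP[_ kn]; rewrite /step tail_step.
have n0 : (0 < n)%N.
  by rewrite lt0n; apply/eqP => n0; move: z2; rewrite n0 big_geq // ltxx.
(* Taking [n] blocks overshoots the range, which is harmless by [ext] and avoids a division of [n]
   by [K]. *)
have nK : (n <= n * K)%N by rewrite leq_pmulr.
have ext (f : nat -> R) : (forall i, (n <= i)%N -> f i = 0) ->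
    \sum_(0 <= i < n * K) f i.+1 = \sum_(0 <= i < n) f i - f 0.
  move=> f0; rewrite [in RHS]big_ltn // addrC addKr -[in LHS](big_add1 _ _ 0 (n * K).+1 predT f) /=.
  rewrite (@big_cat_nat _ _ _ n) //=; last by clear -nK; lia.
  by rewrite [X in _ + X]big_nat [X in _ + X]big1 ?addr0 // => i /andP[ni _]; exact: f0.
have key : N * K%:R * \sum_(0 <= i < n * K) gap i.+1 * tail i.+1 <=
   mu * (K%:R + C) * ((1 + eps) * \sum_(0 <= i < n * K) tail i.+1 ^+ 2
     + (1 + eps^-1) * (K%:R ^+ 2 * \sum_(0 <= i < n * K) step i.+1 ^+ 2)).
  rewrite !big_nat_mul !mulr_sumr -big_split /= mulr_sumr.
  by apply: ler_sum => j _; rewrite mulSn addnC; exact: block_sum.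
move: key.
rewrite (ext (fun i => gap i * tail i)); last by move=> i ni; rewrite tail_ge // mulr0.
rewrite (ext (fun i => tail i ^+ 2)); last by move=> i ni; rewrite tail_ge // expr0n.
rewrite (ext (fun i => step i ^+ 2)); last first.
  by move=> i ni; rewrite /step !tail_ge ?subrr ?expr0n // ltnW.
rewrite tail0 mulr0 expr0n /= !subr0 szE.
have -> : \sum_(0 <= i < n) gap i * tail i = \sum_(0 <= i < n) z i ^+ 2.
  by rewrite sum_sqr_gap_tail big_ltn // tail0 mulr0 add0r.
rewrite szE in wirt.
set Z := \sum_(0 <= i < n) z i ^+ 2 in z2 wirt *.
set T := \sum_(0 <= i < n) tail i ^+ 2 in wirt *.
have st0 : 0 <= step 0 ^+ 2 by exact: sqr_ge0.
move=> key.
have M0 : 0 <= mu * (K%:R + C) by rewrite mulr_ge0 // addr_ge0.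
have k2 : N * K%:R * Z <= mu * (K%:R + C) * ((1 + eps) * T + (1 + eps^-1) * (K%:R ^+ 2 * Z)).
  apply: le_trans key _; rewrite ler_wpM2l // lerD2l ler_wpM2l ?ler_wpM2l ?sqr_ge0 //; lra.
rewrite -(ler_pM2r z2).
have := ler_wpM2l lam_ge0 k2.
have : mu * (K%:R + C) * ((1 + eps) * (lam * T)) <= mu * (K%:R + C) * ((1 + eps) * Z).
  by rewrite ler_wpM2l // ler_wpM2l // addr_ge0 // ltW.
lra.
Qed.

End SpectralBound.

(** * Ordering the vertices of a graph by a function *)

Section Relabel.
Variables (R : realType) (m : nat).
Local Notation n := m.+1.
Variables (G : sgraph n) (f : 'I_n -> R).

Definition vsort : seq 'I_n := sort (fun x y => f x <= f y) (enum 'I_n).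

Definition vtx (i : nat) : 'I_n := nth ord0 vsort i.

Definition redge : rel nat := fun i j => G (vtx i) (vtx j).

(** Clamping the index at the last vertex makes the values nondecreasing on all of [nat], as the
    sections above assume. *)
Definition rval (i : nat) : R := f (vtx (minn i m)).

Lemma size_vsort : size vsort = n.
Proof. by rewrite size_sort size_enum_ord. Qed.

Lemma sum_vtx (T : nmodType) (F : 'I_n -> T) :
  \sum_(0 <= i < n) F (vtx i) = \sum_x F x.
Proof.
rewrite -[RHS]big_enum /= -(perm_big _ (permEl (perm_sort (fun x y => f x <= f y) (enum 'I_n)))).
by rewrite (big_nth ord0) size_vsort.
Qed.

Lemma rval_mono i j : (i <= j)%N -> rval i <= rval j.
Proof.
move=> ij; rewrite /rval.
have tot : total (fun x y => f x <= f y) by move=> x y; exact: le_total.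
have tr : transitive (fun x y => f x <= f y) by move=> y x w; exact: le_trans.
have := @sorted_leq_nth _ (fun x y => f x <= f y) tr (fun x => lexx (f x)) ord0 vsort.
move=> /(_ (sort_sorted tot _)); apply.
- by rewrite inE size_vsort ltnS geq_minr.
- by rewrite inE size_vsort ltnS geq_minr.
- by rewrite leq_min geq_minr andbT (leq_trans (geq_minl _ _)).
Qed.

Lemma redge_sym : symmetric redge.
Proof. by move=> i j; rewrite /redge adj_sym. Qed.

Lemma redge_irr : irreflexive redge.
Proof. by move=> i; rewrite /redge adj_irrefl. Qed.

Lemma rvalE i : (i < n)%N -> rval i = f (vtx i).
Proof. by move=> ni; rewrite /rval (minn_idPl _). Qed.

Lemma redge_deg i : ecount redge i i.+1 0 n = deg G (vtx i).
Proof.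
rewrite ecount_row (sum_vtx _ (fun y => G (vtx i) y : nat)) /deg -sum1_card.
by rewrite [RHS]big_mkcond; apply: eq_bigr => y _; rewrite inE; case: (G _ _).
Qed.

(** If the cut were empty, the first [k] vertices would be closed under adjacency. *)
Lemma redge_cut : connected_graph G ->
  forall k, (0 < k < n)%N -> (0 < cut n redge k)%N.
Proof.
move=> conn k /andP[k0 kn]; rewrite lt0n; apply/negP => /eqP c0.
have uv : uniq vsort by rewrite sort_uniq enum_uniq.
have nadj i j : (i < k)%N -> (k <= j)%N -> (j < n)%N -> redge i j = false.
  move=> ik kj jn; apply/negP => eij.
  have : (redge i j <= cut n redge k)%N.
    have ik' := ltnW ik; have jn' := ltnW jn.
    rewrite /cut /span2 /ecount (@big_cat_nat _ _ _ i) //=.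
    rewrite (big_ltn ik) (@big_cat_nat _ _ _ j k) //=.
    by rewrite (big_ltn jn); clear; lia.
  by rewrite c0 eij.
pose a : pred 'I_n := [pred x | (index x vsort < k)%N].
have allv x : (index x vsort < n)%N.
  by have := index_mem x vsort; rewrite size_vsort mem_sort mem_enum.
have vi x : vtx (index x vsort) = x by rewrite /vtx nth_index // mem_sort mem_enum.
have cl : fingraph.closed (adj G) a.
  move=> x y xy; rewrite !inE.
  have xy' : redge (index x vsort) (index y vsort) by rewrite /redge !vi.
  case: (ltnP (index x vsort) k) => hx; case: (ltnP (index y vsort) k) => hy //.
    by rewrite (nadj _ _ hx hy (allv y)) in xy'.
  by rewrite redge_sym (nadj _ _ hy hx (allv x)) in xy'.
have := fingraph.closed_connect cl (conn (vtx 0) (vtx k)).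
rewrite !inE /vtx !index_uniq ?size_vsort // k0 => /esym.
by rewrite ltnn.
Qed.

(** Sum the eigenvalue equation over the vertices from [k] on; the edges inside this set contribute
    antisymmetric terms, which cancel. *)
Lemma redge_flux mu : (forall x, \sum_y (G x y)%:R * (f x - f y) = mu * f x) ->
  forall k, (k <= n)%N -> flux R n redge rval k = mu * tail R n rval k.
Proof.
move=> eig k kn; rewrite /tail mulr_sumr.
transitivity (\sum_(k <= j < n) \sum_(0 <= i < n)
    (redge j i)%:R * (rval j - rval i)); last first.
  rewrite !big_nat; apply: eq_bigr => j /andP[kj jn].
  rewrite rvalE // -eig -(sum_vtx _ (fun y => (G (vtx j) y)%:R * (f (vtx j) - f y))).
  by rewrite !big_nat; apply: eq_bigr => i /andP[_ ni]; rewrite rvalE.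
have E : \sum_(k <= j < n) \sum_(k <= i < n) (redge j i)%:R * (rval j - rval i) = 0.
  set X := (X in X = _).
  have : X = - X.
    rewrite {1}/X exchange_big_nat /= /X -sumrN; apply: eq_bigr => j _.
    rewrite -sumrN; apply: eq_bigr => i _.
    by rewrite redge_sym -mulrN opprB.
  lra.
rewrite -[LHS]addr0 -{1}E /flux exchange_big_nat /= -big_split /=.
apply: eq_bigr => j _; rewrite [RHS](@big_cat_nat _ _ _ k) //=; congr (_ + _).
by apply: eq_bigr => i _; rewrite redge_sym.
Qed.

End Relabel.

Lemma ecount_self_even e p : symmetric e -> irreflexive e -> ~~ odd (ecount e 0 p 0 p).
Proof.
move=> e_sym e_irr; elim: p => [|p IH]; first by rewrite /ecount big_geq.
rewrite (@ecount_catl e p) // (@ecount_catr e p 0 p) // (@ecount_catr e p p p.+1) //.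
rewrite (ecount_diag e e_irr) (ecountC e e_sym p p.+1 0 p) addn0.
by rewrite -addnA addnn oddD odd_double addbF.
Qed.

Lemma ecount_regular n e d p : (forall i, (i < n)%N -> ecount e i i.+1 0 n = d) ->
  (p <= n)%N -> ecount e 0 p 0 n = (p * d)%N.
Proof.
move=> deg_eq; elim: p => [|p IH] pn; first by rewrite /ecount big_geq.
rewrite (@ecount_catl e p) // IH; last exact: ltnW.
by rewrite deg_eq // mulSn addnC.
Qed.

(** The degree sum [k * d] of the first [k] vertices is the cut plus twice the number of edges among
    them. *)
Lemma cut_parity n e d : symmetric e -> irreflexive e ->
  (forall i, (i < n)%N -> ecount e i i.+1 0 n = d) -> ~~ odd d ->
  forall k, (k <= n)%N -> ~~ odd (cut n e k).
Proof.
move=> e_sym e_irr deg_eq d_even k kn.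
have := ecount_regular n e d k deg_eq kn.
rewrite (@ecount_catr e k) // -/(span2 n e k k) -/(cut n e k) => E.
have : ~~ odd (k * d) by rewrite oddM (negbTE d_even) andbF.
by rewrite -E oddD (negbTE (ecount_self_even e k e_sym e_irr)).
Qed.

(** * Spectral theorem for real symmetric matrices and the eigenvalue list *)

Section SymmetricSpectrum.
Variable R : realType.

Definition dotr n (x y : 'rV[R]_n) : R := (x *m y^T) 0 0.

Local Arguments dotr {n}.

Lemma dotrE n (x y : 'rV[R]_n) : dotr x y = \sum_i x 0 i * y 0 i.
Proof. by rewrite /dotr mxE; apply: eq_bigr => i _; rewrite mxE. Qed.

Lemma dotrC n (x y : 'rV[R]_n) : dotr x y = dotr y x.
Proof. by rewrite !dotrE; apply: eq_bigr => i _; rewrite mulrC. Qed.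

Lemma dotrDl n (x y w : 'rV[R]_n) : dotr (x + y) w = dotr x w + dotr y w.
Proof. by rewrite /dotr mulmxDl mxE. Qed.

Lemma dotrZl n a (x w : 'rV[R]_n) : dotr (a *: x) w = a * dotr x w.
Proof. by rewrite /dotr -scalemxAl mxE. Qed.

Lemma dotrDr n (x y w : 'rV[R]_n) : dotr w (x + y) = dotr w x + dotr w y.
Proof. by rewrite dotrC dotrDl !(dotrC _ w). Qed.

Lemma dotrZr n a (x w : 'rV[R]_n) : dotr w (a *: x) = a * dotr w x.
Proof. by rewrite dotrC dotrZl dotrC. Qed.

Lemma dotr_ge0 n (x : 'rV[R]_n) : 0 <= dotr x x.
Proof. by rewrite dotrE sumr_ge0 // => i _; rewrite -expr2 sqr_ge0. Qed.

Lemma dotr_eq0 n (x : 'rV[R]_n) : dotr x x = 0 -> x = 0.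
Proof.
rewrite dotrE => /eqP; rewrite psumr_eq0; last by move=> i _; rewrite -expr2 sqr_ge0.
move=> /allP h; apply/rowP => i; rewrite mxE.
by have := h i (mem_index_enum i); rewrite -expr2 sqrf_eq0 => /eqP.
Qed.

Lemma dotr_sym n (A : 'M[R]_n) (x y : 'rV[R]_n) : A^T = A ->
  dotr (x *m A) y = dotr x (y *m A).
Proof. by move=> sA; rewrite /dotr trmx_mul sA mulmxA. Qed.

Lemma continuous_sum (T : topologicalType) (I : finType) (F : I -> T -> R) :
  (forall i, continuous (F i)) -> continuous (fun x => \sum_i F i x).
Proof.
move=> cF; apply: continuous_big => // x.
exact: add_continuous.
Qed.

Lemma continuous_dotr n (A : 'M[R]_n) : continuous (fun x : 'rV[R]_n => dotr (x *m A) x).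
Proof.
have -> : (fun x : 'rV[R]_n => dotr (x *m A) x) =
    (fun x : 'rV[R]_n => \sum_j \sum_i x 0 i * A i j * x 0 j).
  apply/funext => x; rewrite dotrE; apply: eq_bigr => j _.
  by rewrite mxE mulr_suml.
apply: continuous_sum => j; apply: continuous_sum => i x.
apply: (@continuousM _ _ (fun x : 'rV[R]_n => x 0 i * A i j) (fun x : 'rV[R]_n => x 0 j));
  last exact: coord_continuous.
by apply: continuousM; [exact: coord_continuous | exact: cst_continuous].
Qed.

Lemma continuous_mulmx_entry n k (B : 'M[R]_(n, k)) j :
  continuous (fun x : 'rV[R]_n => (x *m B) 0 j).
Proof.
have -> : (fun x : 'rV[R]_n => (x *m B) 0 j) =
    (fun x : 'rV[R]_n => \sum_i x 0 i * B i j).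
  by apply/funext => x; rewrite mxE.
apply: continuous_sum => i x.
by apply: continuousM; [exact: coord_continuous | exact: cst_continuous].
Qed.

(* The maximiser of the Rayleigh quotient on the unit sphere of the orthogonal
   complement of an invariant subspace is an eigenvector. *)
Lemma next_eigenvector n k (A : 'M[R]_n) (U : 'M[R]_(k, n)) (r : 'rV[R]_k) :
  A^T = A -> (k < n)%N -> U *m A = diag_mx r *m U ->
  exists u a, [/\ dotr u u = 1, u *m U^T = 0 & u *m A = a *: u].
Proof.
move=> sA kn UA.
pose S : set 'rV[R]_n := [set x | dotr x x = 1 /\ x *m U^T = 0].
have S0 : S !=set0.
  have /rowV0Pn[v] : kermx U^T != 0.
    rewrite -mxrank_eq0 -lt0n mxrank_ker subn_gt0.
    exact: leq_ltn_trans (rank_leq_col _) kn.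
  move=> /sub_kermxP vU v0.
  have vp : 0 < dotr v v.
    rewrite lt_neqAle dotr_ge0 andbT eq_sym; apply/eqP => /dotr_eq0 h.
    by rewrite h eqxx in v0.
  exists ((Num.sqrt (dotr v v))^-1 *: v); split; last by rewrite -scalemxAl vU scaler0.
  rewrite dotrZl dotrZr mulrA -expr2 exprVn sqr_sqrtr ?ltW // mulVf // gt_eqF //.
have cS : compact S.
  apply: bounded_closed_compact.
    exists 1; split; first exact: num_real.
    move=> M M1 x [x1 _]; rewrite /Num.norm /= mx_normrE.
    apply/bigmax_leP; split; first exact: ltW (lt_trans ltr01 M1).
    move=> [i j] _ /=; rewrite (ord1 i); apply: le_trans (ltW M1).
    rewrite -(@expr_le1 _ 2) // -normrX ger0_norm ?sqr_ge0 // -x1 dotrE (bigD1 j) //= expr2.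
    by rewrite lerDl sumr_ge0 // => l _; rewrite -expr2 sqr_ge0.
  have -> : S = (fun x : 'rV[R]_n => dotr (x *m 1%:M) x) @^-1` [set 1] `&`
      \bigcap_j ((fun x : 'rV[R]_n => (x *m U^T) 0 j) @^-1` [set 0]).
    apply/seteqP; split => x /=.
      by move=> [x1 xU]; split; [rewrite mulmx1 | move=> j _ /=; rewrite xU mxE].
    rewrite mulmx1 => -[x1 xU]; split=> //; apply/rowP => j; rewrite [RHS]mxE.
    exact: (xU j Logic.I).
  apply: closedI; last apply: closed_bigI => j _; apply: preimage_closed.
  - by move=> x _; exact: continuous_dotr.
  - exact: closed_eq.
  - by move=> x _; exact: continuous_mulmx_entry.
  - exact: closed_eq.
have [|u] := @EVT_max_rV R n (fun x => dotr (x *m A) x) S S0 cS.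
  by apply: continuous_subspaceT; exact: continuous_dotr.
rewrite inE => -[u1 uU] umax.
exists u, (dotr (u *m A) u).
set a := dotr (u *m A) u.
split=> //; apply/eqP; rewrite -subr_eq0; apply/eqP/dotr_eq0.
set w := u *m A - a *: u; have wE : w = u *m A - a *: u by [].
clearbody w.
have wU : w *m U^T = 0.
  rewrite wE mulmxBl -scalemxAl uU scaler0 subr0.
  by rewrite -mulmxA -[A]sA -trmx_mul UA trmx_mul mulmxA uU mul0mx.
have wu : dotr u w = 0.
  by rewrite wE dotrDr -scaleNr dotrZr u1 mulr1 dotrC subrr.
have Qle v : v *m U^T = 0 -> dotr (v *m A) v <= a * dotr v v.
  move=> vU; have [->|v0] := eqVneq v 0.
    by rewrite mul0mx /dotr mul0mx mxE mulr0.
  have vp : 0 < dotr v v.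
    rewrite lt_neqAle dotr_ge0 andbT eq_sym; apply/eqP => /dotr_eq0 h.
    by rewrite h eqxx in v0.
  have := umax ((Num.sqrt (dotr v v))^-1 *: v).
  have e1 : (Num.sqrt (dotr v v))^-1 * (Num.sqrt (dotr v v))^-1 = (dotr v v)^-1.
    by rewrite -expr2 exprVn sqr_sqrtr ?dotr_ge0.
  rewrite -scalemxAl !dotrZl dotrZr mulrA e1 => h.
  rewrite -ler_pdivrMr // mulrC; apply: h; rewrite inE; split.
    by rewrite dotrZl dotrZr mulrA e1 mulVf // gt_eqF.
  by rewrite -scalemxAl vU scaler0.
have wA : dotr (u *m A) w = dotr w w.
  have -> : u *m A = w + a *: u by rewrite wE subrK.
  by rewrite dotrDl dotrZl wu mulr0 addr0.
pose q := dotr w w.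
have q0 : 0 <= q by exact: dotr_ge0.
pose p := dotr (w *m A) w.
(* Maximality of [u] tested on [u + t *: w], where [w] is the residual: the term linear in [t]
   forces [q = 0]. *)
have key t : 2 * t * q + t ^+ 2 * p <= a * (t ^+ 2 * q).
  have := Qle (u + t *: w); rewrite mulmxDl uU -scalemxAl wU scaler0 addr0 => /(_ erefl).
  rewrite mulmxDl -scalemxAl !(dotrDl, dotrDr, dotrZl, dotrZr) wA -/a -/p -/q.
  have -> : dotr (w *m A) u = q by rewrite dotr_sym // dotrC wA.
  by rewrite u1 wu (dotrC _ w u) wu; lra.
have [//|qn] := eqVneq q 0.
have qp : 0 < q by rewrite lt_neqAle eq_sym qn.
pose c := `|p| + `|a| * q.
have c0 : 0 <= c by rewrite addr_ge0 // mulr_ge0.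
have cp : - c <= p.
  have : 0 <= `|a| * q by rewrite mulr_ge0.
  by have := ler_norm (- p); rewrite normrN /c; lra.
have ca : a * q <= c.
  have : a * q <= `|a| * q by rewrite ler_wpM2r // ler_norm.
  by have := normr_ge0 p; rewrite /c; lra.
(* Both quadratic terms are at most [c * t ^+ 2] in the harmful direction, and [q = t * (1 + c)]
   exceeds [c * t]. *)
pose t := q / (1 + c).
have tp : 0 < t by rewrite divr_gt0 //; lra.
have te : t * (1 + c) = q by rewrite divfK // gt_eqF //; lra.
have := key t.
have : t ^+ 2 * (a * q) <= t ^+ 2 * c by rewrite ler_wpM2l ?sqr_ge0.
have : t ^+ 2 * (- c) <= t ^+ 2 * p by rewrite ler_wpM2l ?sqr_ge0.
have : 0 < t * t by rewrite mulr_gt0.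
rewrite -te; move: tp; nra.
Qed.

End SymmetricSpectrum.

Lemma orthonormal_eigenbasis (R : realType) n (A : 'M[R]_n) : A^T = A ->
  exists (P : 'M[R]_n) (r : 'rV[R]_n), P *m P^T = 1%:M /\ P *m A = diag_mx r *m P.
Proof.
move=> sA.
suff h : forall k, (k <= n)%N -> exists (U : 'M[R]_(k, n)) (r : 'rV[R]_k),
    U *m U^T = 1%:M /\ U *m A = diag_mx r *m U by exact: (h n (leqnn n)).
elim=> [|k IH] kn.
  by exists 0, 0; split; apply/matrixP => -[].
have [U [r [U1 UA]]] := IH (ltnW kn).
have [u [a [u1 uU uA]]] := @next_eigenvector R n k A U r sA kn UA.
have V1 : col_mx u U *m (col_mx u U)^T = 1%:M.
  rewrite tr_col_mx mul_col_row uU U1 (scalar_mx_block 1 k); congr block_mx.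
    by apply/matrixP => i j; rewrite !ord1 [RHS]mxE /= -u1.
  by apply: trmx_inj; rewrite trmx_mul trmxK uU !trmx0.
have VA : col_mx u U *m A = diag_mx (row_mx (const_mx a : 'rV[R]_1) r) *m col_mx u U.
  rewrite diag_mx_row mul_block_col !mul0mx addr0 add0r mul_col_mx UA uA.
  by rewrite diag_const_mx mul_scalar_mx.
by exists (col_mx u U), (row_mx (const_mx a : 'rV[R]_1) r : 'rV[R]_(1 + k)).
Qed.

Lemma char_poly_eigenbasis (R : realType) n (A P : 'M[R]_n) (r : 'rV[R]_n) :
  P *m P^T = 1%:M -> P *m A = diag_mx r *m P ->
  char_poly A = \prod_(x <- map (r 0) (enum 'I_n)) ('X - x%:P).
Proof.
move=> PP PA; have PP' : P^T *m P = 1%:M by exact: mulmx1C.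
transitivity (char_poly (diag_mx r)); last first.
  rewrite char_poly_trig ?diag_mx_is_trig // big_map big_enum /=.
  by apply: eq_bigr => i _; rewrite mxE eqxx mulr1n.
rewrite /char_poly.
have -> : char_poly_mx A = map_mx polyC P^T *m char_poly_mx (diag_mx r) *m map_mx polyC P.
  rewrite /char_poly_mx mulmxBr mulmxBl mul_mx_scalar -scalemxAl -!map_mxM PP'.
  by rewrite map_mx1 scalemx1 -mulmxA -PA mulmxA PP' mul1mx.
rewrite !det_mulmx mulrC mulrA -det_mulmx -map_mxM PP map_mx1 det1 mul1r //.
Qed.

Lemma count_flatten_nseq (T : eqType) (g : T -> nat) (s : seq T) x : uniq s ->
  count_mem x (flatten [seq nseq (g y) y | y <- s]) = ((x \in s) * g x)%N.
Proof.
elim: s => [|y s IH] //= /andP[ys us].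
rewrite count_cat IH // count_nseq inE /= eq_sym.
by have [->|] := eqVneq x y; rewrite ?(negbTE ys) ?mul1n ?mul0n ?addn0.
Qed.

Lemma sorted_flatten_nseq (R : realDomainType) (g : R -> nat) (s : seq R) :
  sorted <%R s -> sorted <=%R (flatten [seq nseq (g y) y | y <- s]).
Proof.
rewrite (sorted_pairwise lt_trans) (sorted_pairwise le_trans).
elim: s => [|y s IH] //= /andP[/allP ys us].
rewrite pairwise_cat IH // andbT; apply/andP; split.
  apply/allrelP => a b /nseqP[-> _] /flattenP[t /mapP[w ws ->] /nseqP[-> _]].
  by apply: ltW; exact: ys.
elim: (g y) => //= k ->; rewrite andbT.
by apply/allP => w /nseqP[-> _].
Qed.

(** Both lists are sorted, so comparing multiplicities is enough; these are read off the factored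
    characteristic polynomial. *)
Lemma eigenvalues_eigenbasis (R : realType) n (A P : 'M[R]_n) (r : 'rV[R]_n) :
  P *m P^T = 1%:M -> P *m A = diag_mx r *m P ->
  eigenvalues A = sort <=%R (map (r 0) (enum 'I_n)).
Proof.
move=> PP PA; have cE := @char_poly_eigenbasis R n A P r PP PA.
have c0 : char_poly A != 0 by apply: monic_neq0; exact: char_poly_monic.
apply: (sorted_eq le_trans le_anti).
- by apply: sorted_flatten_nseq; exact: sorted_roots.
- by apply: sort_sorted; exact: le_total.
rewrite (perm_sym) perm_sort perm_sym.
apply/allP => x _ /=; apply/eqP.
rewrite count_flatten_nseq; last by apply: sorted_uniq (sorted_roots _ _ _); [exact: lt_trans | exact: ltxx].
have := roots_on_rootsR c0 x; rewrite inE /= => <-.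
rewrite cE mu_prod_XsubC root_prod_XsubC.
by case: (boolP (x \in _)) => [|/count_memPn ->]; rewrite ?mul1n ?mul0n.
Qed.

(** * Laplacian, variational upper bound and Fiedler vector *)

Section LaplacianSpectrum.
Variables (R : realType) (n : nat) (G : sgraph n).
Implicit Types (f : 'I_n -> R) (w : 'rV[R]_n).

Local Notation L := (laplacian R G).

Definition rowf f : 'rV[R]_n := \row_i f i.

(* Ordered pairs: every edge is counted twice. *)
Definition energy f : R := \sum_x \sum_y (G x y)%:R * (f x - f y) ^+ 2.

Lemma laplacian_sym : L^T = L.
Proof.
rewrite /laplacian linearB /= tr_diag_mx; congr (_ - _).
by apply/matrixP => i j; rewrite !mxE adj_sym.
Qed.

Lemma mul_laplacian w i : (w *m L) 0 i = \sum_j (G i j)%:R * (w 0 i - w 0 j).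
Proof.
rewrite /laplacian /degree_mx mulmxBr mul_mx_diag !mxE /deg -sum1_card natr_sum mulr_sumr.
rewrite big_mkcond -sumrB; apply: eq_bigr => j _.
rewrite /adjacency_mx !mxE inE adj_sym.
by case: (G j i); rewrite ?mulr1 ?mul1r // mulr0 mul0r subrr.
Qed.

Lemma energy_laplacian w : energy (w 0) = 2 * dotr R n (w *m L) w.
Proof.
rewrite dotrE /energy.
have E : \sum_i (w *m L) 0 i * w 0 i =
    \sum_i \sum_j (G i j)%:R * (w 0 i - w 0 j) * w 0 i.
  by apply: eq_bigr => i _; rewrite mul_laplacian mulr_suml.
have E' : \sum_i (w *m L) 0 i * w 0 i =
    \sum_i \sum_j (G i j)%:R * (w 0 j - w 0 i) * w 0 j.
  rewrite E exchange_big; apply: eq_bigr => i _; apply: eq_bigr => j _.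
  by rewrite adj_sym.
rewrite (_ : 2 = 1 + 1) // mulrDl mul1r {1}E E' -big_split; apply: eq_bigr => i _ /=.
by rewrite -big_split; apply: eq_bigr => j _ /=; lra.
Qed.

Lemma energy_ge0 f : 0 <= energy f.
Proof. by apply: sumr_ge0 => i _; apply: sumr_ge0 => j _; rewrite mulr_ge0 ?sqr_ge0. Qed.

Lemma energy0 f : connected_graph G -> energy f = 0 -> forall x y, f x = f y.
Proof.
move=> conn /eqP; rewrite psumr_eq0 => [/allP E x y|i _]; last first.
  by apply: sumr_ge0 => j _; rewrite mulr_ge0 ?sqr_ge0.
have cl : fingraph.closed (adj G) [pred w | f w == f x].
  move=> a b ab; rewrite !inE.
  have /implyP/(_ isT) := E a (mem_index_enum a).
  rewrite psumr_eq0 => [/allP/(_ b (mem_index_enum b))|j _]; last by rewrite mulr_ge0 ?sqr_ge0.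
  by rewrite ab mul1r sqrf_eq0 subr_eq0 => /eqP ->.
have := fingraph.closed_connect cl (conn x y).
by rewrite !inE eqxx => /esym/eqP.
Qed.

Section Basis.
Variables (P : 'M[R]_n) (r : 'rV[R]_n).
Hypotheses (PP : P *m P^T = 1%:M) (PL : P *m L = diag_mx r *m P).

Lemma coordK w : w *m P^T *m P = w.
Proof. by rewrite -mulmxA (mulmx1C PP) mulmx1. Qed.

Lemma dotr_coord w : dotr R n w w = \sum_i (w *m P^T) 0 i ^+ 2.
Proof.
rewrite -{1}[w]coordK /dotr -mulmxA -[P *m w^T]trmxK trmx_mul trmxK.
by rewrite -/(dotr R n _ _) dotrE; apply: eq_bigr => i _; rewrite -expr2.
Qed.

Lemma dotr_laplacian_coord w :
  dotr R n (w *m L) w = \sum_i r 0 i * (w *m P^T) 0 i ^+ 2.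
Proof.
have -> : w *m L = w *m P^T *m diag_mx r *m P by rewrite -mulmxA -PL mulmxA coordK.
rewrite /dotr -mulmxA -[P *m w^T]trmxK trmx_mul trmxK.
rewrite -/(dotr R n _ _) dotrE; apply: eq_bigr => i _.
by rewrite mul_mx_diag mxE; lra.
Qed.

End Basis.

Lemma alg_connectivity_basis : exists (P : 'M[R]_n) (r : 'rV[R]_n),
  [/\ P *m P^T = 1%:M, P *m L = diag_mx r *m P &
      alg_connectivity R G = (sort <=%R (map (r 0) (enum 'I_n)))`_1].
Proof.
have [P [r [PP PL]]] := @orthonormal_eigenbasis R n L laplacian_sym.
by exists P, r; split=> //; rewrite /alg_connectivity (eigenvalues_eigenbasis R n L P r).
Qed.

End LaplacianSpectrum.

(** Attainment yields the Fiedler vector, the two indices not above [mu] yield its positivity, and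
    the single exceptional index yields the variational bound. *)
Lemma second_smallest (R : realDomainType) n (r : 'I_n -> R) (n2 : (2 <= n)%N) :
  let mu := (sort <=%R (map r (enum 'I_n)))`_1 in
  [/\ exists j, r j = mu, exists i j, [/\ i != j, r i <= mu & r j <= mu] &
      exists i0, forall i, i != i0 -> mu <= r i].
Proof.
set s := sort _ _ => mu.
have ss : sorted <=%R s by apply: sort_sorted; exact: le_total.
have ps : perm_eq s (map r (enum 'I_n)) by rewrite perm_sort.
have szs : size s = n by rewrite (perm_size ps) size_map size_enum_ord.
have cnt (a : pred R) : count a s = #|[pred i | a (r i)]|.
  by rewrite (permP ps) count_map -sum1_count big_enum_cond -sum1_card; apply: eq_bigl.
have [s0 [s1 [s' sE]]] : exists s0 s1 s', s = [:: s0, s1 & s'].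
  by case: (s) szs n2 => [|s0 [|s1 s']] /= <- //; exists s0, s1, s'.
have muE : mu = s1 by rewrite /mu sE.
have /= /andP[s01 ss'] : path <=%R s0 (s1 :: s') by move: ss; rewrite sE.
have s1s : {in s', forall x, s1 <= x} by apply/allP; exact: order_path_min le_trans ss'.
split.
- have : mu \in map r (enum 'I_n).
    by rewrite -(perm_mem ps) muE sE !inE eqxx orbT.
  by case/mapP => j _ ->; exists j.
- have : (1 < #|[pred i | (r i <= mu)%R]|)%N.
    by rewrite -(cnt (fun x => x <= mu)) sE /= muE s01 lexx.
  by case/card_gt1P => i [j [] /[!inE] ri rj ij]; exists i, j.
have : (#|[pred i | (r i < mu)%R]| <= 1)%N.
  rewrite -(cnt (fun x => x < mu)) sE /= muE ltxx add0n.
  rewrite (_ : count _ s' = 0%N) ?addn0 ?leq_b1 //.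
  by apply/eqP; rewrite -leqn0 leqNgt -has_count; apply/hasPn => x /s1s; rewrite -leNgt.
move=> /card_le1P h.
have [/existsP[i0 i0mu]|] := boolP [exists i, r i < mu].
  exists i0 => i ii0; rewrite leNgt; apply/negP => imu.
  by have := h i0 i0mu i; rewrite !inE imu => /esym; rewrite (negbTE ii0).
rewrite negb_exists => /forallP hn; exists (Ordinal (ltnW n2)) => i _.
by rewrite leNgt; exact: hn.
Qed.

(** Courant-Fischer: the span of [f] and the constants contains a vector orthogonal to the one
    exceptional eigenvector, and constants add norm but no energy. The factor 2 reflects that
    [energy] counts every edge twice. *)
Lemma alg_connectivity_le (R : realType) n (G : sgraph n) (f : 'I_n -> R) rho :
  (2 <= n)%N -> \sum_x f x = 0 -> 0 < \sum_x f x ^+ 2 ->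
  energy R n G f <= 2 * rho * \sum_x f x ^+ 2 -> alg_connectivity R G <= rho.
Proof.
move=> n2 f0 fp fE.
have [P [r [PP PL ->]]] := alg_connectivity_basis R n G.
have [_ _ [i0 hi0]] := second_smallest R n (r 0) n2.
set mu := _`_1 in hi0 *; clearbody mu; rewrite leNgt; apply/negP => rmu.
have low w : (w *m P^T) 0 i0 = 0 -> mu * dotr R n w w <= dotr R n (w *m laplacian R G) w.
  move=> w0; rewrite (dotr_laplacian_coord R n G P r) // (dotr_coord R n P) // mulr_sumr.
  apply: ler_sum => i _; have [->|ii0] := eqVneq i i0; first by rewrite w0 expr0n !mulr0.
  by rewrite ler_wpM2r ?sqr_ge0 ?hi0.
pose u : 'rV[R]_n := const_mx 1; pose w := rowf R n f.
have uL : u *m laplacian R G = 0.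
  apply/rowP => i; rewrite mul_laplacian big1 ?mxE // => j _.
  by rewrite !mxE subrr mulr0.
have ww : dotr R n w w = \sum_x f x ^+ 2.
  by rewrite dotrE; apply: eq_bigr => x _; rewrite !mxE expr2.
have wu : dotr R n w u = 0.
  by rewrite dotrE -[RHS]f0; apply: eq_bigr => x _; rewrite !mxE mulr1.
have uu : dotr R n u u = n%:R.
  by rewrite dotrE (eq_bigr (fun=> 1)) ?sumr_const ?card_ord // => x _; rewrite !mxE mulr1.
have wE : dotr R n (w *m laplacian R G) w <= rho * dotr R n w w.
  have := energy_laplacian R n G w.
  rewrite (_ : energy _ _ _ (w 0) = energy R n G f); last first.
    by rewrite /energy; apply: eq_bigr => x _; apply: eq_bigr => y _; rewrite !mxE.
  by rewrite ww; lra.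
pose c := (u *m P^T) 0 i0; pose c' := (w *m P^T) 0 i0.
pose v := c *: w - c' *: u.
have v0 : (v *m P^T) 0 i0 = 0.
  rewrite mulmxBl -!scalemxAl /c /c'; move: (w *m _) (u *m _) => a b.
  by rewrite !mxE; lra.
have vv : dotr R n v v = c ^+ 2 * dotr R n w w + c' ^+ 2 * n%:R.
  rewrite /v -scaleNr !(dotrDl, dotrDr, dotrZl, dotrZr) wu dotrC wu uu; lra.
have vL : dotr R n (v *m laplacian R G) v = c ^+ 2 * dotr R n (w *m laplacian R G) w.
  rewrite mulmxBl -!scalemxAl uL scaler0 subr0 dotrZl /v -scaleNr dotrDr !dotrZr.
  rewrite (dotr_sym R n _ w u (laplacian_sym R n G)) uL.
  have -> : dotr R n w 0 = 0 by rewrite /dotr trmx0 mulmx0 mxE.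
  by lra.
have r0 : 0 <= rho.
  rewrite leNgt; apply/negP => rn; have := energy_ge0 R n G f.
  by rewrite leNgt (le_lt_trans fE) // pmulr_llt0 //; lra.
have vle := low v v0; rewrite vL vv in vle.
(* The combination [v] may be zero. A nonzero [c], then a nonzero [c'], contradicts [vle]; with
   [c' = 0] the vector [w] itself is orthogonal to the exceptional one. *)
have c0 : c = 0.
  apply/eqP; rewrite -sqrf_eq0; apply/negPn/negP => cn.
  have cp : 0 < c ^+ 2 by rewrite lt_neqAle eq_sym cn sqr_ge0.
  have cw : 0 < c ^+ 2 * dotr R n w w by rewrite mulr_gt0 // ww.
  have h1 := ler_wpM2l (ltW cp) wE.
  have h2 : 0 <= mu * (c' ^+ 2 * n%:R).
    by apply: mulr_ge0; [lra | rewrite mulr_ge0 ?sqr_ge0].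
  have h3 : rho * (c ^+ 2 * dotr R n w w) < mu * (c ^+ 2 * dotr R n w w) by rewrite ltr_pM2r.
  lra.
have c'0 : c' = 0.
  apply/eqP; rewrite -sqrf_eq0; apply/negPn/negP => cn.
  have cp : 0 < c' ^+ 2 by rewrite lt_neqAle eq_sym cn sqr_ge0.
  have : 0 < mu * (c' ^+ 2 * n%:R).
    by apply: mulr_gt0; [lra | rewrite mulr_gt0 // ltr0n ltnW].
  by move: vle; rewrite c0; lra.
have := le_trans (low w c'0) wE; rewrite leNgt ltr_pM2r ?rmu //.
by rewrite ww.
Qed.

(** Were [mu] not positive, two orthonormal eigenvectors would have zero energy and, by
    connectedness, both be constant. *)
Lemma fiedler_vector (R : realType) n (G : sgraph n) :
  (2 <= n)%N -> connected_graph G -> exists f : 'I_n -> R,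
  [/\ 0 < alg_connectivity R G, \sum_x f x = 0, 0 < \sum_x f x ^+ 2 &
   forall x, \sum_y (G x y)%:R * (f x - f y) = alg_connectivity R G * f x].
Proof.
move=> n2 conn.
have [P [r [PP PL ->]]] := alg_connectivity_basis R n G.
have [[j rj] [i1 [i2 [i12 r1 r2]]] _] := second_smallest R n (r 0) n2.
set mu := _`_1 in rj r1 r2 *; clearbody mu.
have PPij i k : dotr R n (row i P) (row k P) = (i == k)%:R.
  have := congr1 (fun M : 'M[R]_n => M i k) PP; rewrite !mxE => <-.
  by rewrite dotrE; apply: eq_bigr => l _; rewrite !mxE.
have rowL i : row i P *m laplacian R G = r 0 i *: row i P.
  by rewrite -row_mul PL mul_diag_mx; apply/rowP => k; rewrite !mxE.
have rowE i : energy R n G (row i P 0) = 2 * r 0 i.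
  by rewrite energy_laplacian rowL dotrZl PPij eqxx mulr1.
have r_ge0 i : 0 <= r 0 i by have := energy_ge0 R n G (row i P 0); rewrite rowE; lra.
have mu_gt0 : 0 < mu.
  rewrite ltNge; apply/negP => mu0.
  have row0 i : r 0 i <= mu -> exists a, row i P = a *: const_mx 1.
    move=> ri; have ri0 : r 0 i = 0 by apply/eqP; rewrite eq_le r_ge0 (le_trans ri).
    exists (row i P 0 (Ordinal (ltnW n2))); apply/rowP => k; rewrite [RHS]mxE [X in _ * X]mxE mulr1.
    by apply: (energy0 R n G) => //; rewrite rowE ri0 mulr0.
  have [a aE] := row0 _ r1; have [b bE] := row0 _ r2.
  have h11 := PPij i1 i1; have h22 := PPij i2 i2; have h12 := PPij i1 i2.
  move: h11 h22 h12; rewrite (negbTE i12) !eqxx aE bE !(dotrZl, dotrZr).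
  set D := dotr _ _ _ _ => h11 h22 h12.
  have : (a * (a * D)) * (b * (b * D)) = (a * (b * D)) ^+ 2 by rewrite expr2; lra.
  by rewrite h11 h22 h12 expr0n mulr1 => /eqP; rewrite oner_eq0.
exists (row j P 0); split=> //.
- have : dotr R n (row j P *m laplacian R G) (const_mx 1) = 0.
    rewrite dotr_sym ?laplacian_sym // (_ : _ *m _ = 0) ?/dotr ?trmx0 ?mulmx0 ?mxE //.
    by apply/rowP => i; rewrite mul_laplacian big1 ?mxE // => k _; rewrite !mxE subrr mulr0.
  rewrite rowL dotrZl rj => /eqP; rewrite mulf_eq0 gt_eqF //= => /eqP h; rewrite -[RHS]h.
  by rewrite dotrE; apply: eq_bigr => x _; rewrite [X in _ = _ * X]mxE mulr1.
- rewrite (_ : \sum_x _ = 1) //.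
  have := PPij j j; rewrite eqxx dotrE => E; rewrite -[RHS]E.
  by apply: eq_bigr => x _; rewrite expr2.
- by move=> x; rewrite -mul_laplacian rowL mxE rj.
Qed.

(** * Quantitative bounds for 2 - 2 cos *)

Section CosineBounds.
Variable R : realType.

Lemma sin_le (y : R) : 0 <= y -> sin y <= y.
Proof.
rewrite le_eqVlt => /predU1P[<-|y0]; first by rewrite sin0.
have [|c _] := @MVT R sin cos 0 y y0.
  by apply: continuous_subspaceT => x; exact: continuous_sin.
rewrite sin0 !subr0 => ->.
by rewrite -[X in _ <= X]mul1r ler_wpM2r ?(ltW y0) // cos_le1.
Qed.

Lemma one_sub_cos (y : R) : 2 - 2 * cos y = 4 * sin (y / 2) ^+ 2.
Proof.
have := cos_mulr2n (y / 2); rewrite -[_ *+ 2]mulr_natr divfK // => ->.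
by rewrite cos2sin2; lra.
Qed.

Lemma one_sub_cos_le (y : R) : 0 <= y -> 2 - 2 * cos y <= y ^+ 2.
Proof.
move=> y0; rewrite one_sub_cos.
have [h|h] := lerP 0 (sin (y / 2)).
  have s : sin (y / 2) <= y / 2 by rewrite sin_le // divr_ge0.
  by nra.
have s : sin (- (y / 2)) = - sin (y / 2) by rewrite sinN.
have [y2|y2] := leP y 2; last first.
  have := sin_max (y / 2); rewrite ler_norml => /andP[]; nra.
have : 0 <= sin (y / 2).
  rewrite le_eqVlt in y0; case/predU1P: y0 => [<-|y0]; first by rewrite mul0r sin0.
  by apply/ltW/sin2_gt0; apply/andP; split; lra.
by rewrite leNgt h.
Qed.

Lemma sin_ge (y : R) : 0 <= y -> y * (1 - y ^+ 2 / 2) <= sin y.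
Proof.
rewrite le_eqVlt => /predU1P[<-|y0]; first by rewrite sin0 mul0r.
have [|c /andP[]] := @MVT R sin cos 0 y y0.
  by apply: continuous_subspaceT => x; exact: continuous_sin.
rewrite !bnd_simp => c0 cy; rewrite sin0 !subr0 => ->; rewrite mulrC.
rewrite ler_wpM2r ?(ltW y0) //.
have := one_sub_cos_le c (ltW c0).
have : c ^+ 2 <= y ^+ 2 by rewrite ler_sqr ?nnegrE ?ltW // (lt_trans c0).
lra.
Qed.

Lemma one_sub_cos_ge (y : R) : 0 <= y -> y <= 2 -> y ^+ 2 * (1 - y ^+ 2) <= 2 - 2 * cos y.
Proof.
move=> y0 y2; rewrite one_sub_cos.
have h : 0 <= y / 2 by rewrite divr_ge0.
have := sin_ge (y / 2) h; set s := sin _ => sE.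
have l0 : 0 <= y / 2 * (1 - (y / 2) ^+ 2 / 2) by rewrite mulr_ge0 //; nra.
have : (y / 2 * (1 - (y / 2) ^+ 2 / 2)) ^+ 2 <= s ^+ 2 by rewrite ler_sqr ?nnegrE // (le_trans l0).
have y4 : 0 <= y ^+ 2 * y ^+ 2 by rewrite -expr2 sqr_ge0.
have y6 : 0 <= y ^+ 2 * y ^+ 2 * y ^+ 2 by rewrite mulr_ge0 // sqr_ge0.
move: y4 y6; rewrite !expr2; lra.
Qed.

End CosineBounds.

(** * Asymptotic form of the lower bounds *)

Lemma pi_div_small (R : realType) (t : R) : 0 < t ->
  exists n0, forall n, (n0 <= n)%N -> (0 < n)%N /\ pi / n%:R <= t.
Proof.
move=> t0; pose k := Num.bound (pi / t : R).
exists k.+1 => n kn; have n0 : (0 < n)%N by exact: leq_trans kn.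
split=> //; rewrite ler_pdivrMr ?ltr0n // mulrC -ler_pdivrMr //.
apply: ltW; apply: lt_le_trans (archi_boundP _) _; first by rewrite divr_ge0 ?pi_ge0 ?ltW.
by rewrite ler_nat; exact: ltnW.
Qed.

(** The order of choices matters: [t], which also serves as [eps], and [K] with [C <= t * K] depend
    on [eta] only; then [n] is taken so large that the term with [K ^ 2 * lam] is at most [t]. The
    losses combine by [(1 - 4 * t) * (1 + t) * (1 + 2 * t) <= 1 - t], hence [eta = 4 * t * N]. *)
Lemma block_bound_asymp (R : realType) (N C eta : R) : 0 < N -> 0 <= C -> 0 < eta ->
  exists n0, forall n, (n0 <= n)%N -> forall mu : R, 0 <= mu ->
   (forall (K : nat) (eps : R), (0 < K)%N -> 0 < eps ->
     let lam := 2 - 2 * cos (pi / n%:R) in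
     N * K%:R * lam <= mu * (K%:R + C) * (1 + eps + (1 + eps^-1) * (K%:R ^+ 2 * lam))) ->
  (N - eta) * (pi ^+ 2 / n%:R ^+ 2) <= mu.
Proof.
move=> N0 C0 eta0; have [t [t0 tN]] : exists t, 0 < t /\ 4 * t * N = eta.
  exists (eta / (4 * N)); split; first by rewrite divr_gt0 // mulr_gt0.
  have -> : 4 * (eta / (4 * N)) * N = eta / (4 * N) * (4 * N) by lra.
  by rewrite divfK // gt_eqF // mulr_gt0.
pose K := (Num.bound (C / t)).+1.
have KC : C <= t * K%:R.
  rewrite mulrC -ler_pdivrMr //; apply: ltW; apply: lt_le_trans (archi_boundP _) _.
    by rewrite divr_ge0 // ltW.
  by rewrite ler_nat /K leqnSn.
have K0 : 0 < K%:R :> R by rewrite ltr0n.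
pose M := (1 + t^-1) * K%:R ^+ 2.
have M0 : 0 < M by rewrite mulr_gt0 ?exprn_gt0 // addr_gt0 ?invr_gt0.
pose q := Num.min (Num.min 1 t) (t / M).
have q0 : 0 < q by rewrite !lt_min ltr01 t0 divr_gt0.
have q1 : q <= 1 by rewrite !ge_min lexx.
have qt : q <= t by rewrite !ge_min lexx orbT.
have qM : M * q <= t by rewrite mulrC -ler_pdivlMr // !ge_min lexx orbT.
clearbody q; have [n0 hn0] := pi_div_small R q q0.
exists n0 => n /hn0[n_gt0 yq] mu mu0 /(_ K t isT t0) /=.
rewrite -expr_div_n.
have y0 : 0 <= pi / n%:R :> R by rewrite divr_ge0 ?pi_ge0.
set y : R := pi / n%:R in yq y0 *; clearbody y.
have := one_sub_cos_le R y y0.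
have := one_sub_cos_ge R y y0; move=> /(_ ltac:(lra)).
move: (2 - 2 * cos y) => lam lamge lamle.
have y1 : y <= 1 by exact: le_trans q1.
have yy : y ^+ 2 <= q by apply: le_trans yq; rewrite expr2 -[X in _ <= X]mulr1 ler_wpM2l.
have lam0 : 0 <= lam by apply: le_trans lamge; rewrite mulr_ge0 ?sqr_ge0 //; lra.
have ML : (1 + t^-1) * (K%:R ^+ 2 * lam) <= t.
  rewrite mulrA -/M; apply: le_trans qM; rewrite (ler_wpM2l (ltW M0)) //; lra.
move=> H.
have h1 : mu * (K%:R + C) * (1 + t + (1 + t^-1) * (K%:R ^+ 2 * lam)) <=
    mu * ((1 + t) * K%:R) * (1 + t + t).
  have e0 : 0 <= (1 + t^-1) * (K%:R ^+ 2 * lam).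
    apply: mulr_ge0; last by rewrite mulr_ge0 ?sqr_ge0.
    by rewrite addr_ge0 // invr_ge0 ltW.
  apply: ler_pM.
  - by apply: mulr_ge0 => //; apply: addr_ge0 => //; exact: ltW.
  - lra.
  - by rewrite ler_wpM2l //; lra.
  - lra.
have h2 : N * lam <= mu * ((1 + t) * (1 + t + t)).
  rewrite -(ler_pM2r K0); apply: le_trans (le_trans _ (le_trans H h1)) _; lra.
have h3 : N * (y ^+ 2 * (1 - t)) <= N * lam.
  rewrite (ler_wpM2l (ltW N0)) //; apply: le_trans lamge.
  by rewrite ler_wpM2l ?sqr_ge0 //; lra.
have p : 0 < (1 + t) * (1 + t + t) by rewrite mulr_gt0 //; lra.
rewrite -(ler_pM2r p); apply: le_trans (le_trans h3 h2).
have -> : (N - eta) = N * (1 - 4 * t) by rewrite -tN; lra.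
have -> : N * (1 - 4 * t) * y ^+ 2 * ((1 + t) * (1 + t + t)) =
  N * (y ^+ 2 * ((1 - 4 * t) * ((1 + t) * (1 + t + t)))) by lra.
rewrite (ler_wpM2l (ltW N0)) // ler_wpM2l ?sqr_ge0 //.
have t2 : 0 < t * t by rewrite mulr_gt0.
have t3 : 0 < t * t * t by rewrite mulr_gt0.
lra.
Qed.

Lemma sine_wirtinger (R : realType) n (S : nat -> R) : S 0%N = 0 -> S n = 0 ->
  (2 - 2 * cos (pi / n%:R)) * \sum_(0 <= k < n) S k ^+ 2 <=
    \sum_(0 <= k < n) (S k - S k.+1) ^+ 2.
Proof.
move=> S0 Sn; have [->|n0] := posnP n; first by rewrite !big_geq // mulr0.
have nr : 0 < n%:R :> R by rewrite ltr0n.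
apply: (wirtinger R n _ (fun k => sin (k%:R * (pi / n%:R)))) => //.
- move=> k /andP[k0 kn]; apply: sin_gt0_pi; apply/andP; split.
    by rewrite mulr_gt0 ?ltr0n ?divr_gt0 ?pi_gt0.
  by rewrite mulrA ltr_pdivrMr // mulrC ltr_pM2l ?pi_gt0 // ltr_nat.
- by rewrite mul0r sin0.
- by rewrite mulrC divfK ?gt_eqF // sinpi.
move=> [|k] // _ /=; set t := pi / _.
have -> : k.+2%:R * t = k.+1%:R * t + t by rewrite -natr1; lra.
have -> : k%:R * t = k.+1%:R * t - t by rewrite -[k.+1%:R]natr1; lra.
by rewrite sinB sinD; lra.
Qed.

Lemma alg_connectivity_lower (R : realType) (N C eta : R) :
  0 < N -> 0 <= C -> 0 < eta ->
  exists n0, forall m, (n0 <= m)%N -> forall G : sgraph m.+1, connected_graph G ->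
   (forall f a b F, (a <= b)%N -> (b < m.+1)%N -> 0 <= F ->
      (forall k, (a < k <= b)%N -> flux R m.+1 (redge R m G f) (rval R m f) k <= F) ->
      N * (rval R m f b - rval R m f a) <= F * ((b - a)%:R + C)) ->
  (N - eta) * (pi ^+ 2 / m.+1%:R ^+ 2) <= alg_connectivity R G.
Proof.
move=> N0 C0 eta0; have [n0 hn0] := block_bound_asymp R N C eta N0 C0 eta0.
exists n0.+1 => m mn G conn dens.
have m2 : (2 <= m.+1)%N by rewrite ltnS (leq_trans _ mn).
have [f [mu0 f0 fp eig]] := fiedler_vector R m.+1 G m2 conn.
apply: (hn0 m.+1); [by rewrite leqW // ltnW | exact: ltW |].
move=> K eps K0 eps0 /=.
have z0 : \sum_(0 <= i < m.+1) rval R m f i = 0.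
  rewrite -[RHS]f0 -(sum_vtx R m f _ f) !big_nat; apply: eq_bigr => i /andP[_ im].
  exact: rvalE.
apply: (spectral_block_bound R m.+1 (rval R m f) _ z0) => //.
- exact: rval_mono.
- exact: ltW.
- move=> a b F ab bm F0 fl; apply: dens => // k /andP[ak kb].
  rewrite (redge_flux R m G f _ eig); first by apply: fl; rewrite ak.
  by rewrite ltnW // (leq_ltn_trans kb).
- apply: sine_wirtinger; first exact: tail0.
  exact: tail_ge.
- suff -> : \sum_(0 <= i < m.+1) rval R m f i ^+ 2 = \sum_x f x ^+ 2 by [].
  rewrite -(sum_vtx R m f _ (fun x => f x ^+ 2)) !big_nat; apply: eq_bigr => i /andP[_ im].
  by rewrite rvalE.
Qed.

Lemma min_degree_lower (R : realType) d (eta : R) : (3 <= d)%N -> 0 < eta ->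
  exists n0, forall n, (n0 <= n)%N -> forall G : sgraph n, min_degree_class d G ->
  (d%:R - 1 - eta) * (pi ^+ 2 / n%:R ^+ 2) <= alg_connectivity R G.
Proof.
move=> d3 eta0.
have dE : d%:R - 1 = (d - 1)%:R :> R by rewrite natrB // (ltn_trans _ d3).
have N0 : 0 < (d - 1)%:R :> R by rewrite ltr0n subn_gt0 (ltn_trans _ d3).
have C0 : 0 <= 6 * (d - 1)%:R :> R by rewrite mulr_ge0.
have [n0 hn0] := alg_connectivity_lower R _ _ _ N0 C0 eta0.
exists n0.+1 => -[//|m] mn G [dn conn degd]; rewrite dE; apply: hn0 => // f a b F ab bm F0 fl.
apply: (density_one R m.+1 (redge R m G f)) => //.
- exact: redge_sym.
- exact: redge_irr.
- exact: rval_mono.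
- exact: redge_cut.
- by move=> i im; rewrite redge_deg.
Qed.

Lemma regular_even_lower (R : realType) d (eta : R) : (3 <= d)%N -> ~~ odd d -> 0 < eta ->
  exists n0, forall n, (n0 <= n)%N -> forall G : sgraph n, regular_class d G ->
  (2 * (d%:R - 2) - eta) * (pi ^+ 2 / n%:R ^+ 2) <= alg_connectivity R G.
Proof.
move=> d3 dev eta0.
have d4 : (4 <= d)%N by rewrite ltn_neqAle d3 andbT; apply: contraNneq dev => <-.
have dE : 2 * (d%:R - 2) = 2 * (d - 2)%:R :> R by rewrite natrB // (ltn_trans _ d3).
have N0 : 0 < 2 * (d - 2)%:R :> R by rewrite mulr_gt0 // ltr0n subn_gt0.
have C0 : 0 <= 10 * (2 * (d - 2)%:R) :> R by rewrite mulr_ge0 // ltW.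
have [n0 hn0] := alg_connectivity_lower R _ _ _ N0 C0 eta0.
exists n0.+1 => -[//|m] mn G [dn conn degd]; rewrite dE; apply: hn0 => // f a b F ab bm F0 fl.
have degE i : (i < m.+1)%N -> ecount (redge R m G f) i i.+1 0 m.+1 = d by rewrite redge_deg.
have sym := redge_sym R m G f; have irr := redge_irr R m G f.
apply: (density_two R m.+1 (redge R m G f) _ sym irr) => //.
- exact: rval_mono.
- exact: redge_cut.
- exact: cut_parity degE dev.
Qed.

(** * Graphs on an arbitrary finite type *)

Section Transport.
Variables (T : finType) (E : rel T).
Hypotheses (E_sym : symmetric E) (E_irr : irreflexive E).

Definition transport_graph : sgraph #|T| :=
  @SGraph #|T| (fun i j => E (enum_val i) (enum_val j))
    (fun i j => E_sym _ _) (fun i => E_irr _).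

Lemma sum_transport (V : nmodType) (F : T -> V) :
  \sum_(i < #|T|) F (enum_val i) = \sum_x F x.
Proof. by rewrite -(big_enum_val F). Qed.

Lemma deg_transport i : deg transport_graph i = (\sum_y E (enum_val i) y)%N.
Proof.
rewrite -(sum_transport _ (fun y => E (enum_val i) y : nat)) /deg -sum1_card.
by rewrite [LHS]big_mkcond; apply: eq_bigr => j _; rewrite inE /=; case: (E _ _).
Qed.

Lemma connected_transport (pos : T -> nat) :
  (forall x, (0 < pos x)%N -> exists2 y, (pos y < pos x)%N & E x y) ->
  (forall x y, pos x = 0%N -> pos y = 0%N -> x = y) -> connected_graph transport_graph.
Proof.
move=> down root0.
have csym : connect_sym transport_graph by apply: sym_connect_sym; exact: adj_sym.
have h k : forall i, (pos (enum_val i) <= k)%N ->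
    exists2 j, pos (enum_val j) = 0%N & connect transport_graph i j.
  elim: k => [|k IH] i hi; first by exists i; [lia | exact: connect0].
  have [p0|p0] := posnP (pos (enum_val i)); first by exists i; [ | exact: connect0].
  have [y yx xy] := down _ p0.
  have [|j j0 cj] := IH (enum_rank y); first by rewrite enum_rankK; lia.
  exists j => //; apply: connect_trans cj; apply: connect1.
  by rewrite /= enum_rankK.
move=> x y.
have [x' x0 cx] := h _ x (leqnn _); have [y' y0 cy] := h _ y (leqnn _).
apply: connect_trans cx _; rewrite csym (_ : x' = y') //.
by apply: enum_val_inj; exact: root0.
Qed.

Lemma energy_transport (R : realType) (f : T -> R) :
  energy R #|T| transport_graph (fun i => f (enum_val i)) =
  \sum_x \sum_y (E x y)%:R * (f x - f y) ^+ 2.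
Proof.
rewrite /energy -(sum_transport _ (fun x => \sum_y (E x y)%:R * (f x - f y) ^+ 2)).
apply: eq_bigr => i _.
by rewrite -(sum_transport _ (fun y => (E (enum_val i) y)%:R * (f (enum_val i) - f y) ^+ 2)).
Qed.

End Transport.

Section ChainSums.
Variable R : realFieldType.

Lemma sum_pick N a (g : nat -> R) :
  \sum_(0 <= j < N) (j == a)%:R * g j = (a < N)%:R * g a.
Proof.
elim: N => [|N IH]; first by rewrite big_geq // ltn0 mul0r.
rewrite big_nat_recr //= IH.
have [->|Na] := eqVneq N a; first by rewrite ltnn ltnSn mul0r add0r.
rewrite mul0r addr0 (_ : (a < N.+1)%N = (a < N)%N) //.
by move: Na; clear; lia.
Qed.

End ChainSums.

(** * The chain of modified complete graphs: degrees and energy *)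

Section Chain.
Variables (d c P r1 r2 : nat) (H1 H2 : rel nat).
Local Notation D := d.+1.
Hypotheses (c_gt0 : (0 < c)%N) (c_lt : (c < d)%N) (P_gt0 : (0 < P)%N).
Hypotheses (r1c : (2 * c <= r1)%N) (r2c : (2 * c <= r2)%N).
Hypotheses (H1_sym : symmetric H1) (H1_irr : irreflexive H1).
Hypotheses (H2_sym : symmetric H2) (H2_irr : irreflexive H2).

Definition chainV := ('I_r1 + ('I_P * 'I_D) + 'I_r2)%type.

(** Ports are never consecutive: an edge between two ports can be deleted from an end block without
    breaking its path of consecutive vertices, which serves for connectivity. *)
Definition port (p : nat) := (p < 2 * c)%N && ~~ odd p.

Definition exit (s : nat) := (D - c <= s)%N.

Definition clique_edge (s t : nat) :=
  [&& s != t, ~~ ((s == 0) && exit t) & ~~ (exit s && (t == 0))]%N.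

Definition mid_edge (i s j t : nat) :=
  [|| (j == i) && clique_edge s t, (j == i.+1) && (exit s && (t == 0)) |
      (0 < i) && (j == i.-1) && ((s == 0) && exit t)]%N.

Definition out_edge (i s q : nat) := [&& i.+1 == P, exit s & q == 2 * (s - (D - c))]%N.

(* P copies of the complete graph on d + 1 vertices; in each copy the edges from
   vertex 0 to the last c vertices (the exits) are replaced by edges from the
   exits to vertex 0 of the next copy, or to the ports of the end blocks. *)
Definition chain_edge (x y : chainV) : bool :=
  match x, y with
  | inl (inl p), inl (inl q) => H1 p q
  | inl (inl p), inl (inr (i, s)) | inl (inr (i, s)), inl (inl p) =>
      [&& port p, i == 0 :> nat & s == 0 :> nat]%N
  | inl (inr (i, s)), inl (inr (j, t)) => mid_edge i s j t
  | inl (inr (i, s)), inr q | inr q, inl (inr (i, s)) => out_edge i s q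
  | inr p, inr q => H2 p q
  | inl (inl _), inr _ | inr _, inl (inl _) => false
  end.

Definition chain_fun (V : Type) (gl : nat -> V) (gm : nat -> nat -> V) (gr : nat -> V)
    (x : chainV) : V :=
  match x with
  | inl (inl p) => gl p
  | inl (inr (i, s)) => gm i s
  | inr q => gr q
  end.

Lemma chain_edge_sym : symmetric chain_edge.
Proof.
move=> [[p|[i s]]|p] [[q|[j t]]|q] //=.
by rewrite /mid_edge /clique_edge /exit; clear; lia.
Qed.

Lemma chain_edge_irr : irreflexive chain_edge.
Proof.
move=> [[p|[i s]]|p] //=.
by rewrite /mid_edge /clique_edge /exit; move: c_lt; clear; lia.
Qed.

Lemma card_chainV : #|{: chainV}| = (P * D + r1 + r2)%N.
Proof. by rewrite !card_sum card_prod !card_ord; lia. Qed.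

(** The ranking required by [connected_transport]. Inside a copy [s.+1] stays adjacent to [s],
    because a deleted edge joins 0 to an exit and 1 is no exit when [c < d]; vertex 0 of a copy is
    adjacent to the last exit of the previous one. *)
Lemma chain_edge_down (x : chainV) :
  (forall p, (p.+1 < r1)%N -> H1 p.+1 p) -> (forall q, (q.+1 < r2)%N -> H2 q.+1 q) ->
  let pos := chain_fun _ id (fun i s => r1 + i * D + s)%N (fun q => r1 + P * D + q)%N in
  (0 < pos x)%N -> exists2 y, (pos y < pos x)%N & chain_edge x y.
Proof.
move=> h1 h2 pos.
case: x => [[[[|p] hp]|[[i hi] [s hs]]]|[q hq]] //= _.
- by exists (inl (inl (Ordinal (ltnW hp)))) => //=; exact: h1.
- case: s hs => [|s] hs.
    case: i hi => [|i] hi.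
      have r10 : (0 < r1)%N by move: r1c c_gt0; clear; lia.
      exists (inl (inl (Ordinal r10))) => /=; first by move: r10; clear; lia.
      by rewrite /port; move: c_gt0; clear; lia.
    exists (inl (inr (Ordinal (ltnW hi), ord_max))) => /=; first by clear; lia.
    by rewrite /mid_edge /exit; move: c_gt0 c_lt; clear; lia.
  have [es|es] := boolP (exit s.+1 && (s == 0%N)).
    have s1 : (1 < D)%N by move: c_lt; clear; lia.
    by move: es c_lt; rewrite /exit; clear; lia.
  exists (inl (inr (Ordinal hi, Ordinal (ltnW hs)))) => /=; first by clear; lia.
  by move: es; rewrite /mid_edge /clique_edge /exit; clear; lia.
- case: q hq => [|q] hq.
    have hP : (P.-1 < P)%N by move: P_gt0; clear; lia.
    have hc : (D - c < D)%N by move: c_gt0; clear; lia.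
    exists (inl (inr (Ordinal hP, Ordinal hc))) => /=; first by move: P_gt0 c_gt0; clear; nia.
    by rewrite /out_edge /exit; move: P_gt0; clear; lia.
  by exists (inr (Ordinal (ltnW hq))) => /=; [clear; lia | exact: h2].
Qed.

Section Rows.
Variable R : realFieldType.
Implicit Types (gl gr : nat -> R) (gm : nat -> nat -> R).

Lemma sum_chainV gl gm gr :
  \sum_x chain_fun _ gl gm gr x =
  \sum_(0 <= p < r1) gl p + \sum_(0 <= i < P) \sum_(0 <= s < D) gm i s
   + \sum_(0 <= q < r2) gr q.
Proof.
rewrite !big_sumType /= !big_mkord; congr (_ + _ + _).
transitivity (\sum_(x : 'I_P * 'I_D) gm x.1 x.2); first by apply: eq_bigr => -[].
by rewrite -(pair_bigA _ (fun (i : 'I_P) (s : 'I_D) => gm i s)); apply: eq_bigr => i _; rewrite big_mkord.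
Qed.

Lemma sum_row (x : chainV) (el er : nat -> bool) (em : nat -> nat -> bool) gl gm gr :
  chain_edge x =1 chain_fun _ el em er ->
  \sum_y (chain_edge x y)%:R * chain_fun _ gl gm gr y =
  \sum_(0 <= p < r1) (el p)%:R * gl p +
  \sum_(0 <= i < P) \sum_(0 <= s < D) (em i s)%:R * gm i s +
  \sum_(0 <= q < r2) (er q)%:R * gr q.
Proof.
move=> xE.
rewrite -(sum_chainV (fun p => (el p)%:R * gl p) (fun i s => (em i s)%:R * gm i s)
  (fun q => (er q)%:R * gr q)).
by apply: eq_bigr => y _; rewrite xE; case: y => [[|[]]|].
Qed.

Lemma row_left (p : 'I_r1) gl gm gr :
  \sum_y (chain_edge (inl (inl p)) y)%:R * chain_fun _ gl gm gr y =
  \sum_(0 <= q < r1) (H1 p q)%:R * gl q + (port p)%:R * gm 0%N 0%N.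
Proof.
rewrite (sum_row _ (H1 p) (fun=> false) (fun i s => [&& port p, i == 0 & s == 0]%N));
  last by case=> [[|[]]|].
rewrite [X in _ + X]big1 ?addr0; last by move=> *; rewrite mul0r.
congr (_ + _).
transitivity (\sum_(0 <= i < P) (i == 0)%N%:R * ((port p)%:R * gm i 0%N)).
  apply: eq_bigr => i _.
  transitivity (\sum_(0 <= s < D) (s == 0)%N%:R * ((i == 0)%N%:R * ((port p)%:R * gm i s))).
    by apply: eq_bigr => s _; case: port; case: (i == 0)%N; case: (s == 0)%N; rewrite ?mul1r ?mul0r.
  by rewrite (sum_pick R D 0 (fun s => (i == 0)%N%:R * ((port p)%:R * gm i s))) mul1r.
by rewrite (sum_pick R P 0 (fun i => (port p)%:R * gm i 0%N)) P_gt0 mul1r.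
Qed.

Lemma row_right (q : 'I_r2) gl gm gr :
  \sum_y (chain_edge (inr q) y)%:R * chain_fun _ gl gm gr y =
  \sum_(0 <= s < D) (exit s && (q == 2 * (s - (D - c)) :> nat)%N)%:R * gm P.-1 s +
  \sum_(0 <= q' < r2) (H2 q q')%:R * gr q'.
Proof.
rewrite (sum_row _ (fun=> false) (H2 q) (fun i s => out_edge i s q));
  last by case=> [[|[]]|].
rewrite [X in X + _ + _]big1 ?add0r; last by move=> *; rewrite mul0r.
congr (_ + _).
transitivity (\sum_(0 <= i < P) (i == P.-1)%:R *
    \sum_(0 <= s < D) (exit s && (q == 2 * (s - (D - c)) :> nat)%N)%:R * gm i s).
  apply: eq_bigr => i _; rewrite mulr_sumr; apply: eq_bigr => s _.
  rewrite /out_edge (_ : (i.+1 == P) = (i == P.-1)); last by move: P_gt0; clear; lia.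
  by case: (i == P.-1); rewrite /= ?mul1r ?mul0r.
rewrite (sum_pick R P P.-1 (fun i => \sum_(0 <= s < D)
  (exit s && (q == 2 * (s - (D - c)) :> nat)%N)%:R * gm i s)).
by rewrite (_ : (P.-1 < P)%N) ?mul1r //; move: P_gt0; clear; lia.
Qed.

Lemma row_mid (i : 'I_P) (s : 'I_D) gl gm gr :
  \sum_y (chain_edge (inl (inr (i, s))) y)%:R * chain_fun _ gl gm gr y =
  ((i == 0 :> nat)%N && (s == 0 :> nat)%N)%:R * \sum_(0 <= p < r1) (port p)%:R * gl p +
  (\sum_(0 <= t < D) (clique_edge s t)%:R * gm i t +
   ((i.+1 < P)%N && exit s)%:R * gm i.+1 0%N +
   ((0 < i)%N && (s == 0 :> nat)%N)%:R * \sum_(0 <= t < D) (exit t)%:R * gm i.-1 t) +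
  ((i.+1 == P) && exit s)%:R * gr (2 * (s - (D - c)))%N.
Proof.
rewrite (sum_row _ (fun p => [&& port p, i == 0 :> nat & s == 0 :> nat]%N)
  (fun q => out_edge i s q) (mid_edge i s)); last by case=> [[|[]]|].
congr (_ + _ + _).
- rewrite mulr_sumr; apply: eq_bigr => p _.
  by case: port; case: (_ == _); case: (_ == _); rewrite /= ?mul1r ?mul0r.
- transitivity (\sum_(0 <= j < P)
    ((j == i)%:R * \sum_(0 <= t < D) (clique_edge s t)%:R * gm j t +
     ((j == i.+1)%:R * ((exit s)%:R * gm j 0%N) +
      (j == i.-1)%:R * (((0 < i)%N && (s == 0 :> nat)%N)%:R *
        \sum_(0 <= t < D) (exit t)%:R * gm j t)))).
    apply: eq_bigr => j _.
    rewrite -[gm j 0%N]mul1r -[1 * _](sum_pick R D 0 (fun t => gm j t)).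
    rewrite !mulr_sumr -!big_split /=; apply: eq_bigr => t _.
    rewrite !mulrA -!mulrDl; congr (_ * _); rewrite /mid_edge.
    have [->|ji] := eqVneq j i.
      rewrite (_ : (i == i.+1 :> nat) = false); last by clear; lia.
      rewrite /= !mul0r add0r mul1r.
      case: (posnP i) => [->|i0] /=; first by rewrite orbF mulr0 mul0r addr0.
      rewrite (_ : (i == i.-1 :> nat) = false) /=; last by move: i0; clear; lia.
      by rewrite orbF !mul0r addr0.
    rewrite mul0r add0r /=.
    have [->|ji1] := eqVneq j i.+1.
      rewrite (_ : (i.+1 == i.-1 :> nat) = false); last by clear; lia.
      by rewrite andbF /= orbF !mul0r addr0 mul1r; case: exit; case: (t == _); rewrite /= ?mul1r ?mul0r.
    rewrite /= !mul0r add0r.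
    by case: (_ < _)%N; case: (j == _); case: (s == _ :> nat); case: (exit t); rewrite /= ?mul1r ?mul0r.
  rewrite !big_split /= (sum_pick R P i (fun j => \sum_(0 <= t < D) (clique_edge s t)%:R * gm j t)).
  rewrite (sum_pick R P i.+1 (fun j => (exit s)%:R * gm j 0%N)).
  rewrite (sum_pick R P i.-1 (fun j => ((0 < i)%N && (s == 0 :> nat)%N)%:R * \sum_(0 <= t < D) (exit t)%:R * gm j t)).
  rewrite ltn_ord mul1r (_ : (i.-1 < P)%N); last by have := ltn_ord i; clear; lia.
  by rewrite mul1r addrA mulrA -natrM mulnb.
have lt_r2 : (2 * (s - (D - c)) < r2)%N.
  by have := ltn_ord s; move: r2c c_gt0; clear; lia.
transitivity (\sum_(0 <= q < r2) ((i.+1 == P) && exit s)%:R *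
    ((q == 2 * (s - (D - c)))%N%:R * gr q)).
  apply: eq_bigr => q _; rewrite /out_edge.
  by case: (_ == P); case: exit; case: (q == _); rewrite /= ?mul1r ?mul0r.
by rewrite -mulr_sumr (sum_pick R r2 (2 * (s - (D - c)))%N gr) lt_r2 mul1r.
Qed.

(** A copy has three types of vertices: vertex 0, [d - c] ordinary vertices and [c] exits. *)
Lemma sum_types (psi : nat -> R) B C :
  (forall s, (0 < s < D - c)%N -> psi s = B) -> (forall s, (D - c <= s < D)%N -> psi s = C) ->
  \sum_(0 <= s < D) psi s = psi 0%N + (d - c)%:R * B + c%:R * C.
Proof.
move=> hB hC; rewrite big_ltn // (@big_cat_nat _ _ _ (D - c)) //=; last 2 first.
- by move: c_lt; clear; lia.
- by clear; lia.
rewrite addrA; congr (_ + _ + _).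
  rewrite big_nat (eq_bigr (fun=> B)) => [|s /hB //]; rewrite -big_nat sumr_const_nat.
  by rewrite mulr_natl; congr (_ *+ _); move: c_lt; clear; lia.
rewrite big_nat (eq_bigr (fun=> C)) => [|s /hC //]; rewrite -big_nat sumr_const_nat.
by rewrite mulr_natl; congr (_ *+ _); move: c_lt; clear; lia.
Qed.

Lemma sum_exit (V : nat -> R) C : (forall s, (D - c <= s < D)%N -> V s = C) ->
  \sum_(0 <= s < D) (exit s)%:R * V s = c%:R * C.
Proof.
move=> hC; rewrite (sum_types _ 0 C); last 2 first.
- by move=> s hs; rewrite (_ : exit s = false) ?mul0r //; move: hs; rewrite /exit; clear; lia.
- by move=> s hs; rewrite hC // /exit; case/andP: hs => -> _; rewrite mul1r.
by rewrite (_ : exit 0 = false) ?mul0r ?mulr0 ?add0r //; move: c_lt; rewrite /exit; clear; lia.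
Qed.

Lemma sum_port r : (2 * c <= r)%N -> \sum_(0 <= p < r) (port p)%:R = c%:R :> R.
Proof.
move=> rc; rewrite (@big_cat_nat _ _ _ (2 * c)) //= [X in _ + X]big_nat [X in _ + X]big1 ?addr0; last first.
  by move=> p /andP[cp _]; rewrite /port ltnNge cp.
transitivity (\sum_(0 <= p < 2 * c) (~~ odd p)%:R : R).
  by rewrite !big_nat; apply: eq_bigr => p /andP[_ pc]; rewrite /port pc.
elim: (c) => [|k IH]; first by rewrite big_geq.
rewrite (_ : (2 * k.+1 = (2 * k).+2)%N); last by clear; lia.
rewrite !big_nat_recr //= IH (_ : odd (2 * k) = false); last by clear; lia.
by rewrite /= addr0 natr1.
Qed.

Definition chain_deg (x : chainV) : R := \sum_y (chain_edge x y)%:R.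

Lemma chain_degE x : chain_deg x = \sum_y (chain_edge x y)%:R *
  chain_fun _ (fun=> 1) (fun _ _ => 1) (fun=> 1) y.
Proof. by apply: eq_bigr => y _; case: y => [[|[]]|] *; rewrite /= mulr1. Qed.

Lemma chain_deg_left (p : 'I_r1) :
  chain_deg (inl (inl p)) = \sum_(0 <= q < r1) (H1 p q)%:R + (port p)%:R.
Proof.
rewrite chain_degE row_left mulr1; congr (_ + _).
by apply: eq_bigr => q _; rewrite mulr1.
Qed.

Lemma chain_deg_right (q : 'I_r2) :
  chain_deg (inr q) = \sum_(0 <= q' < r2) (H2 q q')%:R + (port q)%:R.
Proof.
rewrite chain_degE row_right addrC; congr (_ + _).
  by apply: eq_bigr => q' _; rewrite mulr1.
transitivity (\sum_(0 <= s < D) (s == D - c + q./2)%N%:R * (~~ odd q)%:R : R).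
  rewrite !big_nat; apply: eq_bigr => s /andP[_ sD]; rewrite mulr1 -natrM mulnb; congr (_%:R).
  by congr nat_of_bool; rewrite /exit; move: c_lt sD; clear; lia.
rewrite (sum_pick R D _ (fun=> (~~ odd q)%:R)) -natrM mulnb; congr (_%:R).
by congr nat_of_bool; rewrite /port; move: c_lt; clear; lia.
Qed.

Lemma sum_clique_edge (s : 'I_D) :
  \sum_(0 <= t < D) (clique_edge s t)%:R = d%:R - (s == 0 :> nat)%N%:R * c%:R - (exit s)%:R :> R.
Proof.
transitivity (\sum_(0 <= t < D) (1 - (t == s)%N%:R * 1 -
    ((s == 0 :> nat)%N%:R * ((exit t)%:R * 1) + (t == 0)%N%:R * (exit s)%:R)) : R).
  rewrite !big_nat; apply: eq_bigr => t /andP[_ tD]; rewrite !mulr1.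
  rewrite /clique_edge.
  have e0 : exit 0 = false by move: c_lt; rewrite /exit; clear; lia.
  have [->|ts] := eqVneq t s.
    have [->|s0] := eqVneq (s : nat) 0%N; rewrite ?eqxx ?e0 ?eqxx /= ?mulr0n ?mulr1n; lra.
  have [s0|s0] := eqVneq (s : nat) 0%N; have [t0|t0] := eqVneq t 0%N.
  - by move: ts; rewrite s0 t0 eqxx.
  - by rewrite s0 e0; case: exit; rewrite /= ?mulr0n ?mulr1n; lra.
  - by rewrite t0 e0; case: exit; rewrite /= ?mulr0n ?mulr1n; lra.
  - by rewrite /= andbF ?mulr0n ?mulr1n !mul0r; lra.
rewrite !big_split /= !sumrN big_split /= -mulr_sumr.
rewrite (sum_pick R D s (fun=> 1)) (sum_pick R D 0 (fun=> (exit s)%:R)).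
rewrite (sum_exit (fun=> 1) 1) // sumr_const_nat subn0 ltn_ord /= mul1r !mulr1.
by rewrite -(natr1 d); lra.
Qed.

Lemma chain_deg_mid (i : 'I_P) (s : 'I_D) : chain_deg (inl (inr (i, s))) = d%:R.
Proof.
rewrite chain_degE row_mid /= !mulr1.
rewrite [X in _ * X + _](_ : _ = c%:R); last first.
  by rewrite -(sum_port r1) //; apply: eq_bigr => p _; rewrite mulr1.
rewrite [X in _ + (X + _ + _) + _](_ : _ = \sum_(0 <= t < D) (clique_edge s t)%:R); last first.
  by apply: eq_bigr => t _; rewrite mulr1.
rewrite (sum_exit (fun=> 1) 1) // sum_clique_edge mulr1.
have iP := ltn_ord i.
have -> : (i.+1 == P) = ~~ (i.+1 < P)%N by move: iP; clear; lia.
rewrite lt0n; case: (i == 0 :> nat)%N; case: (s == 0 :> nat)%N; case: (exit s); case: (i.+1 < P)%N;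
  rewrite /= ?mul1r ?mul0r; lra.
Qed.

(* Linear in the electrical potential inside every period: the links between
   consecutive layers have resistances 1/(d-c), 1/(c(d-c)) and 1/c. *)
Definition weight (s : nat) : R :=
  if s == 0%N then 0 else if exit s then c.+1%:R / D%:R else c%:R / D%:R.

Definition interp (F : nat -> R) (i s : nat) : R := F i + weight s * (F i.+1 - F i).

Definition chain_test (F : nat -> R) : chainV -> R :=
  chain_fun _ (fun=> F 0%N) (interp F) (fun=> F P).

Lemma weight_ge0 s : 0 <= weight s.
Proof. by rewrite /weight; case: ifP => // _; case: ifP => _; rewrite divr_ge0. Qed.

Lemma weight_le1 s : weight s <= 1.
Proof.
rewrite /weight; case: ifP => // _; case: ifP => _; rewrite ler_pdivrMr ?ltr0n // mul1r ler_nat.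
  by move: c_lt; clear; lia.
by move: c_lt; clear; lia.
Qed.

Lemma weight_mid s : (0 < s < D - c)%N -> weight s = c%:R / D%:R.
Proof.
rewrite /weight /exit => /andP[s0 sD].
by rewrite gtn_eqF // leqNgt sD.
Qed.

Lemma weight_exit s : (D - c <= s)%N -> weight s = c.+1%:R / D%:R.
Proof.
rewrite /weight /exit => sD.
by rewrite sD gtn_eqF //; move: sD c_lt; clear; lia.
Qed.

Lemma exit0 : exit 0 = false.
Proof. by move: c_lt; rewrite /exit; clear; lia. Qed.

Lemma exit_weight s : (exit s)%:R * (1 - weight s) ^+ 2 = (exit s)%:R * ((d - c)%:R / D%:R) ^+ 2.
Proof.
have [es|] := boolP (exit s); last by rewrite !mul0r.
rewrite !mul1r weight_exit //; congr (_ ^+ 2).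
rewrite -[X in X - _](@divff _ D%:R) ?pnatr_eq0 // -mulrBl -natrB ?ltnS ?(ltnW c_lt) //.
Qed.

Lemma clique_energy : \sum_(0 <= s < D) \sum_(0 <= t < D)
   (clique_edge s t)%:R * (weight s - weight t) ^+ 2 =
  2 * ((d - c)%:R * (c%:R / D%:R) ^+ 2 + (d - c)%:R * c%:R * D%:R ^- 2).
Proof.
have e0 := exit0.
have w0 : weight 0 = 0 by [].
have hm t : (0 < t < D - c)%N -> exit t = false /\ (t == 0)%N = false.
  by rewrite /exit; clear; lia.
have he t : (D - c <= t < D)%N -> exit t = true /\ (t == 0)%N = false.
  by move: c_lt; rewrite /exit; clear; lia.
have wd : (c.+1%:R / D%:R - c%:R / D%:R) ^+ 2 = D%:R ^- 2 :> R.
  by rewrite -mulrBl -natr1 addrAC subrr add0r mul1r exprVn.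
have same s t : weight s = weight t -> (clique_edge s t)%:R * (weight s - weight t) ^+ 2 = 0.
  by move=> ->; rewrite subrr expr0n mulr0.
rewrite (sum_types _ ((c%:R / D%:R) ^+ 2 + c%:R * D%:R ^- 2) ((d - c)%:R * D%:R ^- 2)); first last.
- move=> s hs; have [es s0] := he s hs; have ws := weight_exit s (proj1 (andP hs)).
  rewrite (sum_types _ (D%:R ^- 2) 0); first last.
  + by move=> t /andP[ht _]; apply: same; rewrite ws weight_exit.
  + move=> t ht; have [et t0] := hm t ht; rewrite ws weight_mid // wd.
    rewrite /clique_edge es t0 et s0 (_ : (s == t) = false) ?mul1r //.
    by move: hs ht; clear; lia.
  have -> : clique_edge s 0 = false by rewrite /clique_edge es eqxx !andbF.
  by rewrite mul0r mulr0 addr0 add0r.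
- move=> s hs; have [es s0] := hm s hs; have ws := weight_mid s hs.
  rewrite (sum_types _ 0 (D%:R ^- 2)); first last.
  + move=> t ht; have [et t0] := he t ht; rewrite ws weight_exit ?(proj1 (andP ht)) //.
    rewrite -sqrrN opprB wd /clique_edge es t0 et s0 (_ : (s == t) = false) ?mul1r //.
    by move: hs ht; clear; lia.
  + by move=> t ht; apply: same; rewrite ws weight_mid.
  have -> : clique_edge s 0 = true by rewrite /clique_edge es e0 s0.
  by rewrite mul1r ws w0 subr0 mulr0 addr0.
rewrite (sum_types _ ((c%:R / D%:R) ^+ 2) 0); first last.
- by move=> t ht; have [et t0] := he t ht; rewrite (_ : clique_edge 0 t = false) ?mul0r // /clique_edge et /= andbF.
- move=> t ht; have [et t0] := hm t ht; rewrite (weight_mid t) // w0 sub0r sqrrN.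
  by rewrite /clique_edge et e0 eq_sym t0 mul1r.
rewrite same // add0r mulr0 addr0.
by move: (c%:R / D%:R) (D%:R ^- 2) ((d - c)%:R) => u v b; lra.
Qed.

Lemma chain_energy F :
  \sum_x \sum_y (chain_edge x y)%:R * (chain_test F x - chain_test F y) ^+ 2 =
  2 * ((d - c)%:R * c%:R / D%:R) * \sum_(0 <= i < P) (F i.+1 - F i) ^+ 2.
Proof.
pose De i := F i.+1 - F i.
(* The squared fraction of the drop of a period that falls on an edge leaving the copy, by
   [exit_weight]. *)
pose Z := ((d - c)%:R / D%:R : R) ^+ 2.
have VE (a : R) y : (a - chain_test F y) ^+ 2 = chain_fun _ (fun=> (a - F 0%N) ^+ 2)
    (fun j t => (a - interp F j t) ^+ 2) (fun=> (a - F P) ^+ 2) y.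
  by case: y => [[|[]]|].
have i0 i : interp F i 0 = F i by rewrite /interp /weight /= mul0r addr0.
have rowE x : \sum_y (chain_edge x y)%:R * (chain_test F x - chain_test F y) ^+ 2 =
  chain_fun _ (fun=> 0)
    (fun i s => De i ^+ 2 * \sum_(0 <= t < D) (clique_edge s t)%:R * (weight s - weight t) ^+ 2
      + Z * De i ^+ 2 * (exit s)%:R
      + (s == 0)%N%:R * ((0 < i)%N%:R * (c%:R * Z * De i.-1 ^+ 2)))
    (fun q => Z * De P.-1 ^+ 2 * \sum_(0 <= s < D) (exit s && (q == 2 * (s - (D - c)))%N)%:R) x.
  under eq_bigr => y _ do rewrite VE.
  case: x => [[p|[i s]]|q].
  - rewrite row_left /= i0 subrr expr0n /= mulr0 addr0.
    by rewrite big1 // => q _; rewrite mulr0.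
  - rewrite row_mid /=.
    have -> : ((i == 0 :> nat)%N && (s == 0 :> nat)%N)%:R *
        \sum_(0 <= p < r1) (port p)%:R * (interp F i s - F 0%N) ^+ 2 = 0.
      have [->|_] := eqVneq (i : nat) 0%N; last by rewrite mul0r.
      have [->|_] := eqVneq (s : nat) 0%N; last by rewrite mul0r.
      by rewrite big1 ?mulr0 // => p _; rewrite i0 subrr expr0n mulr0.
    have -> : \sum_(0 <= t < D) (clique_edge s t)%:R * (interp F i s - interp F i t) ^+ 2 =
        De i ^+ 2 * \sum_(0 <= t < D) (clique_edge s t)%:R * (weight s - weight t) ^+ 2.
      rewrite mulr_sumr; apply: eq_bigr => t _.
      by rewrite /interp -/(De i) (_ : _ - _ = De i * (weight s - weight t)) ?exprMn; lra.
    have exE : (exit s)%:R * (interp F i s - F i.+1) ^+ 2 = Z * De i ^+ 2 * (exit s)%:R.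
      rewrite (_ : interp F i s - F i.+1 = - (De i * (1 - weight s))); last first.
        by rewrite /interp /De; lra.
      rewrite sqrrN exprMn; have := exit_weight s; rewrite -/Z => E.
      by rewrite mulrCA E; lra.
    have -> : ((0 < i)%N && (s == 0 :> nat)%N)%:R *
        \sum_(0 <= t < D) (exit t)%:R * (interp F i s - interp F i.-1 t) ^+ 2 =
        (s == 0 :> nat)%N%:R * ((0 < i)%N%:R * (c%:R * Z * De i.-1 ^+ 2)).
      have [si|_] := eqVneq (s : nat) 0%N; last by rewrite andbF !mul0r.
      have [ii|ii] := posnP (i : nat); first by rewrite !mul0r mulr0.
      rewrite !mul1r si i0 (sum_exit _ (Z * De i.-1 ^+ 2)) ?mulrA // => t /andP[ht _].
      have := exit_weight t; rewrite -/Z /exit ht !mul1r => <-.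
      by rewrite /interp /De prednK // -mulrA -exprMn; congr (_ ^+ 2); lra.
    rewrite i0; have iP := ltn_ord i.
    have [ip|ip] := boolP (i.+1 < P)%N.
      by rewrite (_ : (i.+1 == P) = false) ?mul0r ?exE ?add0r ?addr0 // ltn_eqF.
    have ->: F P = F i.+1 by congr F; move: ip iP; clear; lia.
    rewrite (_ : (i.+1 == P) = true); last by move: ip iP; clear; lia.
    by rewrite /= mul0r addr0 exE add0r addrAC.
  rewrite row_right /= [X in _ + X]big1 ?addr0; last by move=> *; rewrite subrr expr0n mulr0.
  rewrite mulr_sumr; apply: eq_bigr => s _.
  rewrite (_ : F P - _ = De P.-1 * (1 - weight s)); last first.
    by rewrite /interp /De prednK //; lra.
  have := exit_weight s; rewrite -/Z exprMn -!mulnb !natrM.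
  move: (exit s)%:R ((1 - weight s) ^+ 2) (De P.-1 ^+ 2) => x y v E.
  move: (_ == _)%:R => b; rewrite mulrCA mulrAC mulrA E; lra.
rewrite (eq_bigr _ (fun x _ => rowE x)) sum_chainV big1 ?add0r //.
have -> : \sum_(0 <= q < r2) Z * De P.-1 ^+ 2 *
    (\sum_(0 <= s < D) (exit s && (q == 2 * (s - (D - c)))%N)%:R) = c%:R * Z * De P.-1 ^+ 2.
  rewrite -mulr_sumr exchange_big_nat /=.
  rewrite (eq_big_nat _ _ (F2 := fun s => (exit s)%:R * 1)) => [|s /andP[_ sD]].
    by rewrite (sum_exit (fun=> 1) 1) //; lra.
  transitivity (\sum_(0 <= q < r2) (q == 2 * (s - (D - c)))%N%:R * (exit s)%:R : R).
    by apply: eq_bigr => q _; rewrite -natrM mulnb andbC.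
  rewrite (sum_pick R r2 _ (fun=> (exit s)%:R)) mulr1 (_ : (_ < r2)%N) ?mul1r //.
  by move: r2c c_gt0 sD; clear; lia.
transitivity (\sum_(0 <= i < P)
   ((2 * ((d - c)%:R * (c%:R / D%:R) ^+ 2 + (d - c)%:R * c%:R * D%:R ^- 2) + c%:R * Z) * De i ^+ 2 +
     (0 < i)%N%:R * (c%:R * Z * De i.-1 ^+ 2)) + c%:R * Z * De P.-1 ^+ 2).
  congr (_ + _); apply: eq_bigr => i _; rewrite !big_split /=.
  rewrite -mulr_sumr clique_energy (sum_pick R D 0 (fun=> (0 < i)%N%:R * (c%:R * Z * De i.-1 ^+ 2))) mul1r.
  congr (_ + _); rewrite -mulr_sumr (eq_bigr (fun s => (exit s)%:R * 1)) => [|s _]; last by rewrite mulr1.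
  rewrite (sum_exit (fun=> 1) 1) //.
  rewrite mulr1 [RHS]mulrDl [De i ^+ 2 * _]mulrC; congr (_ + _).
  by rewrite mulrC mulrA.
rewrite big_split /= -mulr_sumr -addrA.
have -> : \sum_(0 <= i < P) (0 < i)%N%:R * (c%:R * Z * De i.-1 ^+ 2) + c%:R * Z * De P.-1 ^+ 2 =
    c%:R * Z * \sum_(0 <= i < P) De i ^+ 2.
  case: (P) P_gt0 => // p _.
  rewrite big_nat_recl //= mul0r add0r big_nat_recr //= mulrDr mulr_sumr; congr (_ + _).
  by apply: eq_bigr => i _; rewrite mul1r.
rewrite -mulrDl; congr (_ * _).
have DE : D%:R = 1 + (d - c)%:R + c%:R :> R.
  by rewrite -addrA -natrD subnK ?(ltnW c_lt) // addrC natr1.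
have Dn : D%:R != 0 :> R by rewrite pnatr_eq0.
rewrite /Z -!exprVn !exprMn.
have E : D%:R * (D%:R^-1 ^+ 2) = D%:R^-1 :> R by rewrite expr2 mulrA divff ?mul1r.
rewrite -[in RHS]E; move: (D%:R^-1 ^+ 2) => v.
by rewrite DE !expr2; move: (d - c)%:R (c%:R) => x y; lra.
Qed.

Lemma chain_test_lin a b F F' x :
  chain_test (fun i => a * F i - b * F' i) x = a * chain_test F x - b * chain_test F' x.
Proof. by case: x => [[p|[i s]]|q] //=; rewrite /interp; lra. Qed.

Lemma interp_ge0 F i s : 0 <= F i -> 0 <= F i.+1 -> 0 <= interp F i s.
Proof.
move=> f0 f1; rewrite (_ : interp F i s = (1 - weight s) * F i + weight s * F i.+1).
  by rewrite addr_ge0 // mulr_ge0 ?weight_ge0 // subr_ge0 weight_le1.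
by rewrite /interp; lra.
Qed.

(** Interpolation between two values of the same sign does not go below the smaller absolute
    value. *)
Lemma interp_sqr_ge F i s m : m ^+ 2 <= F i ^+ 2 -> m ^+ 2 <= F i.+1 ^+ 2 ->
  0 <= F i * F i.+1 -> m ^+ 2 <= interp F i s ^+ 2.
Proof.
move=> h0 h1 h01; rewrite (_ : interp F i s = (1 - weight s) * F i + weight s * F i.+1);
  last by rewrite /interp; lra.
have := weight_ge0 s; have := weight_le1 s; move: (weight s) (F i) (F i.+1) h0 h1 h01 => w x y.
have [xy|xy] := lerP (x ^+ 2) (y ^+ 2) => h0 h1 h01 w1 w0.
  suff : x ^+ 2 <= ((1 - w) * x + w * y) ^+ 2 by lra.
  have h : x ^+ 2 <= x * y.
    rewrite -ler_sqr ?nnegrE ?sqr_ge0 //.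
    by have := ler_wpM2l (sqr_ge0 x) xy; rewrite !expr2; lra.
  have : 0 <= w * (x * y - x ^+ 2) by rewrite mulr_ge0 // subr_ge0.
  have : 0 <= w * (1 - w) * (x * y - x ^+ 2) by rewrite !mulr_ge0 // subr_ge0.
  have : 0 <= w * w * (y ^+ 2 - x ^+ 2) by rewrite !mulr_ge0 // subr_ge0.
  rewrite !expr2; lra.
suff : y ^+ 2 <= ((1 - w) * x + w * y) ^+ 2 by lra.
have h : y ^+ 2 <= x * y.
  rewrite -ler_sqr ?nnegrE ?sqr_ge0 //.
  by have := ler_wpM2l (sqr_ge0 y) (ltW xy); rewrite !expr2; lra.
have : 0 <= (1 - w) * (x * y - y ^+ 2) by rewrite mulr_ge0 // subr_ge0.
have : 0 <= w * (1 - w) * (x * y - y ^+ 2) by rewrite !mulr_ge0 // subr_ge0.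
have : 0 <= (1 - w) * (1 - w) * (x ^+ 2 - y ^+ 2) by rewrite !mulr_ge0 // subr_ge0 // ltW.
rewrite !expr2; lra.
Qed.

(** In the positive half a copy is bounded below by its right value, in the negative half by its
    left one. This loses [F 0] and [F P], which the end blocks restore, having at least [D] vertices
    each. *)
Lemma chain_sum_sqr F h : (h <= P)%N -> (D <= r1)%N -> (D <= r2)%N ->
  (forall i, (i < h)%N -> 0 <= F i.+1 /\ F i.+1 <= F i) ->
  (forall i, (h <= i < P)%N -> F i <= 0 /\ F i.+1 <= F i) ->
  D%:R * \sum_(0 <= i < P.+1) F i ^+ 2 <= \sum_x chain_test F x ^+ 2.
Proof.
move=> hP Dr1 Dr2 up down.
have -> : \sum_x chain_test F x ^+ 2 =
    \sum_x chain_fun _ (fun=> F 0%N ^+ 2) (fun i s => interp F i s ^+ 2) (fun=> F P ^+ 2) x.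
  by apply: eq_bigr => x _; case: x => [[|[]]|].
rewrite sum_chainV !sumr_const_nat !subn0 -[_ *+ r1]mulr_natl -[_ *+ r2]mulr_natl.
have rowlb m i : m ^+ 2 <= F i ^+ 2 -> m ^+ 2 <= F i.+1 ^+ 2 -> 0 <= F i * F i.+1 ->
    D%:R * m ^+ 2 <= \sum_(0 <= s < D) interp F i s ^+ 2.
  move=> a0 a1 a2; rewrite mulr_natl -[D in _ *+ D]subn0 -sumr_const_nat.
  by apply: ler_sum => s _; exact: interp_sqr_ge.
have lb : D%:R * (\sum_(0 <= i < h) F i.+1 ^+ 2 + \sum_(h <= i < P) F i ^+ 2) <=
    \sum_(0 <= i < P) \sum_(0 <= s < D) interp F i s ^+ 2.
  rewrite (@big_cat_nat _ _ _ h 0 P) //= mulrDr !mulr_sumr.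
  apply: lerD; apply: ler_sum_nat => i.
    move=> /andP[_ ih]; have [f0 f1] := up i ih; apply: rowlb => //.
    - by rewrite ler_sqr // nnegrE (le_trans f0).
    - by rewrite mulr_ge0 // (le_trans f0).
  move=> /down[f0 f1]; apply: rowlb => //.
  - by rewrite -sqrrN -[leRHS]sqrrN ler_sqr ?nnegrE ?oppr_ge0 ?lerN2 // (le_trans f1).
  - by rewrite mulr_le0 // (le_trans f1).
apply: (@le_trans _ _ (D%:R * F 0%N ^+ 2 + D%:R * (\sum_(0 <= i < h) F i.+1 ^+ 2 +
    \sum_(h <= i < P) F i ^+ 2) + D%:R * F P ^+ 2)); last first.
  apply: lerD; first apply: lerD => //; by rewrite ler_wpM2r ?sqr_ge0 // ler_nat.
rewrite -!mulrDr ler_wpM2l // big_nat_recr //= lerD2r.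
rewrite addrA (@big_cat_nat _ _ _ h 0 P) //= lerD2r.
have <- : \sum_(0 <= i < h.+1) F i ^+ 2 = F 0%N ^+ 2 + \sum_(0 <= i < h) F i.+1 ^+ 2.
  by rewrite big_nat_recl.
by rewrite [leRHS]big_nat_recr //= lerDl sqr_ge0.
Qed.

End Rows.

End Chain.

Lemma sum_sqr_diff (R : realFieldType) (F : nat -> R) p :
  \sum_(0 <= i < p.+1) (F i.+1 - F i) ^+ 2 =
  F p.+1 * (F p.+1 - F p) - F 0%N * (F 1%N - F 0%N) +
  \sum_(0 <= i < p) F i.+1 * (2 * F i.+1 - F i - F i.+2).
Proof.
elim: p => [|p IH]; first by rewrite big_nat1 big_geq // expr2; lra.
by rewrite big_nat_recr //= IH [in RHS]big_nat_recr //= !expr2; lra.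
Qed.

(** * The cosine test profile and the resulting bound for chains *)

Section CosineProfile.
Variables (R : realType) (h : nat) (a b : R).
Hypotheses (h_gt0 : (0 < h)%N) (a_ge0 : 0 <= a) (b_ge0 : 0 <= b).
Local Notation P := (2 * h)%N.

Definition angle : R := pi / P%:R.

(** The number of periods is even so that the cosine vanishes at [h]. Hence the two halves can be
    scaled independently, which makes the vertex sum 0 although the end blocks have different
    orders. *)
Definition profile (i : nat) : R := (if (i <= h)%N then a else b) * cos (i%:R * angle).

Lemma periods_gt0 : 0 < P%:R :> R.
Proof. by rewrite ltr0n muln_gt0. Qed.

Lemma periods_angle : P%:R * angle = pi.
Proof. by rewrite /angle mulrC divfK // gt_eqF // periods_gt0. Qed.

Lemma angle_half : h%:R * angle = pi / 2.
Proof. by have := periods_angle; rewrite natrM; lra. Qed.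

Lemma angle_gt0 : 0 < angle.
Proof. by rewrite divr_gt0 ?pi_gt0 // periods_gt0. Qed.

Lemma cos_angle_half : cos (h%:R * angle) = 0.
Proof. by rewrite angle_half cos_pihalf. Qed.

Lemma cos_angle_anti i j : (i <= j <= P)%N -> cos (j%:R * angle) <= cos (i%:R * angle).
Proof.
move=> /andP[ij jP].
have dom k : (k <= P)%N -> k%:R * angle \in `[0, pi].
  move=> kP; rewrite in_itv /= mulr_ge0 ?(ltW angle_gt0) //=.
  by rewrite -[leRHS]periods_angle ler_pM2r ?angle_gt0 // ler_nat.
have [->//|nij] := eqVneq i j; apply: ltW.
rewrite ltr_cos ?dom //; last exact: leq_trans jP.
by rewrite ltr_pM2r ?angle_gt0 // ltr_nat ltn_neqAle nij.
Qed.

Lemma profile_up i : (i < h)%N -> 0 <= profile i.+1 /\ profile i.+1 <= profile i.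
Proof.
move=> ih; rewrite /profile ih (ltnW ih); split.
  by rewrite mulr_ge0 // -cos_angle_half; apply: cos_angle_anti; clear -ih; lia.
by rewrite ler_wpM2l //; apply: cos_angle_anti; clear -ih; lia.
Qed.

Lemma profile_tail i : (h <= i)%N -> profile i = b * cos (i%:R * angle).
Proof.
rewrite /profile leq_eqVlt => /predU1P[<-|hi]; first by rewrite cos_angle_half !mulr0.
by rewrite leqNgt hi.
Qed.

Lemma profile_down i : (h <= i < P)%N -> profile i <= 0 /\ profile i.+1 <= profile i.
Proof.
move=> /andP[hi iP]; rewrite !profile_tail //; last exact: leqW; split.
  by rewrite mulr_ge0_le0 // -cos_angle_half; apply: cos_angle_anti; clear -hi iP; lia.
by rewrite ler_wpM2l //; apply: cos_angle_anti; clear -iP; lia.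
Qed.

Lemma cos_rec (i : nat) :
  2 * cos (i.+1%:R * angle) - cos (i%:R * angle) - cos (i.+2%:R * angle) =
  (2 - 2 * cos angle) * cos (i.+1%:R * angle).
Proof.
have -> : i.+2%:R * angle = i.+1%:R * angle + angle by rewrite -[i.+2%:R]natr1; lra.
have -> : i%:R * angle = i.+1%:R * angle - angle by rewrite -[i.+1%:R]natr1; lra.
by rewrite cosB cosD; lra.
Qed.

(** Summation by parts: the cosine recursion holds within each half, and at the node [h] the scales
    meet but the profile is 0. The two boundary terms carry only [1 - cos angle]. *)
Lemma profile_diff :
  \sum_(0 <= i < P) (profile i.+1 - profile i) ^+ 2 <=
  (2 - 2 * cos angle) * \sum_(0 <= i < P.+1) profile i ^+ 2.
Proof.
have [p pE] : exists p, P = p.+1 by exists P.-1; rewrite prednK // muln_gt0.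
rewrite pE sum_sqr_diff.
have lam0 : 0 <= 2 - 2 * cos angle by have := cos_le1 angle; lra.
have c0 : 0 <= 1 - cos angle by have := cos_le1 angle; lra.
have mid i : (i < p)%N -> profile i.+1 * (2 * profile i.+1 - profile i - profile i.+2) =
    (2 - 2 * cos angle) * profile i.+1 ^+ 2.
  move=> ip; have R0 := cos_rec i.
  have [ih|ih|ih] := ltngtP i.+1 h.
  - rewrite /profile ih (ltnW ih) (ltnW (ltnW ih)).
    by have := congr1 (fun t => a * a * cos (i.+1%:R * angle) * t) R0; rewrite /= !expr2; lra.
  - have hi : (h <= i)%N by [].
    rewrite !profile_tail ?(leqW, leq_trans hi) //.
    by have := congr1 (fun t => b * b * cos (i.+1%:R * angle) * t) R0; rewrite /= !expr2; lra.
  - have -> : profile i.+1 = 0 by rewrite profile_tail ih // cos_angle_half mulr0.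
    by rewrite mul0r expr0n mulr0.
rewrite (eq_big_nat _ _ (F2 := fun i => (2 - 2 * cos angle) * profile i.+1 ^+ 2)) => [|i /andP[_ ip]]; last exact: mid.
rewrite -mulr_sumr [X in _ <= _ * X]big_nat_recr // [X in _ <= _ * (X + _)]big_nat_recl //=.
set S := \sum_(_ <= _ < _) _.
have q0 : 0 <= profile 0 ^+ 2 by exact: sqr_ge0.
have q1 : 0 <= profile p.+1 ^+ 2 by exact: sqr_ge0.
have e0 : profile 0 - profile 1 = (1 - cos angle) * profile 0.
  by rewrite /profile leq0n h_gt0 mul0r cos0 mul1r; lra.
have e1 : profile p.+1 - profile p = (1 - cos angle) * profile p.+1.
  have hp : (h <= p)%N by move: pE h_gt0; clear; lia.
  rewrite !profile_tail ?leqW // -pE periods_angle cospi.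
  have -> : p%:R * angle = pi - angle by rewrite -periods_angle pE -natr1; lra.
  by rewrite cosB cospi sinpi; lra.
have -> : - (profile 0 * (profile 1 - profile 0)) = (1 - cos angle) * profile 0 ^+ 2.
  by rewrite -mulrN opprB e0 expr2; lra.
rewrite e1 (_ : _ * (_ * _) = (1 - cos angle) * profile p.+1 ^+ 2); last by rewrite expr2; lra.
have h1 : 0 <= (1 - cos angle) * profile 0 ^+ 2 by rewrite mulr_ge0.
have h2 : 0 <= (1 - cos angle) * profile p.+1 ^+ 2 by rewrite mulr_ge0.
lra.
Qed.

End CosineProfile.

(** The predicate [Q] on degrees is [leq d] or [eq^~ d], so that both classes share one
    construction. *)
Lemma chain_graph_exists (R : realType) (Q : nat -> Prop) d c h r1 r2 (H1 H2 : rel nat) :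
  (0 < c)%N -> (c < d)%N -> (0 < h)%N -> (2 * c <= d.+1)%N -> (d.+1 <= r1)%N -> (d.+1 <= r2)%N ->
  symmetric H1 -> symmetric H2 -> irreflexive H1 -> irreflexive H2 ->
  (forall p, (p.+1 < r1)%N -> H1 p.+1 p) -> (forall p, (p.+1 < r2)%N -> H2 p.+1 p) ->
  Q d -> (forall p, (p < r1)%N -> Q (\sum_(0 <= q < r1) H1 p q + port c p)%N) ->
  (forall p, (p < r2)%N -> Q (\sum_(0 <= q < r2) H2 p q + port c p)%N) ->
  exists G : sgraph (2 * h * d.+1 + r1 + r2)%N,
    [/\ connected_graph G, forall x, Q (deg G x) &
        alg_connectivity R G <= (d - c)%:R * c%:R * (pi / (2 * h * d.+1)%:R) ^+ 2].
Proof.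
move=> c0 cd h0 cD Dr1 Dr2 s1 s2 i1 i2 p1 p2 Qd Q1 Q2.
have r1c := leq_trans cD Dr1; have r2c := leq_trans cD Dr2.
set P := (2 * h)%N; have P0 : (0 < P)%N by rewrite muln_gt0.
rewrite -(card_chainV d c P r1 r2) //.
pose E := chain_edge d c P r1 r2 H1 H2.
have E_sym : symmetric E by exact: chain_edge_sym.
have E_irr : irreflexive E by exact: chain_edge_irr.
exists (transport_graph _ E E_sym E_irr); split.
- apply: (connected_transport _ E E_sym E_irr (chain_fun d P r1 r2 _ id
    (fun i s => r1 + i * d.+1 + s)%N (fun q => r1 + P * d.+1 + q)%N)).
    by move=> x; exact: chain_edge_down.
  have r1p : (0 < r1)%N by exact: leq_trans Dr1.
  move=> [[x|[i s]]|x] [[y|[j t]]|y] //= hx hy; try by clear -r1p hx hy; lia.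
  by congr (inl (inl _)); apply: val_inj; rewrite /= hx hy.
- move=> i; rewrite deg_transport; set x := enum_val i.
  have degE : (\sum_y E x y)%:R = chain_deg d c P r1 r2 H1 H2 R x by rewrite natr_sum.
  case: x degE => [[p|[j s]]|q] degE.
  + rewrite (_ : (\sum_y _)%N = \sum_(0 <= q < r1) H1 p q + port c p)%N; first exact: Q1.
    by apply/eqP; rewrite -(eqr_nat R) degE chain_deg_left // natrD natr_sum.
  + rewrite (_ : (\sum_y _)%N = d) //.
    by apply/eqP; rewrite -(eqr_nat R) degE chain_deg_mid.
  + rewrite (_ : (\sum_y _)%N = \sum_(0 <= q' < r2) H2 q q' + port c q)%N; first exact: Q2.
    by apply/eqP; rewrite -(eqr_nat R) degE chain_deg_right // natrD natr_sum.
have r1p : (0 < r1)%N by exact: leq_trans Dr1.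
pose test F := chain_test d c P r1 r2 R F.
(* The masses of the positive and the negative half; scaling each half by the mass of the other
   gives total sum 0. *)
pose X := \sum_x test (profile R h 1 0) x; pose Y := \sum_x test (fun i => - profile R h 0 1 i) x.
have profile_tail0 a b i : (h < i)%N -> profile R h a b i = b * cos (i%:R * angle R h).
  by move=> hi; rewrite profile_tail // ltnW.
have profile0 a b : profile R h a b 0 = a by rewrite /profile leq0n mul0r cos0 mulr1.
have profileP a b : profile R h a b P = - b.
  by rewrite profile_tail ?/P ?leq_pmull // (periods_angle R h) // cospi mulrN1.
have g_ge0 i : (i <= P)%N -> 0 <= profile R h 1 0 i.
  move=> iP; rewrite /profile; case: leqP => ih; last by rewrite mul0r.
  rewrite mul1r -(cos_angle_half R h) //; apply: cos_angle_anti => //.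
  by rewrite ih /P leq_pmull.
have k_ge0 i : (i <= P)%N -> 0 <= - profile R h 0 1 i.
  move=> iP; rewrite /profile; case: leqP => ih; first by rewrite mul0r oppr0.
  rewrite oppr_ge0 mul1r -(cos_angle_half R h) //; apply: cos_angle_anti => //.
  by rewrite (ltnW ih).
have test_ge0 F : (forall i, (i <= P)%N -> 0 <= F i) -> forall x, 0 <= test F x.
  move=> F0 [[p|[i s]]|q] /=; [exact: F0 | | exact: F0].
  by apply: interp_ge0 => //; apply: F0; rewrite ?ltn_ord // ltnW.
have X0 : 0 < X.
  rewrite /X (bigD1 (inl (inl (Ordinal r1p)))) //= profile0.
  by rewrite ltr_pwDl // sumr_ge0 // => x _; exact: test_ge0.
have r2p : (0 < r2)%N by exact: leq_trans Dr2.
have Y0 : 0 < Y.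
  rewrite /Y (bigD1 (inr (Ordinal r2p))) //= profileP opprK.
  by rewrite ltr_pwDl // sumr_ge0 // => x _; exact: test_ge0.
pose F := profile R h Y X.
have FE i : F i = Y * profile R h 1 0 i - X * - profile R h 0 1 i.
  by rewrite /F /profile; case: leqP => _; lra.
have testE x : test F x = Y * test (profile R h 1 0) x - X * test (fun i => - profile R h 0 1 i) x.
  rewrite -chain_test_lin; case: x => [[p|[i s]]|q] //=; rewrite /interp -?FE //.
set D := d.+1.
have D0 : 0 < D%:R :> R by rewrite ltr0n.
have sq := chain_sum_sqr d c P r1 r2 cd R F h (leq_pmull h (isT : (0 < 2)%N)) Dr1 Dr2
  (profile_up R h Y X h0 (ltW Y0)) (profile_down R h Y X h0 (ltW X0)).
set S := \sum_x _ in sq.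
have dif := profile_diff R h Y X h0.
apply: (@le_trans _ _ ((d - c)%:R * c%:R * (2 - 2 * cos (angle R h)) / D%:R ^+ 2)); last first.
  have -> : (pi / (P * D)%:R) ^+ 2 = angle R h ^+ 2 / D%:R ^+ 2.
    by rewrite natrM invfM mulrA expr_div_n.
  rewrite -mulrA ler_wpM2l ?mulr_ge0 // ler_wpM2r ?invr_ge0 ?sqr_ge0 //.
  by apply: one_sub_cos_le; apply: ltW; exact: angle_gt0.
have F0P : 0 < F 0%N ^+ 2 by rewrite /F profile0 exprn_gt0.
have SF : 0 < \sum_(0 <= i < P.+1) F i ^+ 2.
  by rewrite big_nat_recl // ltr_pwDl // sumr_ge0 // => i _; exact: sqr_ge0.
have Sp : 0 < S by apply: lt_le_trans sq; rewrite mulr_gt0.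
apply: (alg_connectivity_le R _ _ (fun i => test F (enum_val i))).
- rewrite (card_chainV d c P r1 r2) //; apply: leq_trans (leq_addl _ _).
  by apply: leq_trans Dr2; rewrite ltnS (leq_trans _ cd).
- rewrite (sum_transport _ _ (test F)) (eq_bigr _ (fun x _ => testE x)).
  by rewrite sumrB -!mulr_sumr -/X -/Y mulrC subrr.
- by rewrite (sum_transport _ _ (fun x => test F x ^+ 2)).
rewrite (energy_transport _ E E_sym E_irr R (test F)) (sum_transport _ _ (fun x => test F x ^+ 2)).
rewrite chain_energy // -/S -!mulrA ler_wpM2l // !mulrA.
rewrite -/D; apply: (@le_trans _ _ ((d - c)%:R * c%:R / D%:R * ((2 - 2 * cos (angle R h)) *
  (S / D%:R)))).
  rewrite ler_wpM2l ?divr_ge0 ?mulr_ge0 //; apply: le_trans dif _.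
  rewrite ler_wpM2l //.
  by rewrite ler_pdivlMr // mulrC.
by rewrite expr2 invfM !mulrA; lra.
Qed.

(** * End blocks, and chains of every large order *)

Lemma sum_interval a b n :
  (\sum_(0 <= t < n) (a <= t < b)%N)%N = (minn b n - minn a n)%N.
Proof.
elim: n => [|n IH]; first by rewrite big_geq //; clear; lia.
by rewrite big_nat_recr //= IH; clear; lia.
Qed.

Lemma sum_point (p : bool) a n : (\sum_(0 <= t < n) (p && (t == a)))%N = (p && (a < n)%N).
Proof.
elim: n => [|n IH]; first by rewrite big_geq // ltn0 andbF.
by rewrite big_nat_recr //= IH; clear; lia.
Qed.

(** Cyclic distance between 1 and [k] modulo [r]; the second and fourth disjuncts are the pairs that
    wrap around. *)
Definition circulant (r k : nat) : rel nat := fun s t =>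
  [|| (s < t <= s + k)%N, (s + r <= t + k)%N, (t < s <= t + k)%N | (t + r <= s + k)%N].

Lemma circulant_sym r k : symmetric (circulant r k).
Proof. by move=> s t; rewrite /circulant; clear; lia. Qed.

Lemma circulant_irr r k : (2 * k < r)%N -> irreflexive (circulant r k).
Proof. by move=> kr s; rewrite /circulant; lia. Qed.

Lemma circulant_deg r k s : (2 * k < r)%N -> (s < r)%N ->
  (\sum_(0 <= t < r) circulant r k s t)%N = (2 * k)%N.
Proof.
move=> kr sr.
transitivity (\sum_(0 <= t < r) ((s.+1 <= t < s + k.+1) + (s + r - k <= t < r) +
   (s - k <= t < s) + (0 <= t < s + k.+1 - r)))%N.
  rewrite !big_nat; apply: eq_bigr => t /andP[_ tr].
  by rewrite /circulant; move: kr sr tr; clear; lia.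
by rewrite !big_split !sum_interval /=; move: kr sr; clear; lia.
Qed.

(** The added [port c p] is the one edge that each port receives from the chain. *)
Definition end_block (Q : nat -> Prop) (c r : nat) : Prop := exists H : rel nat,
  [/\ symmetric H, irreflexive H, forall p, (p.+1 < r)%N -> H p.+1 p &
      forall p, (p < r)%N -> Q (\sum_(0 <= q < r) H p q + port c p)%N].

Lemma complete_block d r : (d.+1 <= r)%N -> end_block (leq d) 1 r.
Proof.
move=> dr; exists (fun s t => s != t); split.
- by move=> s t; rewrite eq_sym.
- by move=> s; rewrite eqxx.
- by move=> p _; rewrite eqn_leq ltnn.
move=> p pr; apply: leq_trans (leq_addr _ _).
rewrite (eq_big_nat _ _ (F2 := fun t => (0 <= t < p) + (p.+1 <= t < r)))%N => [|t /andP[_ tr]].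
  by rewrite big_split !sum_interval /=; move: dr pr; clear; lia.
by move: tr => /=; clear; lia.
Qed.

(* The circulant graph of degree d - 1 plus the near perfect matching
   t -- t + q for 1 <= t <= q, which misses only vertex 0. *)
Lemma odd_block d q : odd d -> (d < 2 * q)%N -> (2 < d)%N -> end_block (eq^~ d) 1 (2 * q).+1.
Proof.
move=> od dq d2; pose k := d./2; have dk : d = (2 * k).+1 by rewrite /k; move: od; clear; lia.
have kq : (k < q)%N by move: dq; rewrite dk; clear; lia.
have k0 : (0 < k)%N by move: d2; rewrite dk; clear; lia.
have kr : (2 * k < (2 * q).+1)%N by move: kq; clear; lia.
exists (fun s t => [|| circulant (2 * q).+1 k s t, (0 < s)%N && (t == s + q)%N |
  (0 < t)%N && (s == t + q)%N]); split.
- by move=> s t; rewrite circulant_sym [X in _ || X]orbC.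
- by move=> s; rewrite circulant_irr //=; move: kq; clear; lia.
- by move=> p _; rewrite /circulant; move: k0; clear; lia.
move=> p pr; rewrite (eq_big_nat _ _ (F2 := fun t => circulant (2 * q).+1 k p t +
   (((0 < p)%N && (t == p + q)) + ((q < p)%N && (t == p - q)))))%N => [|t /andP[_ tr]].
  rewrite !big_split /= circulant_deg // !sum_point dk /port.
  by move: pr; clear; lia.
by rewrite /circulant /=; move: kq pr tr; clear; lia.
Qed.

(** In the circulant graph of degree [d] the edge between the ports 0 and 2 is deleted to make room
    for their edges from the chain. *)
Lemma even_block d r : ~~ odd d -> (2 < d)%N -> (d < r)%N -> end_block (eq^~ d) 2 r.
Proof.
move=> ed d2 dr; pose k := d./2; have dk : d = (2 * k)%N by rewrite /k; move: ed; clear; lia.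
have kr : (2 * k < r)%N by rewrite -dk.
have k1 : (1 < k)%N by move: d2; rewrite dk; clear; lia.
exists (fun s t => [&& circulant r k s t, ~~ ((s == 0) && (t == 2)) & ~~ ((s == 2) && (t == 0))]%N); split.
- by move=> s t; rewrite circulant_sym; congr (_ && _); clear; lia.
- by move=> s; rewrite circulant_irr.
- by move=> p _; rewrite /circulant; move: k1; clear; lia.
move=> p pr; rewrite -[RHS]/d [RHS]dk -(circulant_deg r k p kr pr).
rewrite [in RHS](eq_big_nat _ _ (F2 := fun t =>
   [&& circulant r k p t, ~~ ((p == 0) && (t == 2)) & ~~ ((p == 2) && (t == 0))] +
   (((p == 0) && (t == 2)) + ((p == 2) && (t == 0)))))%N => [|t /andP[_ tr]].
  rewrite big_split /=; congr (_ + _)%N; rewrite big_split /= !sum_point /port.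
  by move: pr kr k1; clear; lia.
by rewrite /circulant; move: kr k1 pr tr; clear; lia.
Qed.

(** Two periods have [2 * (d + 1)] vertices; the remainder of [n - 2 * r0] modulo this number goes
    into the second block, whose order stays bounded. The equation for [n] is passed on so that the
    caller can determine the parity of that order. *)
Lemma chain_upper (R : realType) (Q : nat -> Prop) d c r0 (eta : R) :
  (0 < c)%N -> (c < d)%N -> (2 * c <= d.+1)%N -> (d.+1 <= r0)%N -> Q d -> end_block Q c r0 ->
  0 < eta -> exists n0, forall n, (n0 <= n)%N ->
  (forall h r, (r0 <= r)%N -> n = (2 * h * d.+1 + r0 + r)%N -> end_block Q c r) ->
  exists G : sgraph n, [/\ connected_graph G, forall x, Q (deg G x) &
    alg_connectivity R G <= ((d - c)%:R * c%:R + eta) * (pi ^+ 2 / n%:R ^+ 2)].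
Proof.
move=> c0 cd cD Dr Qd [H1 [s1 i1 p1 q1]] eta0.
set N : R := (d - c)%:R * c%:R.
have N0 : 0 < N by rewrite mulr_gt0 // ltr0n // subn_gt0.
have [t [t0 t1 tN]] : exists t : R, [/\ 0 < t, t <= 1 & 3 * N * t <= eta].
  have u0 : 0 < eta / (3 * N) by rewrite divr_gt0 // mulr_gt0.
  exists (Num.min 1 (eta / (3 * N))); rewrite lt_min ltr01 u0 ge_min lexx; split=> //.
  have : Num.min 1 (eta / (3 * N)) <= eta / (3 * N) by rewrite ge_min lexx orbT.
  have n3 : 0 < 3 * N by rewrite mulr_gt0.
  move=> /(ler_wpM2l (ltW n3)) tle; apply: le_trans tle _.
  by rewrite mulrCA divff ?mulr1 ?gt_eqF.
pose w := (2 * d.+1)%N; pose B := (2 * r0 + w)%N.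
have w0 : (0 < w)%N by [].
exists (B + (Num.bound (B%:R / t)).+1)%N => n nB hblock.
pose h := ((n - 2 * r0) %/ w)%N; pose r := (r0 + (n - 2 * r0) %% w)%N.
have dE := divn_eq (n - 2 * r0) w; have mE : ((n - 2 * r0) %% w < w)%N by rewrite ltn_mod.
have nE : n = (2 * h * d.+1 + r0 + r)%N.
  rewrite (_ : 2 * h * d.+1 = h * w)%N; last by rewrite /w; clear; lia.
  by move: dE nB; rewrite -/h /r /B; clear; lia.
have r0r : (r0 <= r)%N by rewrite leq_addr.
have [H2 [s2 i2 p2 q2]] := hblock h r r0r nE.
pose X := (2 * h * d.+1)%N.
have nX : (n <= X + B)%N by rewrite nE /B /r -/X; move: mE; clear; lia.
have XB : ((Num.bound (B%:R / t)).+1 <= X)%N by move: nX nB; clear; lia.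
have h0 : (0 < h)%N.
  by rewrite lt0n; apply/eqP => hh; move: XB; rewrite /X hh muln0 mul0n.
have Dr2 : (d.+1 <= r)%N by exact: leq_trans r0r.
have [G [conn dG muG]] := chain_graph_exists R Q d c h r0 r H1 H2 c0 cd h0 cD Dr Dr2
  s1 s2 i1 i2 p1 p2 Qd q1 q2.
rewrite -nE in G conn dG muG *.
exists G; split=> //; apply: le_trans muG _.
rewrite -/N -/X.
have Xr : 0 < X%:R :> R by rewrite ltr0n; exact: leq_trans XB.
have nr : 0 < n%:R :> R by rewrite ltr0n; move: nB; clear; lia.
have BX : B%:R <= t * X%:R.
  rewrite mulrC -ler_pdivrMr //; apply: ltW; apply: lt_le_trans (archi_boundP _) _.
    by rewrite divr_ge0 // ltW.
  by rewrite ler_nat ltnW.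
have nX' : n%:R <= (1 + t) * X%:R.
  have : n%:R <= (X + B)%:R :> R by rewrite ler_nat.
  rewrite natrD; lra.
rewrite expr_div_n [leLHS]mulrA [leRHS]mulrA.
rewrite ler_pdivrMr ?exprn_gt0 // [leRHS]mulrAC ler_pdivlMr ?exprn_gt0 //.
have n2 : n%:R ^+ 2 <= (1 + 3 * t) * X%:R ^+ 2.
  apply: (@le_trans _ _ (((1 + t) * X%:R) ^+ 2)).
    by rewrite ler_sqr // nnegrE ltW // (lt_le_trans nr).
  rewrite exprMn ler_wpM2r ?sqr_ge0 // expr2.
  have : 0 <= t * (1 - t) by apply: mulr_ge0; [exact: ltW | rewrite subr_ge0].
  lra.
have pp : 0 <= pi ^+ 2 :> R by exact: sqr_ge0.
have X2 : 0 <= X%:R ^+ 2 :> R by exact: sqr_ge0.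
have := ler_wpM2l (mulr_ge0 (ltW N0) pp) n2.
have := ler_wpM2l (mulr_ge0 pp X2) tN.
lra.
Qed.

(** * Existence of minima and the final asymptotics *)

Lemma sgraph_code_inj n : injective (fun G : sgraph n => [ffun p : 'I_n * 'I_n => G p.1 p.2]).
Proof.
move=> [e1 s1 i1] [e2 s2 i2] /= /ffunP E.
have e12 : e1 = e2 by apply/funext => x; apply/funext => y; have := E (x, y); rewrite !ffunE.
by case: _ / e12 s2 i2 E => s2 i2 _; congr SGraph; exact: Prop_irrelevance.
Qed.

(** The minimum is taken over the finite type of adjacency tables; tables of no graph in [C] are
    decoded to the default [G0]. *)
Lemma sgraph_minimum (R : realType) n (C : set (sgraph n)) (mu : sgraph n -> R) :
  C !=set0 -> exists2 G, C G & forall G', C G' -> mu G <= mu G'.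
Proof.
move=> [G0 CG0]; pose code (G : sgraph n) := [ffun p : 'I_n * 'I_n => G p.1 p.2].
pose dec t : sgraph n := if pselect (exists2 G, C G & code G = t) is left e
  then projT1 (cid2 e) else G0.
have Cdec t : C (dec t) by rewrite /dec; case: pselect => // e; case: (cid2 e).
have decK G : C G -> dec (code G) = G.
  move=> CG; rewrite /dec; case: pselect => [e|[]]; last by exists G.
  by case: (cid2 e) => G' CG' /= /sgraph_code_inj.
pose t0 := [arg min_(t < code G0) mu (dec t)]%O.
exists (dec t0) => // G CG; rewrite -[leRHS](congr1 mu (decK G CG)) /t0.
by case: arg_minP => // t _; apply.
Qed.

Lemma asymp_of_bounds (R : realType) (C : forall n, set (sgraph n)) (c : R) :
  (forall n, C n !=set0 -> (0 < n)%N) ->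
  (forall eta, 0 < eta -> exists n0, forall n, (n0 <= n)%N -> forall G : sgraph n, C n G ->
     (c - eta) * (pi ^+ 2 / n%:R ^+ 2) <= alg_connectivity R G) ->
  (forall eta, 0 < eta -> exists n0, forall n, (n0 <= n)%N -> C n !=set0 ->
     exists2 G : sgraph n, C n G &
     alg_connectivity R G <= (c + eta) * (pi ^+ 2 / n%:R ^+ 2)) ->
  min_alg_connectivity_asymp C c.
Proof.
move=> C0 low up.
pose m n : R := if pselect (C n !=set0) is left e
  then alg_connectivity R (projT1 (cid2 (sgraph_minimum R n (C n) (@alg_connectivity R n) e))) else 0.
have mP n : C n !=set0 -> is_minimum [set alg_connectivity R G | G in C n] (m n).
  move=> ne; rewrite /m; case: pselect => // e.
  case: (cid2 _) => G CG min /=; split; first by exists G.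
  by move=> _ [G' CG' <-]; exact: min.
have pn n : C n !=set0 -> 0 < pi ^+ 2 / n%:R ^+ 2 :> R.
  by move=> /C0 n0; rewrite divr_gt0 // exprn_gt0 ?pi_gt0 ?ltr0n.
exists (fun n => m n / (pi ^+ 2 / n%:R ^+ 2) - c); last first.
  by move=> n ne; rewrite addrC subrK divfK ?gt_eqF ?pn //; exact: mP.
apply/cvgrPdist_le => eta eta0.
have [n1 hn1] := low eta eta0; have [n2 hn2] := up eta eta0.
exists (maxn n1 n2) => // n /= hn ne.
have [n1n n2n] : (n1 <= n)%N /\ (n2 <= n)%N by move: hn; clear; lia.
have [[G CG mE] minm] := mP n ne; have p0 := pn n ne.
have l1 : (c - eta) <= m n / (pi ^+ 2 / n%:R ^+ 2).
  by rewrite ler_pdivlMr // -mE; exact: hn1.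
have l2 : m n / (pi ^+ 2 / n%:R ^+ 2) <= c + eta.
  have [G' CG' le] := hn2 n n2n ne; rewrite ler_pdivrMr //.
  by apply: le_trans le; apply: minm; exists G'.
rewrite sub0r normrN ler_norml; lra.
Qed.

(** Handshaking; the constant function merely fixes an enumeration of the vertices. *)
Lemma odd_regular_order (R : realType) d n (G : sgraph n) : odd d -> regular_class d G -> ~~ odd n.
Proof.
case: n G => [//|m] G od [_ _ degG].
pose e := redge R m G (fun=> 0).
have degE i : (i < m.+1)%N -> ecount e i i.+1 0 m.+1 = d by rewrite redge_deg.
have := ecount_self_even e m.+1 (redge_sym R m G _) (redge_irr R m G _).
by rewrite (ecount_regular m.+1 e d m.+1 degE) // oddM od andbT.
Qed.

Lemma min_degree_upper (R : realType) d (eta : R) : (3 <= d)%N -> 0 < eta ->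
  exists n0, forall n, (n0 <= n)%N -> @min_degree_class n d !=set0 ->
  exists2 G : sgraph n, min_degree_class d G &
    alg_connectivity R G <= (d%:R - 1 + eta) * (pi ^+ 2 / n%:R ^+ 2).
Proof.
move=> d3 eta0.
have c1 : (1 < d)%N by exact: ltnW.
have [n0 hn0] := chain_upper R (leq d) d 1 d.+1 eta isT c1 (leqW c1) (leqnn _) (leqnn _)
  (complete_block d d.+1 (leqnn _)) eta0.
exists (maxn n0 d.+1) => n hn _.
have [|G [conn dG muG]] := hn0 n (leq_trans (leq_maxl _ _) hn).
  by move=> h r dr _; exact: complete_block.
exists G; last by rewrite mulr1 natrB ?(leq_trans _ d3) // in muG.
by split=> //; exact: leq_trans (leq_maxr _ _) hn.
Qed.

Lemma regular_odd_upper (R : realType) d (eta : R) : (3 <= d)%N -> odd d -> 0 < eta ->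
  exists n0, forall n, (n0 <= n)%N -> @regular_class n d !=set0 ->
  exists2 G : sgraph n, regular_class d G &
    alg_connectivity R G <= (d%:R - 1 + eta) * (pi ^+ 2 / n%:R ^+ 2).
Proof.
move=> d3 od eta0.
have block r : (d.+2 <= r)%N -> odd r -> end_block (eq^~ d) 1 r.
  move=> dr or_; have -> : r = (2 * r./2).+1 by move: or_; clear; lia.
  by apply: odd_block => //; move: dr or_ od; clear; lia.
have c1 : (1 < d)%N by exact: ltnW.
have od2 : odd d.+2 by rewrite /= od.
have [n0 hn0] := chain_upper R (eq^~ d) d 1 d.+2 eta isT c1 (leqW c1) (leqnSn _) erefl
  (block _ (leqnn _) od2) eta0.
exists (maxn n0 d.+1) => n hn [G0 CG0].
have en := odd_regular_order R d n G0 od CG0.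
have [|G [conn dG muG]] := hn0 n (leq_trans (leq_maxl _ _) hn).
  (* The order [n] is even and the first block has odd order [d + 2], so the second order is odd, as
     [odd_block] requires. *)
  move=> h r dr nE; apply: block => //; move: en.
  by rewrite nE !oddD !oddM /= od; case: (odd r).
exists G; last by rewrite mulr1 natrB ?(leq_trans _ d3) // in muG.
by split=> //; exact: leq_trans (leq_maxr _ _) hn.
Qed.

Lemma regular_even_upper (R : realType) d (eta : R) : (3 <= d)%N -> ~~ odd d -> 0 < eta ->
  exists n0, forall n, (n0 <= n)%N -> @regular_class n d !=set0 ->
  exists2 G : sgraph n, regular_class d G &
    alg_connectivity R G <= (2 * (d%:R - 2) + eta) * (pi ^+ 2 / n%:R ^+ 2).
Proof.
move=> d3 ed eta0.
have c4 : (2 * 2 <= d.+1)%N by rewrite ltnS.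
have [n0 hn0] := chain_upper R (eq^~ d) d 2 d.+1 eta isT d3 c4 (leqnn _) erefl
  (even_block d d.+1 ed d3 (leqnn _)) eta0.
exists (maxn n0 d.+1) => n hn _.
have [|G [conn dG muG]] := hn0 n (leq_trans (leq_maxl _ _) hn).
  by move=> h r dr _; exact: even_block.
exists G; last by rewrite natrB ?(leq_trans _ d3) // [_ * 2]mulrC in muG.
by split=> //; exact: leq_trans (leq_maxr _ _) hn.
Qed.

Theorem theorem1p1 (R : realType) (d : nat) (hd : (3 <= d)%N) :
  min_alg_connectivity_asymp (fun n => @min_degree_class n d) (d%:R - 1 : R) /\
  min_alg_connectivity_asymp (fun n => @regular_class n d)
    (if odd d then d%:R - 1 else 2 * (d%:R - 2) : R).
Proof.
have reg_min n (G : sgraph n) : regular_class d G -> min_degree_class d G.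
  by case=> dn conn degG; split=> // x; rewrite degG.
split; [|case: ifP => [od|/negbT ed]]; apply: asymp_of_bounds.
- by move=> n [G [dn _ _]]; exact: leq_ltn_trans dn.
- by move=> eta; exact: min_degree_lower.
- by move=> eta; exact: min_degree_upper.
- by move=> n [G [dn _ _]]; exact: leq_ltn_trans dn.
- move=> eta eta0; have [n0 hn0] := min_degree_lower R d eta hd eta0.
  by exists n0 => n nn G CG; apply: hn0 => //; exact: reg_min.
- by move=> eta; exact: regular_odd_upper.
- by move=> n [G [dn _ _]]; exact: leq_ltn_trans dn.
- by move=> eta; exact: regular_even_lower.
- by move=> eta; exact: regular_even_upper.
Qed.
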